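(* Let $[T_1,\ldots,T_n]$ be a row contraction on a Hilbert space $\mathcal H$ and let $m,k\ge1$. (i) If $F_j=F_j(S_1,\ldots,S_n)\in M_m\otimes\mathcal A_n$ with $F_j(0)=0$, $j=1,\ldots,k$, then $$\omega\big(F_1(T_1,\ldots,T_n),\ldots,F_k(T_1,\ldots,T_n)\big)\le\omega(T_1,\ldots,T_n)\,\|[F_1,\ldots,F_k]\|,\qquad( * )$$ where $\omega$ is either the norm $\|[\,\cdot\,]\|$ of the row operator or the joint spectral radius. (ii) If $\mathcal A_n$ is replaced by $F_n^\infty$ in (i), then $( * )$ holds for any completely non-coisometric row contraction $[T_1,\ldots,T_n]$, in particular if $\|[T_1,\ldots,T_n]\|<1$. (iii) If $T_iT_j=T_jT_i$ for all $i,j=1,\ldots,n$, then (i) and (ii) remain true if $\mathcal A_n$ (resp. $F_n^\infty$) is replaced by the commutative algebra $\mathcal A_n^c$ (resp. $W_n^\infty$).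
   Context: $F^2(H_n)=\bigoplus_{k\ge0}H_n^{\otimes k}$ is the full Fock space of an $n$-dimensional Hilbert space $H_n$ with orthonormal basis $e_1,\ldots,e_n$ ($n$ a positive integer); $S_i\psi=e_i\otimes\psi$ are the left creation operators. $\mathbb F_n^+$ is the unital free semigroup on $g_1,\ldots,g_n$ with identity $g_0$; for $\alpha=g_{i_1}\cdots g_{i_k}$, $|\alpha|=k$, $T_\alpha=T_{i_1}\cdots T_{i_k}$, $e_\alpha=e_{i_1}\otimes\cdots\otimes e_{i_k}$; $T_{g_0}=I$, $e_{g_0}=1$. $\mathcal A_n$ (noncommutative disc algebra) and $F_n^\infty$ (noncommutative analytic Toeplitz algebra) are the norm closed, respectively WOT-closed, algebras generated by $S_1,\ldots,S_n,I$. $F_s^2(H_n)\subset F^2(H_n)$ is the symmetric Fock space, $B_i:=P_{F_s^2(H_n)}S_i|_{F_s^2(H_n)}$, $\mathcal A_n^c$ is the norm closed algebra generated by $B_1,\ldots,B_n,I$, and $W_n^\infty:=P_{F_s^2(H_n)}F_n^\infty|_{F_s^2(H_n)}$. $M_m$ denotes the $m\times m$ complex matrices; $M_m\otimes\mathcal A$ is the set of $m\times m$ matrices with entries in $\mathcal A$. For scalar $f$ in one of these algebras, $f(0):=\langle f1,1\rangle$; for matrices $F(0)$ and $F(T_1,\ldots,T_n)$ are defined entrywise. $\|[F_1,\ldots,F_k]\|$ is the norm of the row operator. $[T_1,\ldots,T_n]$, $T_i\in B(\mathcal H)$, is a row contraction if $\sum T_iT_i^*\le I$; it is completely non-coisometric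 (c.n.c.) if there is no $h\ne0$ with $\sum_{|\alpha|=k}\|T_\alpha^*h\|^2=\|h\|^2$ for all $k=1,2,\ldots$. $\|[T_1,\ldots,T_n]\|=\|\sum T_iT_i^*\|^{1/2}$. Functional calculi: for $f\in\mathcal A_n$ (resp. $\mathcal A_n^c$ with $T_i$ commuting), $f(T_1,\ldots,T_n)$ is the norm limit of $p_j(T_1,\ldots,T_n)$ for any polynomials with $p_j(S_1,\ldots,S_n)\to f$ (resp. $p_j(B_1,\ldots,B_n)\to f$) in norm (the limit exists and is independent of choice by the von Neumann inequality for row contractions). For $f\in F_n^\infty$ with $f1=\sum_\alpha a_\alpha e_\alpha$ and $T$ a c.n.c. row contraction, $f(T_1,\ldots,T_n):=\text{SOT-}\lim_{r\to1}\sum_{k=0}^\infty\sum_{|\alpha|=k}r^{|\alpha|}a_\alpha T_\alpha$. For $g\in W_n^\infty$ and $T$ c.n.c. with commuting entries, $g(T_1,\ldots,T_n):=f(T_1,\ldots,T_n)$ for any $f\in F_n^\infty$ with $P_{F_s^2(H_n)}f|_{F_s^2(H_n)}=g$ (independent of $f$). Joint spectral radius: $r(X_1,\ldots,X_k):=\lim_{q\to\infty}\left\|\sum_{|\alpha|=q}X_\alpha X_\alpha^*\right\|^{1/2q}$, $\alpha\in\mathbb F_k^+$. *)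

(* Defs.v *)
From HB Require Import structures.
From mathcomp Require Import all_boot all_order all_algebra.
From mathcomp Require Import ring lra complex.
From mathcomp Require Import all_classical all_reals.
From mathcomp Require Import ereal topology normedtype sequences esum exp.

Set Implicit Arguments.
Unset Strict Implicit.
Unset Printing Implicit Defensive.

Import Order.TTheory GRing.Theory Num.Theory.
Import numFieldNormedType.Exports.

Local Open Scope classical_set_scope.
Local Open Scope complex_scope.
Local Open Scope ring_scope.

HB.mixin Record NormedModule_isInnerProduct (R : realType) H
    & NormedModule R[i] H := {
  hdot : H -> H -> R[i] ;
  hdotP : forall (a : R[i]) (x y z : H),
    hdot (a *: x + y) z = a * hdot x z + hdot y z ;
  hdotC : forall x y : H, hdot x y = (hdot y x)^* ;
  hdotE : forall x : H, hdot x x = `|x| ^+ 2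
}.

#[short(type="preHilbertType")]
HB.structure Definition PreHilbert (R : realType) :=
  {H of NormedModule R[i] H & NormedModule_isInnerProduct R H}.

#[short(type="hilbertType")]
HB.structure Definition Hilbert (R : realType) :=
  {H of PreHilbert R H & Complete H}.

(* The norm of a normed module over R[i] takes its values in R[i]. *)
Definition hnorm (R : realType) (H : preHilbertType R) (x : H) : R :=
  complex.Re `|x|.

HB.factory Record Lmodule_isInnerProduct (R : realType) H
    & GRing.Lmodule R[i] H := {
  dot : H -> H -> R[i] ;
  dotP : forall (a : R[i]) (x y z : H),
    dot (a *: x + y) z = a * dot x z + dot y z ;
  dotC : forall x y : H, dot x y = (dot y x)^* ;
  dot_ge0 : forall x : H, 0 <= dot x x ;
  dot_eq0 : forall x : H, dot x x = 0 -> x = 0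
}.

HB.builders Context R H & Lmodule_isInnerProduct R H.

Let dotDl x y z : dot (x + y) z = dot x z + dot y z.
Proof. by rewrite -{1}[x]scale1r dotP mul1r. Qed.
Let dot0l z : dot 0 z = 0.
Proof. by apply: (addrI (dot 0 z)); rewrite -dotDl !addr0. Qed.
Let dotZl (a : R[i]) x z : dot (a *: x) z = a * dot x z.
Proof. by rewrite -[a *: x]addr0 dotP dot0l addr0. Qed.
Let dotDr x y z : dot z (x + y) = dot z x + dot z y.
Proof. by rewrite dotC dotDl rmorphD /= -!dotC. Qed.
Let dotZr (a : R[i]) x z : dot z (a *: x) = a^* * dot z x.
Proof. by rewrite dotC dotZl rmorphM /= -!dotC. Qed.

Let norm (x : H) : R[i] := (Num.sqrt (complex.Re (dot x x)))%:C.

Let Re_ge0 (z : R[i]) : 0 <= z -> 0 <= complex.Re z.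
Proof. by case: z => a b; rewrite lecE /= => /andP[]. Qed.

Let normE x : norm x ^+ 2 = dot x x.
Proof.
rewrite /norm -rmorphXn /= sqr_sqrtr ?Re_ge0 ?dot_ge0//.
by apply: RRe_real; apply: ger0_real; exact: dot_ge0.
Qed.
Let norm_ge0 x : 0 <= norm x.
Proof. by rewrite /norm ler0c sqrtr_ge0. Qed.

Let normrZ (l : R[i]) (x : H) : norm (l *: x) = `|l| * norm x.
Proof.
apply/eqP; rewrite -(@eqrXn2 _ 2)// ?mulr_ge0// exprMn !normE dotZl dotZr.
by rewrite mulrA normCK.
Qed.

Let normr0_eq0 x : norm x = 0 -> x = 0.
Proof. by move=> x0; apply: dot_eq0; rewrite -normE x0 expr0n. Qed.

Let CS x y : `|dot x y| <= norm x * norm y.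
Proof.
have [->|y0] := eqVneq y 0.
  by rewrite dotC dot0l conjC0 normr0 mulr_ge0.
have ny : 0 < dot y y.
  by rewrite lt_def dot_ge0 andbT; apply: contra_neq y0; exact: dot_eq0.
have conjyy : (dot y y)^* = dot y y by rewrite -dotC.
rewrite -(@ler_pXn2r _ 2)// ?nnegrE ?mulr_ge0// exprMn !normE normCK -dotC.
have [e ea eb] : exists2 e, e = - dot x y & e^* = - dot y x.
  by exists (- dot x y); rewrite // [dot y x]dotC; exact: rmorphN.
have := dot_ge0 (dot y y *: x + e *: y).
rewrite !(dotDl, dotDr, dotZl, dotZr) conjyy eb ea.
set a := dot x y; set b := dot y x; set c := dot y y; set d := dot x x.
rewrite [X in 0 <= X -> _](_ : _ = c * (d * c - a * b)); last by ring.
by rewrite pmulr_rge0// subr_ge0.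
Qed.

Let ler_normD x y : norm (x + y) <= norm x + norm y.
Proof.
rewrite -(@ler_pXn2r _ 2)// ?nnegrE ?addr_ge0// sqrrD !normE dotDl !dotDr.
rewrite addrA lerD2r -addrA lerD2l.
rewrite [dot y x]dotC [X in X <= _](addcJ (dot x y)) mulr_natl lerMn2r /=.
apply: le_trans (CS x y); apply: le_trans (normc_ge_Re _).
by rewrite lecR ler_norm.
Qed.

HB.instance Definition _ :=
  Lmodule_isNormed.Build R[i] H ler_normD normrZ normr0_eq0.

HB.instance Definition _ :=
  NormedModule_isInnerProduct.Build R H dotP dotC (fun x => esym (normE x)).

HB.end.

(* A fresh name for R[i], because the library already has an instance of
   complete space whose key is the regular module R^o of a realType. *)
Definition complex_line (R : realType) : Type := R[i]^o.

Section ComplexHilbert.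
Context (R : realType).

HB.instance Definition _ := NormedModule.copy (complex_line R) R[i]^o.

Let complex_cauchy_cvg (F : set_system (complex_line R)) :
  ProperFilter F -> cauchy F -> cvg F.
Proof.
move=> FF Fc.
have reim (f : R[i] -> R) : (forall x y, `|f x - f y|%:C <= `|x - y|) ->
    cvg (f @ F).
  move=> fP; apply: cauchy_cvg; apply/cauchy_ballP => e e0.
  have /cauchy_ballP/(_ e%:C) := Fc.
  rewrite ltcR => /(_ e0) [[A B] /= [FA FB] AB].
  exists (f @` A, f @` B) => /=.
    by split; [apply: filterS FA|apply: filterS FB] => x ?; exists x.
  move=> [_ _] /= [[x Ax <-] [y By <-]].
  have := AB (x, y) (conj Ax By); rewrite /ball /= => xy.
  by rewrite -ltcR (le_lt_trans (fP _ _) xy).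
have /cvg_ex[/= a Fa] : cvg (@complex.Re R @ F).
  apply: reim => x y; apply: le_trans (normc_ge_Re _).
  by case: x y => [? ?] [? ?].
have /cvg_ex[/= b Fb] : cvg (@complex.Im R @ F).
  apply: reim => -[x1 x2] [y1 y2]; rewrite normc_def lecR /=.
  by rewrite -sqrtr_sqr ler_sqrt ?addr_ge0 ?sqr_ge0// lerDr sqr_ge0.
apply/cvg_ex; exists (a +i* b); apply/(@cvgrPdist_lt _ (complex_line R)) => e e0.
have er : e \is Num.real by exact: gtr0_real.
have [r er' ] := complex_realP _ er; subst e.
have r0 : 0 < r by move: e0; rewrite ltcR.
have r2 : 0 < r / 2 by rewrite divr_gt0.
move/cvgrPdist_lt : Fa => /(_ _ r2) Fa; move/cvgrPdist_lt : Fb => /(_ _ r2) Fb.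
near=> z.
have zE (x : R[i]) :
    (a +i* b) - x = (a - complex.Re x)%:C + 'i%C * (b - complex.Im x)%:C.
  case: x => ? ?; apply/eqP; rewrite eq_complex /=.
  by rewrite !(mul0r, mul1r, mulr0, addr0, add0r, subr0, oppr0) !eqxx.
rewrite zE.
apply: le_lt_trans (ler_normD _ _) _; rewrite normrM.
have -> : `|'i%C : R[i]| = 1.
  by rewrite normc_def /= expr0n/= expr1n add0r sqrtr1.
rewrite mul1r !normc_def /= !expr0n /= !addr0 !sqrtr_sqr -rmorphD ltcR.
rewrite [r]splitr ltrD//.
  by near: z; exact: Fa.
by near: z; exact: Fb.
Unshelve. all: by end_near. Qed.

HB.instance Definition _ :=
  Uniform_isComplete.Build (complex_line R) complex_cauchy_cvg.

Let cdot (x y : complex_line R) : R[i] := x * y^*.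

Let cdotP a x y z : cdot (a *: x + y) z = a * cdot x z + cdot y z.
Proof. by rewrite /cdot mulrDl -[a *: x]/(a * x) mulrA. Qed.

Let cdotC x y : cdot x y = (cdot y x)^*.
Proof. by rewrite /cdot rmorphM /= conjCK mulrC. Qed.

Let cdotE (x : complex_line R) : cdot x x = `|x| ^+ 2.
Proof. by rewrite /cdot -normCK. Qed.

HB.instance Definition _ :=
  NormedModule_isInnerProduct.Build R (complex_line R) cdotP cdotC cdotE.

End ComplexHilbert.

Definition abs_summable (R : realType) (I : choiceType) (f : I -> R) :=
  summable [set: I] (EFin \o f).

(* psum is meant for nonnegative families, rsum and csum for absolutely
   summable ones. *)
Definition psum (R : realType) (I : choiceType) (f : I -> R) : R :=
  fine (\esum_(i in [set: I]) (f i)%:E).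

Definition rsum (R : realType) (I : choiceType) (f : I -> R) : R :=
  psum (fun i => Num.max (f i) 0) - psum (fun i => Num.max (- f i) 0).

Definition csum (R : realType) (I : choiceType) (f : I -> R[i]) : R[i] :=
  rsum (fun i => complex.Re (f i)) +i* rsum (fun i => complex.Im (f i)).

Section Sums.
Context (R : realType) (I : choiceType).
Implicit Types (f g h : I -> R).

Lemma abs_summableE f :
  abs_summable f <-> (\esum_(i in [set: I]) (`|f i|)%:E < +oo)%E.
Proof. by []. Qed.

Lemma abs_summable_le f g : (forall i, `|f i| <= g i) ->
  abs_summable g -> abs_summable f.
Proof.
move=> fg; apply: le_lt_trans; apply: le_esum => i _ /=.
by rewrite lee_fin (le_trans (fg i))// ler_norm.
Qed.

Lemma abs_summableD f g : abs_summable f -> abs_summable g ->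
  abs_summable (fun i => f i + g i).
Proof. exact: summableD. Qed.

Lemma abs_summableN f : abs_summable f -> abs_summable (fun i => - f i).
Proof. by rewrite /abs_summable summableN. Qed.

Lemma esum_psum f : (forall i, 0 <= f i) -> abs_summable f ->
  \esum_(i in [set: I]) (f i)%:E = (psum f)%:E.
Proof.
move=> f0 fs; rewrite /psum fineK// fin_numElt; apply/andP; split.
  by rewrite (lt_le_trans (ltNyr 0))//; apply: esum_ge0 => i _; rewrite lee_fin.
by apply: le_lt_trans fs; apply: le_esum => i _ /=; rewrite lee_fin ler_norm.
Qed.

Lemma psum_ge0 f : (forall i, 0 <= f i) -> 0 <= psum f.
Proof.
by move=> f0; apply: fine_ge0; apply: esum_ge0 => i _; rewrite lee_fin.
Qed.

Lemma eq_psum f g : f =1 g -> psum f = psum g.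
Proof. by move=> /funext ->. Qed.

Lemma psumD f g : (forall i, 0 <= f i) -> (forall i, 0 <= g i) ->
  abs_summable f -> abs_summable g ->
  psum (fun i => f i + g i) = psum f + psum g.
Proof.
move=> f0 g0 fs gs; apply: EFin_inj; rewrite EFinD -!esum_psum//.
- by rewrite -esumD// => i _; rewrite lee_fin.
- by move=> i; rewrite addr_ge0.
- exact: abs_summableD.
Qed.

Lemma psum_le_esum f (x : R) : (forall i, 0 <= f i) ->
  (forall s : seq I, uniq s -> \sum_(i <- s) f i <= x) ->
  (\esum_(i in [set: I]) (f i)%:E <= x%:E)%E.
Proof.
move=> f0 fx; apply: ge_ereal_sup => _ [A [finA _] <-].
by rewrite fsbig_finite//= sumEFin lee_fin fx// fset_uniq.
Qed.

Lemma sum_le_psum f (s : seq I) : (forall i, 0 <= f i) -> abs_summable f ->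
  uniq s -> \sum_(i <- s) f i <= psum f.
Proof.
move=> f0 fs us; rewrite -lee_fin -esum_psum//; apply: esum_ge.
exists [set` s]; first by split.
by rewrite -sumEFin fsbig_seq.
Qed.

Lemma esumZ (c : R) f : 0 <= c -> (forall i, 0 <= f i) ->
  \esum_(i in [set: I]) (c * f i)%:E =
  (c%:E * \esum_(i in [set: I]) (f i)%:E)%E.
Proof.
move=> c0 f0; rewrite /esum -ereal_supZl//; last first.
  by apply/set0P; exists 0%E; exists set0; rewrite ?fsbig_set0//; split.
congr ereal_sup; rewrite image_comp; apply: eq_imagel => A _ /=.
by rewrite ge0_mule_fsumr// => i; rewrite lee_fin.
Qed.

Lemma abs_summableZ (c : R) f : abs_summable f ->
  abs_summable (fun i => c * f i).
Proof.
rewrite !abs_summableE => fs; under eq_esum do rewrite normrM.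
by rewrite esumZ// lte_mul_pinfty ?lee_fin// esum_ge0.
Qed.

Lemma psumZ (c : R) f : 0 <= c -> (forall i, 0 <= f i) -> abs_summable f ->
  psum (fun i => c * f i) = c * psum f.
Proof. by move=> c0 f0 fs; rewrite {1}/psum esumZ// esum_psum. Qed.

Let p f i := Num.max (f i) 0.
Let m f i := Num.max (- f i) 0.

Let p_ge0 f i : 0 <= p f i. Proof. by rewrite le_max lexx orbT. Qed.
Let m_ge0 f i : 0 <= m f i. Proof. by rewrite le_max lexx orbT. Qed.

Let pm f i : p f i - m f i = f i.
Proof.
rewrite /p /m; case: (leP (f i)) => fi.
  by rewrite sub0r max_l ?oppr_ge0// opprK.
by rewrite max_r ?subr0 ?oppr_le0 ?(ltW fi).
Qed.

Let p_sum f : abs_summable f -> abs_summable (p f).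
Proof.
move=> fs; apply: (@abs_summable_le _ (fun i => `|f i|)) => [i|].
  by rewrite ger0_norm ?p_ge0// /p ge_max ler_norm normr_ge0.
by apply: le_lt_trans fs; apply: le_esum => i _ /=; rewrite lee_fin normr_id.
Qed.

Let m_sum f : abs_summable f -> abs_summable (m f).
Proof. by move/abs_summableN/p_sum. Qed.

Lemma rsumB g h : (forall i, 0 <= g i) -> (forall i, 0 <= h i) ->
  abs_summable g -> abs_summable h ->
  rsum (fun i => g i - h i) = psum g - psum h.
Proof.
move=> g0 h0 gs hs; pose d i := g i - h i.
have ds : abs_summable d by apply: abs_summableD => //; exact: abs_summableN.
rewrite -[LHS]/(psum (p d) - psum (m d)).
apply/eqP; rewrite subr_eq addrAC eq_sym subr_eq eq_sym; apply/eqP.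
rewrite -!psumD//; do ?[exact: p_sum|exact: m_sum].
apply: eq_psum => i; have := pm d i; rewrite /d.
move: (p _ i) (m _ i) => a b; lra.
Qed.

Lemma rsumD f g : abs_summable f -> abs_summable g ->
  rsum (fun i => f i + g i) = rsum f + rsum g.
Proof.
move=> fs gs.
rewrite (_ : (fun i => _) = fun i => (p f i + p g i) - (m f i + m g i)); last first.
  by apply/funext => i; rewrite -{1}[f i]pm -{1}[g i]pm opprD addrACA.
rewrite rsumB => [|i|i||]; rewrite ?addr_ge0//.
- by rewrite !psumD ?opprD 1?addrACA//; (exact: p_sum || exact: m_sum).
- by apply: abs_summableD; exact: p_sum.
- by apply: abs_summableD; exact: m_sum.
Qed.

Lemma rsumN f : rsum (fun i => - f i) = - rsum f.
Proof.
rewrite /rsum opprB; congr (_ - _); apply: eq_psum => i.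
by rewrite opprK.
Qed.

Lemma rsum_ge0E f : (forall i, 0 <= f i) -> abs_summable f -> rsum f = psum f.
Proof.
move=> f0 fs; rewrite /rsum [X in _ - X](_ : _ = 0) ?subr0.
  by apply: eq_psum => i; rewrite max_l.
by rewrite /psum esum1// => i _; rewrite max_r// oppr_le0.
Qed.

Lemma rsumZ (c : R) f : abs_summable f ->
  rsum (fun i => c * f i) = c * rsum f.
Proof.
wlog c0 : c / 0 <= c => [hw fs|fs].
  have [|c0] := leP 0 c; first by move/hw; exact.
  rewrite -[c]opprK mulNr -hw ?oppr_ge0 ?ltW// -rsumN; congr rsum.
  by apply/funext => i; rewrite mulNr.
rewrite (_ : (fun i => _) = fun i => c * p f i - c * m f i); last first.
  by apply/funext => i; rewrite -mulrBr pm.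
rewrite rsumB => [|i|i||]; rewrite ?mulr_ge0//.
- by rewrite !psumZ// -?mulrBr//; (exact: p_sum || exact: m_sum).
- by apply: abs_summableZ; exact: p_sum.
- by apply: abs_summableZ; exact: m_sum.
Qed.

Lemma rsum_lin (c d : R) f g h :
  abs_summable f -> abs_summable g -> abs_summable h ->
  rsum (fun i => c * f i + d * g i + h i) = c * rsum f + d * rsum g + rsum h.
Proof.
move=> fs gs hs; have cf := abs_summableZ c fs; have dg := abs_summableZ d gs.
rewrite (rsumD (abs_summableD cf dg) hs) (rsumD cf dg).
by rewrite (rsumZ _ fs) (rsumZ _ gs).
Qed.

End Sums.

Section HilbertTheory.
Context (R : realType) (H : preHilbertType R).
Implicit Types (x y z : H) (a : R[i]).

Lemma hnormE x : (hnorm x)%:C = `|x|.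
Proof. by rewrite /hnorm RRe_real// ger0_real. Qed.

Lemma hnorm_ge0 x : 0 <= hnorm x.
Proof. by rewrite -ler0c hnormE. Qed.

Lemma hnormD x y : hnorm (x + y) <= hnorm x + hnorm y.
Proof. by rewrite -lecR rmorphD /= !hnormE ler_normD. Qed.

Lemma hnormZ a x : hnorm (a *: x) = complex.Re `|a| * hnorm x.
Proof.
rewrite /hnorm normrZ.
have [r ->] := complex_realP _ (ger0_real (normr_ge0 a)).
have [s ->] := complex_realP _ (ger0_real (normr_ge0 x)).
by rewrite /= mulr0 subr0.
Qed.

Lemma hnorm0 : hnorm (0 : H) = 0.
Proof. by rewrite /hnorm normr0. Qed.

Lemma hnormN x : hnorm (- x) = hnorm x.
Proof. by rewrite /hnorm normrN. Qed.

Lemma hdot_hnorm x : hdot x x = (hnorm x ^+ 2)%:C.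
Proof. by rewrite hdotE rmorphXn /= hnormE. Qed.

Lemma hdotDl x y z : hdot (x + y) z = hdot x z + hdot y z.
Proof. by rewrite -{1}[x]scale1r hdotP mul1r. Qed.

Lemma hdot0l z : hdot 0 z = 0.
Proof. by apply: (addrI (hdot 0 z)); rewrite -hdotDl !addr0. Qed.

Lemma hdotZl a x z : hdot (a *: x) z = a * hdot x z.
Proof. by rewrite -[a *: x]addr0 hdotP hdot0l addr0. Qed.

Lemma hdotNl x z : hdot (- x) z = - hdot x z.
Proof. by rewrite -scaleN1r hdotZl mulN1r. Qed.

Lemma hdotDr x y z : hdot z (x + y) = hdot z x + hdot z y.
Proof. by rewrite hdotC hdotDl rmorphD /= -!hdotC. Qed.

Lemma hdotNr x z : hdot z (- x) = - hdot z x.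
Proof. by rewrite hdotC hdotNl rmorphN /= -hdotC. Qed.

Lemma hdotZr a x z : hdot z (a *: x) = a^* * hdot z x.
Proof. by rewrite hdotC hdotZl rmorphM /= -hdotC. Qed.

Lemma hnorm_sqrD x y :
  hnorm (x + y) ^+ 2 = hnorm x ^+ 2 + hnorm y ^+ 2 + 2 * complex.Re (hdot x y).
Proof.
have := congr1 (@complex.Re R) (hdot_hnorm (x + y)).
rewrite hdotDl !hdotDr !hdot_hnorm [hdot y x]hdotC.
by case: (hdot x y) => a b /= <-; ring.
Qed.

Lemma Re_hdot_le x y : `|complex.Re (hdot x y)| <= hnorm x ^+ 2 + hnorm y ^+ 2.
Proof.
have h1 := sqr_ge0 (hnorm (x + y)); rewrite hnorm_sqrD in h1.
have h2 := sqr_ge0 (hnorm (x - y)).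
rewrite hnorm_sqrD hnormN hdotNr in h2.
have RN (u : R[i]) : complex.Re (- u) = - complex.Re u by case: u.
rewrite RN in h2.
have a0 := sqr_ge0 (hnorm x); have b0 := sqr_ge0 (hnorm y).
by rewrite ler_norml; apply/andP; split; lra.
Qed.

Lemma Im_hdot_le x y : `|complex.Im (hdot x y)| <= hnorm x ^+ 2 + hnorm y ^+ 2.
Proof.
have -> : complex.Im (hdot x y) = complex.Re (hdot ((- 'i%C) *: x) y).
  by rewrite hdotZl; case: (hdot x y) => a b /=; rewrite oppr0 mul0r sub0r mulN1r opprK.
rewrite (le_trans (Re_hdot_le _ _))// lerD2r hnormZ normrN.
by rewrite normc_def /= expr0n/= expr1n add0r sqrtr1 mul1r.
Qed.

End HilbertTheory.

Section Dot.
Context (R : realType) (H : preHilbertType R).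
Let dZl : forall u' : H, scalable_for *%R (@hdot R H ^~ u').
Proof. by move=> z a x; rewrite hdotZl. Qed.
Let dZr : forall u : H, scalable_for (Num.conj \; *%R) (@hdot R H u).
Proof. by move=> z a x; rewrite hdotZr. Qed.
Let dBl : forall u' : H, zmod_morphism (@hdot R H ^~ u').
Proof. by move=> z x y; rewrite hdotDl hdotNl. Qed.
Let dBr : forall u : H, zmod_morphism (@hdot R H u).
Proof. by move=> z x y; rewrite hdotDr hdotNr. Qed.
HB.instance Definition _ :=
  isBilinear.Build R[i] H H R[i] *%R (Num.conj \; *%R) (@hdot R H)
    dBl dBr dZl dZr.
HB.instance Definition _ :=
  isHermitianSesquilinear.Build R[i] H false Num.conj (@hdot R H)
    (fun x y => etrans (hdotC x y) (esym (mul1r _))).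
Let dgt0 : forall u : H, u != 0 -> 0 < hdot u u.
Proof. by move=> u u0; rewrite hdotE exprn_gt0// normr_gt0. Qed.
HB.instance Definition _ := isDotProduct.Build R[i] H (@hdot R H) dgt0.
End Dot.

Section HilbertSum.
Context (R : realType) (I : choiceType) (H : hilbertType R).

Definition square_summable : {pred I -> H} :=
  fun x => `[< summable [set: I] (fun i => (hnorm (x i) ^+ 2)%:E) >].

Record hsum := HSum {
  hsum_fun :> I -> H ;
  _ : hsum_fun \in square_summable
}.

Lemma square_summableP (x : I -> H) :
  reflect (abs_summable (fun i => hnorm (x i) ^+ 2)) (x \in square_summable).
Proof. exact: asboolP. Qed.

Lemma square_summable_submod : submod_closed square_summable.
Proof.
split.
  apply/square_summableP; apply/abs_summableE.
  by rewrite esum1// => i _; rewrite hnorm0 expr0n normr0.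
move=> a x y /square_summableP xs /square_summableP ys.
apply/square_summableP.
apply: (@abs_summable_le _ _ _ (fun i => (2 * complex.Re `|a| ^+ 2) *
    hnorm (x i) ^+ 2 + 2 * hnorm (y i) ^+ 2)).
  move=> i; rewrite ger0_norm ?sqr_ge0//.
  have h := hnormD (a *: x i) (y i); rewrite hnormZ in h.
  have h0 := hnorm_ge0 (a *: x i + y i).
  rewrite -[(_ + _) i]/(a *: x i + y i).
  move: (hnorm _) (hnorm (x i)) (hnorm (y i)) (complex.Re `|a|) h h0.
  move=> s u v c h h0.
  have : s ^+ 2 <= (c * u + v) ^+ 2 by rewrite ler_sqr ?nnegrE// (le_trans h0).
  move/le_trans; apply; have := sqr_ge0 (c * u - v); nra.
by apply: abs_summableD; exact: abs_summableZ.
Qed.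

HB.instance Definition _ := [isSub for hsum_fun].
HB.instance Definition _ := [Choice of hsum by <:].
HB.instance Definition _ :=
  GRing.isSubmodClosed.Build _ _ square_summable square_summable_submod.
HB.instance Definition _ := [SubChoice_isSubLmodule of hsum by <:].

Lemma hsum_summable (x : hsum) : abs_summable (fun i => hnorm (x i) ^+ 2).
Proof. by apply/square_summableP; exact: (valP x). Qed.

Definition hsum_dot (x y : hsum) : R[i] := csum (fun i => hdot (x i) (y i)).

Let Re_summable (x y : hsum) :
  abs_summable (fun i => complex.Re (hdot (x i) (y i))).
Proof.
apply: (@abs_summable_le _ _ _ (fun i => hnorm (x i) ^+ 2 + hnorm (y i) ^+ 2)).
  by move=> i; exact: Re_hdot_le.
by apply: abs_summableD; exact: hsum_summable.
Qed.

Let Im_summable (x y : hsum) :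
  abs_summable (fun i => complex.Im (hdot (x i) (y i))).
Proof.
apply: (@abs_summable_le _ _ _ (fun i => hnorm (x i) ^+ 2 + hnorm (y i) ^+ 2)).
  by move=> i; exact: Im_hdot_le.
by apply: abs_summableD; exact: hsum_summable.
Qed.

Lemma hsum_dotP (a : R[i]) (x y z : hsum) :
  hsum_dot (a *: x + y) z = a * hsum_dot x z + hsum_dot y z.
Proof.
rewrite /hsum_dot /csum.
have -> : (fun i => complex.Re (hdot ((a *: x + y) i) (z i))) = fun i =>
    (complex.Re a * complex.Re (hdot (x i) (z i)) +
     (- complex.Im a) * complex.Im (hdot (x i) (z i))) +
    complex.Re (hdot (y i) (z i)).
  apply/funext => i; rewrite -[(a *: x + y) i]/(a *: x i + y i) hdotP.
  by case: a (hdot (x i) _) (hdot (y i) _) => [? ?] [? ?] [? ?] /=; ring.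
have -> : (fun i => complex.Im (hdot ((a *: x + y) i) (z i))) = fun i =>
    (complex.Re a * complex.Im (hdot (x i) (z i)) +
     complex.Im a * complex.Re (hdot (x i) (z i))) +
    complex.Im (hdot (y i) (z i)).
  apply/funext => i; rewrite -[(a *: x + y) i]/(a *: x i + y i) hdotP.
  by case: a (hdot (x i) _) (hdot (y i) _) => [? ?] [? ?] [? ?] /=; ring.
rewrite (rsum_lin _ _ (Re_summable x z) (Im_summable x z) (Re_summable y z)).
rewrite (rsum_lin _ _ (Im_summable x z) (Re_summable x z) (Im_summable y z)).
by case: a => a b /=; apply/eqP; rewrite eq_complex /= mulNr !eqxx.
Qed.

Lemma hsum_dotC (x y : hsum) : hsum_dot x y = (hsum_dot y x)^*.
Proof.
rewrite /hsum_dot /csum; apply/eqP; rewrite eq_complex /= -rsumN.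
apply/andP; split; apply/eqP; congr rsum; apply/funext => i.
  by rewrite hdotC; case: (hdot (y i) (x i)).
by rewrite hdotC; case: (hdot (y i) (x i)).
Qed.

Let hsum_dotE (x : hsum) : hsum_dot x x = (psum (fun i => hnorm (x i) ^+ 2))%:C.
Proof.
rewrite /hsum_dot /csum.
have -> : (fun i => complex.Re (hdot (x i) (x i))) = fun i => hnorm (x i) ^+ 2.
  by apply/funext => i; rewrite hdot_hnorm.
have -> : (fun i => complex.Im (hdot (x i) (x i))) = fun i => 0 * 0.
  by apply/funext => i; rewrite hdot_hnorm /= mulr0.
rewrite rsumZ ?mul0r; last first.
  by apply/abs_summableE; rewrite esum1// => i _; rewrite normr0.
by rewrite rsum_ge0E//; [move=> i; exact: sqr_ge0|exact: hsum_summable].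
Qed.

Lemma hsum_dot_ge0 (x : hsum) : 0 <= hsum_dot x x.
Proof. by rewrite hsum_dotE ler0c psum_ge0// => i; exact: sqr_ge0. Qed.

Lemma hsum_dot_eq0 (x : hsum) : hsum_dot x x = 0 -> x = 0.
Proof.
rewrite hsum_dotE => /complexI x0; apply/val_inj/funext => i /=.
have := @sum_le_psum R I _ [:: i] (fun i => sqr_ge0 (hnorm (x i)))
  (hsum_summable x) isT.
rewrite big_seq1 x0 => xi.
have xi0 : hnorm (x i) = 0.
  by apply/eqP; rewrite -sqrf_eq0 eq_le xi sqr_ge0.
by apply/normr0_eq0; rewrite -hnormE xi0.
Qed.

HB.instance Definition _ :=
  Lmodule_isInnerProduct.Build R hsum hsum_dotP hsum_dotC hsum_dot_ge0 hsum_dot_eq0.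

Lemma hsum_hnorm (x : hsum) : hnorm x ^+ 2 = psum (fun i => hnorm (x i) ^+ 2).
Proof. by apply: complexI; rewrite -hdot_hnorm -hsum_dotE. Qed.

Lemma hnorm_coord (x : hsum) i : hnorm (x i) <= hnorm x.
Proof.
rewrite -(@ler_pXn2r _ 2)// ?nnegrE ?hnorm_ge0// hsum_hnorm.
have := @sum_le_psum R I _ [:: i] (fun i => sqr_ge0 (hnorm (x i)))
  (hsum_summable x) isT.
by rewrite big_seq1.
Qed.

End HilbertSum.

Lemma hnorm_dist (R : realType) (H : preHilbertType R) (x y : H) :
  `|hnorm x - hnorm y| <= hnorm (x - y).
Proof.
have h1 := hnormD (x - y) y; have h2 := hnormD (y - x) x.
have h3 := hnormN (x - y); rewrite opprB in h3; rewrite !subrK in h1 h2.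
by rewrite ler_norml; apply/andP; split; lra.
Qed.

Section HilbertSumComplete.
Context (R : realType) (I : choiceType) (H : hilbertType R).

Let hsum_cauchy_cvg (F : set_system (hsum I H)) :
  ProperFilter F -> cauchy F -> cvg F.
Proof.
move=> FF /cauchyP Fc.
have Fr (e : R) : 0 < e -> exists z : hsum I H, \forall x \near F, hnorm (z - x) < e.
  move=> e0; have [|z Fz] := Fc e%:C; first by rewrite ltcR.
  exists z; apply: filterS Fz => x; rewrite -ball_normE /= => zx.
  by rewrite -ltcR hnormE.
have Fi i : cvg ((fun x : hsum I H => x i) @ F).
  apply: cauchy_cvg; apply/cauchyP => e e0.
  have [r er] := complex_realP _ (gtr0_real e0); subst e.
  have [|z Fz] := Fr r; first by rewrite -ltcR.
  exists (z i); apply: filterS Fz => x zx /=; rewrite -ball_normE /=.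
  by rewrite -hnormE ltcR (le_lt_trans (hnorm_coord (z - x) i)).
pose y i : H := lim ((fun x : hsum I H => x i) @ F).
have Fy i (e : R) : 0 < e -> \forall x \near F, hnorm (y i - (x : hsum I H) i) < e.
  move=> e0; have /cvgrPdist_lt/(_ e%:C) := Fi i.
  rewrite ltcR => /(_ e0); apply: filterS => x /=.
  by rewrite -hnormE ltcR.
have Fs (z : hsum I H) (e : R) : (\forall x \near F, hnorm (z - x) < e) ->
    forall s : seq I, uniq s -> \sum_(i <- s) hnorm (z i - y i) ^+ 2 <= e ^+ 2.
  move=> Fz s us.
  have cv : (fun x : hsum I H => \sum_(i <- s) hnorm (z i - x i) ^+ 2) @ F -->
      \sum_(i <- s) hnorm (z i - y i) ^+ 2.
    elim: s {us} => [|i s IHs].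
      by under eq_fun do rewrite big_nil; rewrite big_nil; exact: cvg_cst.
    under eq_fun do rewrite big_cons; rewrite big_cons; apply: cvgD => //.
    have ci : (fun x : hsum I H => hnorm (z i - x i)) @ F --> hnorm (z i - y i).
      apply/cvgrPdist_lt => e' e0'; have := Fy i _ e0'; apply: filterS => x.
      apply: le_lt_trans; rewrite -[y i - x i]opprB hnormN.
      apply: le_trans (hnorm_dist _ _) _.
      by rewrite opprB addrC addrA subrK.
    by rewrite expr2; under eq_fun do rewrite expr2; exact: cvgM.
  apply: (closed_cvg (fun r => r <= e ^+ 2)) cv; first exact: closed_le.
  apply: filterS Fz => x zx.
  have e0 : 0 <= e by rewrite (le_trans (hnorm_ge0 (z - x)))// ltW.
  apply: le_trans (sum_le_psum (fun i => sqr_ge0 (hnorm ((z - x) i))) (hsum_summable _) us) _.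
  by rewrite -hsum_hnorm ler_sqr ?nnegrE ?hnorm_ge0// ltW.
have Fzy (z : hsum I H) (e : R) : (\forall x \near F, hnorm (z - x) < e) ->
    (\esum_(i in [set: I]) (hnorm (z i - y i) ^+ 2)%:E <= (e ^+ 2)%:E)%E.
  move=> Fz; apply: psum_le_esum => [i|]; first exact: sqr_ge0.
  exact: Fs Fz.
have zys (z : hsum I H) (e : R) : (\forall x \near F, hnorm (z - x) < e) ->
    (fun i => z i - y i) \in @square_summable R I H.
  move=> Fz; apply/square_summableP/abs_summableE.
  under eq_esum do rewrite ger0_norm ?sqr_ge0//.
  by apply: le_lt_trans (Fzy _ _ Fz) _; rewrite ltry.
have yP : y \in @square_summable R I H.
  have [z Fz] := Fr 1 ltr01.
  rewrite (_ : y = (z : I -> H) - (fun i => z i - y i)).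
    by rewrite rpredB ?(valP z)// (zys _ _ Fz).
  by apply/funext => i; rewrite /GRing.add /= /GRing.opp /= opprB addrC subrK.
apply/cvg_ex; exists (HSum yP); apply/cvgrPdist_lt => e e0.
have [r er] := complex_realP _ (gtr0_real e0); subst e.
have r0 : 0 < r by rewrite -ltcR.
have r2 : 0 < r / 2 by rewrite divr_gt0.
have [z Fz] := Fr _ r2.
have zy : hnorm (z - HSum yP) <= r / 2.
  rewrite -(@ler_pXn2r _ 2)// ?nnegrE ?hnorm_ge0 ?(ltW r2)//.
  rewrite hsum_hnorm -lee_fin -esum_psum; last 2 first.
  - by move=> i; exact: sqr_ge0.
  - exact: hsum_summable.
  exact: Fzy Fz.
apply: filterS Fz => x zx; rewrite -hnormE ltcR.
rewrite (_ : _ - x = (HSum yP - z) + (z - x)); last by rewrite addrA subrK.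
apply: le_lt_trans (hnormD _ _) _; rewrite -[HSum yP - z]opprB hnormN.
by rewrite [r]splitr ler_ltD.
Qed.

HB.instance Definition _ := Uniform_isComplete.Build (hsum I H) hsum_cauchy_cvg.

End HilbertSumComplete.

Section BoundedOperators.
Context (R : realType).

Definition bounded_linear (H K : hilbertType R) : {pred H -> K} :=
  fun f =>
    `[< linear f /\ exists C : R, forall x, hnorm (f x) <= C * hnorm x >].

Record bop (H K : hilbertType R) := Bop {
  bop_fun :> H -> K ;
  _ : bop_fun \in @bounded_linear H K
}.

Lemma bounded_linearP (H K : hilbertType R) (f : H -> K) :
  reflect (linear f /\ exists C : R, forall x, hnorm (f x) <= C * hnorm x)
    (f \in @bounded_linear H K).
Proof. exact: asboolP. Qed.

Lemma bounded_linear_submod (H K : hilbertType R) :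
  submod_closed (@bounded_linear H K).
Proof.
split.
  apply/bounded_linearP; split; first by move=> a x y; rewrite /= scaler0 addr0.
  by exists 0 => x; rewrite mul0r hnorm0.
move=> a f g /bounded_linearP[fl [C fC]] /bounded_linearP[gl [D gD]].
apply/bounded_linearP; split.
  move=> b x y; rewrite -![(a *: f + g) _]/(a *: f _ + g _) fl gl.
  by rewrite !scalerDr !scalerA [a * b]mulrC addrACA.
exists (complex.Re `|a| * C + D) => x; rewrite -[(a *: f + g) x]/(a *: f x + g x).
rewrite (le_trans (hnormD _ _))// hnormZ mulrDl lerD// -mulrA ler_wpM2l//.
by rewrite -ler0c RRe_real// ger0_real.
Qed.

HB.instance Definition _ (H K : hilbertType R) := [isSub for @bop_fun H K].
HB.instance Definition _ (H K : hilbertType R) := [Choice of bop H K by <:].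
HB.instance Definition _ (H K : hilbertType R) :=
  GRing.isSubmodClosed.Build _ _ (@bounded_linear H K)
    (@bounded_linear_submod H K).
HB.instance Definition _ (H K : hilbertType R) :=
  [SubChoice_isSubLmodule of bop H K by <:].

HB.instance Definition _ (H K : hilbertType R) (f : bop H K) :=
  GRing.isLinear.Build R[i] H K _ f (bounded_linearP _ (valP f)).1.

Lemma bop_bound (H K : hilbertType R) (f : bop H K) :
  exists2 C : R, 0 <= C & forall x, hnorm (f x) <= C * hnorm x.
Proof.
have [_ [C fC]] := bounded_linearP _ (valP f).
exists `|C| => // x; rewrite (le_trans (fC x))// ler_wpM2r ?hnorm_ge0//.
exact: ler_norm.
Qed.

Lemma bop_id_subproof (H : hilbertType R) : id \in @bounded_linear H H.
Proof. by apply/bounded_linearP; split=> //; exists 1 => x; rewrite mul1r. Qed.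

Definition bid (H : hilbertType R) : bop H H := Bop (bop_id_subproof H).

Lemma bop_comp_subproof (H K L : hilbertType R) (f : bop K L) (g : bop H K) :
  f \o g \in @bounded_linear H L.
Proof.
apply/bounded_linearP; split; first by move=> a x y; rewrite /= !linearP.
have [C C0 fC] := bop_bound f; have [D D0 gD] := bop_bound g.
exists (C * D) => x /=; rewrite (le_trans (fC _))// -mulrA ler_wpM2l//.
Qed.

Definition bcomp (H K L : hilbertType R) (f : bop K L) (g : bop H K) :
  bop H L := Bop (bop_comp_subproof f g).

Definition opnorm (H K : hilbertType R) (f : bop H K) : R :=
  sup [set hnorm (f x) | x in [set x : H | hnorm x <= 1]].

(* The adjoint exists by the Riesz representation theorem, so the default
   value 0 is not used. *)
Definition adj (H K : hilbertType R) (f : bop H K) : bop K H :=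
  xget 0 [set g : bop K H | forall x y, hdot (f x) y = hdot x (g y)].

Definition op_le (H : hilbertType R) (f g : bop H H) :=
  forall x, hdot (f x) x <= hdot (g x) x.

Definition op_cvg (H K : hilbertType R) (f : nat -> bop H K) (g : bop H K) :=
  opnorm (f j - g) @[j --> \oo] --> (0 : R).

Definition word_op (H : hilbertType R) (n : nat) (T : 'I_n -> bop H H)
    (w : seq 'I_n) : bop H H :=
  foldr (fun i f => bcomp (T i) f) (bid H) w.

End BoundedOperators.

Infix "\ob" := bcomp (at level 40, left associativity) : ring_scope.

Section SumOperators.
Context (R : realType).

Lemma hsum_coord_subproof (I : choiceType) (H : hilbertType R) (i : I) :
  (fun x : hsum I H => x i) \in @bounded_linear R _ _.
Proof.
apply/bounded_linearP; split; first by move=> a x y.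
by exists 1 => x; rewrite mul1r hnorm_coord.
Qed.

Definition hsum_coord (I : choiceType) (H : hilbertType R) (i : I) :
  bop (hsum I H) H := Bop (hsum_coord_subproof H i).

Section Inj.
Context (I : choiceType) (H : hilbertType R) (i : I).

Definition hsum_single_fun (h : H) (j : I) : H := if j == i then h else 0.

Let single_le (h : H) :
  (\esum_(j in [set: I]) (hnorm (hsum_single_fun h j) ^+ 2)%:E
     <= (hnorm h ^+ 2)%:E)%E.
Proof.
apply: psum_le_esum => [j|s us]; first exact: sqr_ge0.
have E j : hnorm (hsum_single_fun h j) ^+ 2 =
    if j == i then hnorm h ^+ 2 else 0.
  by rewrite /hsum_single_fun; case: eqP => // _; rewrite hnorm0 expr0n.
under eq_bigr do rewrite E.
have [iS|iS] := boolP (i \in s).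
  by rewrite (bigD1_seq i)//= eqxx big1 ?addr0// => j /negPf ->.
rewrite big_seq big1 ?sqr_ge0// => j js; case: eqP => // ji.
by rewrite -ji js in iS.
Qed.

Lemma hsum_single_subproof (h : H) :
  hsum_single_fun h \in @square_summable R I H.
Proof.
apply/square_summableP/abs_summableE.
under eq_esum do rewrite ger0_norm ?sqr_ge0//.
by apply: le_lt_trans (single_le h) _; rewrite ltry.
Qed.

Definition hsum_single (h : H) : hsum I H := HSum (hsum_single_subproof h).

Lemma hsum_inj_subproof : hsum_single \in @bounded_linear R _ _.
Proof.
apply/bounded_linearP; split=> [a x y|].
  apply/val_inj/funext => j /=.
  rewrite -[RHS]/(a *: hsum_single_fun x j + hsum_single_fun y j).
  by rewrite /hsum_single_fun; case: eqP => // _; rewrite scaler0 addr0.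
exists 1 => h; rewrite mul1r -(@ler_pXn2r _ 2)// ?nnegrE ?hnorm_ge0//.
rewrite hsum_hnorm -lee_fin -esum_psum; first exact: single_le.
  by move=> j; exact: sqr_ge0.
exact: hsum_summable.
Qed.

Definition hsum_inj : bop H (hsum I H) := Bop hsum_inj_subproof.

End Inj.

Definition row_op (H K : hilbertType R) (k : nat) (X : 'I_k -> bop K H) :
    bop (hsum 'I_k K) H :=
  \sum_(j < k) X j \ob hsum_coord K j.

Definition row_norm (H K : hilbertType R) (k : nat) (X : 'I_k -> bop K H) : R :=
  opnorm (row_op X).

Definition mx_op (H : hilbertType R) (m : nat) (X : 'M[bop H H]_m) :
    bop (hsum 'I_m H) (hsum 'I_m H) :=
  \sum_(a < m) \sum_(b < m) hsum_inj H a \ob X a b \ob hsum_coord H b.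

Definition joint_spectral_radius (H : hilbertType R) (k : nat)
    (X : 'I_k -> bop H H) : R :=
  lim (opnorm (\sum_(w : q.-tuple 'I_k) word_op X w \ob adj (word_op X w))
         `^ ((2 * q)%:R)^-1 @[q --> \oo]).

Definition row_contraction (H : hilbertType R) (n : nat)
    (T : 'I_n -> bop H H) :=
  op_le (\sum_(i < n) T i \ob adj (T i)) (bid H).

Definition completely_non_coisometric (H : hilbertType R) (n : nat)
    (T : 'I_n -> bop H H) :=
  ~ exists h : H, h != 0 /\
      forall k : nat, (0 < k)%N ->
        \sum_(w : k.-tuple 'I_n) hnorm (adj (word_op T w) h) ^+ 2 =
        hnorm h ^+ 2.

End SumOperators.

(* With respect to the orthonormal basis (e_alpha), the full Fock space of an
   n-dimensional space is the space of square summable families of complex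
   numbers indexed by the words alpha in the free semigroup on n generators;
   the empty word is g_0. *)
Notation fock R n := (hsum (seq 'I_n) (complex_line R)).

Section Fock.
Context (R : realType) (n : nat).
Local Notation F2 := (fock R n).

Definition fock_basis (w : seq 'I_n) : F2 :=
  hsum_inj (complex_line R) w (1 : R[i]).

Definition vacuum : F2 := fock_basis [::].

(* S_i psi = e_i (x) psi: \sum_alpha a_alpha e_alpha is sent to
   \sum_alpha a_alpha e_(g_i alpha). *)
Definition creation_fun (i : 'I_n) (psi : F2) (w : seq 'I_n) : complex_line R :=
  if w is j :: v then if j == i then psi v else 0 else 0.

Section Creation.
Variable i : 'I_n.

Let creation_le (psi : F2) :
  (\esum_(w in [set: seq 'I_n]) (hnorm (creation_fun i psi w) ^+ 2)%:E
     <= (hnorm psi ^+ 2)%:E)%E.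
Proof.
apply: psum_le_esum => [w|s us]; first exact: sqr_ge0.
pose P (w : seq 'I_n) := ohead w == Some i.
have PE w : P w -> w = i :: behead w by case: w => [|j v] // /eqP[->].
have E w : hnorm (creation_fun i psi w) ^+ 2 =
    if P w then hnorm (psi (behead w)) ^+ 2 else 0.
  rewrite /P; case: w => [|j v] /=; first by rewrite hnorm0 expr0n.
  rewrite -[Some j == _]/(j == i); case: eqP => // _.
  by rewrite hnorm0 expr0n.
under eq_bigr do rewrite E; rewrite -big_mkcond -big_filter.
rewrite -(big_map behead xpredT (fun v => hnorm (psi v) ^+ 2)) hsum_hnorm.
apply: sum_le_psum; first by move=> v; exact: sqr_ge0.
  exact: hsum_summable.
rewrite map_inj_in_uniq ?filter_uniq// => v w.
rewrite !mem_filter => /andP[/PE -> _] /andP[/PE -> _] /= ->.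
by [].
Qed.

Lemma creation_square_summable (psi : F2) :
  creation_fun i psi \in @square_summable R _ _.
Proof.
apply/square_summableP/abs_summableE.
under eq_esum do rewrite ger0_norm ?sqr_ge0//.
by apply: le_lt_trans (creation_le psi) _; rewrite ltry.
Qed.

Lemma creation_subproof :
  (fun psi => HSum (creation_square_summable psi)) \in @bounded_linear R F2 F2.
Proof.
apply/bounded_linearP; split=> [a x y|].
  apply/val_inj/funext => w /=.
  rewrite -[RHS]/(a *: creation_fun i x w + creation_fun i y w).
  by case: w => [|j v] /=; [|case: eqP => // _]; rewrite scaler0 addr0.
exists 1 => psi; rewrite mul1r -(@ler_pXn2r _ 2)// ?nnegrE ?hnorm_ge0//.
rewrite hsum_hnorm -lee_fin -esum_psum; first exact: creation_le.
  by move=> w; exact: sqr_ge0.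
exact: hsum_summable.
Qed.

Definition creation : bop F2 F2 := Bop creation_subproof.

End Creation.

(* The symmetric Fock space consists of the vectors all of whose homogeneous
   components are symmetric tensors, i.e. invariant under the permutations of
   the tensor factors. *)
Definition symmetric_tensors : {pred F2} :=
  fun psi => `[< forall v w : seq 'I_n, perm_eq v w -> psi v = psi w >].

Record sym_fock := SymFock {
  sym_fock_val :> F2 ;
  _ : sym_fock_val \in symmetric_tensors
}.

Lemma symmetric_tensors_submod : submod_closed symmetric_tensors.
Proof.
split; first by apply/asboolP => v w _.
move=> a x y /asboolP xs /asboolP ys; apply/asboolP => v w vw.
rewrite -[(a *: x + y) v]/(a *: x v + y v) (xs _ _ vw) (ys _ _ vw).
by [].
Qed.

HB.instance Definition _ := [isSub for sym_fock_val].
HB.instance Definition _ := [Choice of sym_fock by <:].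
HB.instance Definition _ :=
  GRing.isSubmodClosed.Build _ _ symmetric_tensors symmetric_tensors_submod.
HB.instance Definition _ := [SubChoice_isSubLmodule of sym_fock by <:].

Definition sym_dot (x y : sym_fock) : R[i] :=
  hdot (sym_fock_val x) (sym_fock_val y).

Lemma sym_dotP (a : R[i]) (x y z : sym_fock) :
  sym_dot (a *: x + y) z = a * sym_dot x z + sym_dot y z.
Proof. exact: hdotP. Qed.

Lemma sym_dotC (x y : sym_fock) : sym_dot x y = (sym_dot y x)^*.
Proof. exact: hdotC. Qed.

Lemma sym_dot_ge0 (x : sym_fock) : 0 <= sym_dot x x.
Proof. by rewrite /sym_dot hdotE exprn_ge0. Qed.

Lemma sym_dot_eq0 (x : sym_fock) : sym_dot x x = 0 -> x = 0.
Proof.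
rewrite /sym_dot hdotE => /eqP; rewrite sqrf_eq0 normr_eq0 => /eqP x0.
exact: val_inj.
Qed.

HB.instance Definition _ :=
  Lmodule_isInnerProduct.Build R sym_fock sym_dotP sym_dotC sym_dot_ge0 sym_dot_eq0.

Lemma sym_hnorm (x : sym_fock) : hnorm x = hnorm (sym_fock_val x).
Proof. by []. Qed.

Let sym_fock_cauchy_cvg (F : set_system sym_fock) :
  ProperFilter F -> cauchy F -> cvg F.
Proof.
move=> FF /cauchyP Fc.
have /cvg_ex[/= y Fy] : cvg (sym_fock_val @ F).
  apply: cauchy_cvg; apply/cauchyP => e e0.
  have [z Fz] := Fc e e0.
  exists (sym_fock_val z); move: Fz; rewrite /= -!ball_normE /=.
  apply: filterS => -[x xs] /=; rewrite -[`|z - _|]hnormE sym_hnorm.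
  by rewrite -(hnormE (sym_fock_val z - x)).
move/cvgrPdist_lt : Fy => Fy.
have yP : y \in symmetric_tensors.
  apply/asboolP => v w vw; apply/eqP; rewrite -subr_eq0 -normr_eq0 -hnormE.
  apply/eqP; congr (_%:C); apply/eqP; rewrite eq_le hnorm_ge0 andbT.
  apply/ler_addgt0Pr => e e0; rewrite add0r.
  have e2 : 0 < e / 2 by rewrite divr_gt0.
  have [x yx] : exists x, hnorm (y - sym_fock_val x) < e / 2.
    have := Fy (e / 2)%:C; rewrite ltcR => /(_ e2) /filter_ex[x yx].
    by exists x; rewrite -ltcR hnormE.
  have /asboolP/(_ _ _ vw) xvw := valP x.
  have -> : y v - y w = (y - sym_fock_val x) v - (y - sym_fock_val x) w.
    rewrite -![(y - _) _]/(y _ - sym_fock_val x _) /= xvw.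
    by rewrite opprB addrA subrK.
  apply: le_trans (hnormD _ _) _; rewrite hnormN [e]splitr.
  by rewrite lerD// (le_trans (hnorm_coord _ _))// ltW.
apply/cvg_ex; exists (SymFock yP); apply/cvgrPdist_lt => e e0.
apply: filterS (Fy e e0) => x /=.
by rewrite -(hnormE (y - sym_fock_val x)) -(hnormE (SymFock yP - x)) sym_hnorm.
Qed.

HB.instance Definition _ :=
  Uniform_isComplete.Build sym_fock sym_fock_cauchy_cvg.

Lemma sym_incl_subproof : sym_fock_val \in @bounded_linear R sym_fock F2.
Proof.
apply/bounded_linearP; split; first by move=> a x y.
by exists 1 => x; rewrite mul1r sym_hnorm.
Qed.

Definition sym_incl : bop sym_fock F2 := Bop sym_incl_subproof.

(* The orthogonal projection exists because the range of sym_incl is closed,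
   so the default value 0 is not used. *)
Definition sym_proj : bop F2 sym_fock :=
  xget 0 [set P : bop F2 sym_fock |
    forall x y, hdot (x - sym_incl (P x)) (sym_incl y) = 0].

Definition compression (f : bop F2 F2) : bop sym_fock sym_fock :=
  sym_proj \ob f \ob sym_incl.

Lemma vacuum_symmetric : vacuum \in symmetric_tensors.
Proof.
apply/asboolP => v w vw; rewrite /= /hsum_single_fun.
suff -> : (v == [::]) = (w == [::]) by [].
by rewrite -!size_eq0 (perm_size vw).
Qed.

Definition sym_vacuum : sym_fock := SymFock vacuum_symmetric.

End Fock.

Section Algebras.
Context (R : realType).

Definition subalgebra (H : hilbertType R) (A : set (bop H H)) :=
  forall (c : R[i]) f g, A f -> A g -> A (c *: f + g) /\ A (f \ob g).

Definition norm_closed (H : hilbertType R) (A : set (bop H H)) :=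
  forall f, (forall e : R, 0 < e -> exists2 g, A g & opnorm (f - g) < e) -> A f.

(* The weak operator topology is generated by the seminorms
   f |-> |<f x, y>|, so a basic neighbourhood is given by a finite family of
   pairs of vectors and a positive e. *)
Definition wot_closed (H : hilbertType R) (A : set (bop H H)) :=
  forall f, (forall (s : seq (H * H)) (e : R), 0 < e ->
    exists2 g, A g & forall p, p \in s -> `|hdot ((f - g) p.1) p.2| < e%:C) ->
  A f.

Definition norm_closed_algebra (H : hilbertType R) (G : set (bop H H)) :=
  smallest (fun A => subalgebra A /\ norm_closed A) G.

Definition wot_closed_algebra (H : hilbertType R) (G : set (bop H H)) :=
  smallest (fun A => subalgebra A /\ wot_closed A) G.

Definition generators (H : hilbertType R) (n : nat) (V : 'I_n -> bop H H) :
    set (bop H H) :=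
  range V `|` [set bid H].

Variable n : nat.

Definition disc_algebra : set (bop (fock R n) (fock R n)) :=
  norm_closed_algebra (generators (@creation R n)).

Definition toeplitz_algebra : set (bop (fock R n) (fock R n)) :=
  wot_closed_algebra (generators (@creation R n)).

Definition sym_creation (i : 'I_n) : bop (sym_fock R n) (sym_fock R n) :=
  compression (creation R i).

Definition sym_disc_algebra : set (bop (sym_fock R n) (sym_fock R n)) :=
  norm_closed_algebra (generators sym_creation).

Definition sym_toeplitz_algebra : set (bop (sym_fock R n) (sym_fock R n)) :=
  [set compression f | f in toeplitz_algebra].

End Algebras.

Section Calculi.
Context (R : realType) (n : nat).

(* A polynomial in n noncommuting variables: a formal sum of monomials
   c * X_alpha. *)
Definition ncpoly := seq (R[i] * seq 'I_n).

Definition nceval (H : hilbertType R) (V : 'I_n -> bop H H) (p : ncpoly) :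
    bop H H :=
  \sum_(t <- p) t.1 *: word_op V t.2.

(* f(T_1, ..., T_n) for f in the norm closed algebra generated by V_1, ..., V_n
   and I: the common limit of p_j(T_1, ..., T_n) for all sequences of
   polynomials with p_j(V_1, ..., V_n) --> f. By the von Neumann inequality it exists when V
   is the tuple of creation operators (or of their compressions to the symmetric
   Fock space, if the T_i commute) and T is a row contraction. *)
Definition norm_calculus (K H : hilbertType R) (V : 'I_n -> bop K K)
    (T : 'I_n -> bop H H) (f : bop K K) : bop H H :=
  xget 0 [set X | forall p : nat -> ncpoly,
    op_cvg (fun j => nceval V (p j)) f -> op_cvg (fun j => nceval T (p j)) X].

(* The coefficient a_alpha in f 1 = \sum_alpha a_alpha e_alpha, that is, the
   alpha-th entry of the family f 1. *)
Definition fourier (f : bop (fock R n) (fock R n)) (w : seq 'I_n) : R[i] :=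
  f (vacuum R n) w.

(* The sums over k are taken pointwise; the limit as r --> 1 from the left is in
   the strong operator topology. *)
Definition sot_calculus (H : hilbertType R) (T : 'I_n -> bop H H)
    (f : bop (fock R n) (fock R n)) : bop H H :=
  xget 0 [set X : bop H H | forall h,
    lim (series (fun k => \sum_(w : k.-tuple 'I_n)
           ((r ^+ k)%:C * fourier f w) *: word_op T w h) @ \oo)
      @[r --> (1 : R)^'-] --> X h].

(* The common value of f(T_1, ..., T_n) over all lifts f of g. *)
Definition sym_sot_calculus (H : hilbertType R) (T : 'I_n -> bop H H)
    (g : bop (sym_fock R n) (sym_fock R n)) : bop H H :=
  xget 0 [set X | forall f,
    toeplitz_algebra f -> compression f = g -> sot_calculus T f = X].

Definition mx_at0 (K : hilbertType R) (one : K) (m : nat) (F : 'M[bop K K]_m) :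
    'M[R[i]]_m :=
  \matrix_(a, b) hdot (F a b one) one.

(* The inequality for omega the norm of the row operator and for omega the joint
   spectral radius; calc is the functional calculus f |-> f(T_1, ..., T_n). *)
Definition omega_bound (K H : hilbertType R) (m k : nat) (T : 'I_n -> bop H H)
    (calc : bop K K -> bop H H) (F : 'I_k -> 'M[bop K K]_m) :=
  let FT j := mx_op (map_mx calc (F j)) in
  let normF := row_norm (fun j => mx_op (F j)) in
  row_norm FT <= row_norm T * normF /\
  joint_spectral_radius FT <= joint_spectral_radius T * normF.

End Calculi.

(* Main.v *)
(** For an admissible vector z, h |-> \sum_w <T_w^* h, z> e_w is a bounded operator K
from H to the full Fock space that intertwines the adjoints f(T)^* and f^*; these K
are the scalar components of the Poisson kernel of T. Diagonalising the defect form
<(1 - \sum_i T_i T_i^* ) x, x> on finite sets of vectors turns an inequality between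
sums of |K y|^2 and |K x|^2 for all K into the same inequality in H, provided T is
pure; r T with r < 1 is pure. On the Fock space side, a word of length q in the F_j
raises degrees by at least q because F_j(0) = 0, so that
\sum_{|w| = q} |F_w^* x|^2 <= |[F_1, ..., F_k]|^(2q) |P_{>= q} x|^2, and
|P_{>= q} x|^2 = \sum_{|u| = q} |S_u^* x|^2. Transported to H this gives
\sum_{|w| = q} |F_w(T)^* h|^2 <= |[F_1, ..., F_k]|^(2q) \sum_{|u| = q} |T_u^* h|^2:
the case q = 1 is the norm inequality and q -> oo the one for the spectral radius.
When the T_i commute, K takes its values in the symmetric Fock space. *)
Require Import Defs.
From HB Require Import structures.
From mathcomp Require Import all_boot all_order all_algebra.
From mathcomp Require Import ring lra complex.
From mathcomp Require Import all_classical all_reals.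
From mathcomp Require Import ereal topology normedtype sequences esum exp.
Import Defs.

Set Implicit Arguments.
Unset Strict Implicit.
Unset Printing Implicit Defensive.

Import Order.TTheory GRing.Theory Num.Theory.
Import numFieldNormedType.Exports.

Local Open Scope classical_set_scope.
Local Open Scope complex_scope.
Local Open Scope ring_scope.

(** Using scalar components of the Poisson kernel avoids the square root of the defect operator and
    the tensor product with the defect space. The price is that only finitely many vectors are
    handled at a time, hence Gram-Schmidt on a finite list, a truncation to words of length < N, and
    a limit in N. All estimates concern adjoints, because the subspaces involved are invariant under
    f^* and not under f. In [pure_word_bound] the set E of Fock vectors is invariant under these
    adjoints and contains every K h. If E is the whole space, C is the norm of the row; if E
    consists of the symmetric vectors, C is the norm of the compressed row, whatever lift is chosen.
    The operator intertwined with f(rT) is f itself, so C is the same for every r and the passage r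
    -> 1 happens only in H. It is a strong limit, under which adjoints need not converge, so the
    estimate passes to T by lower semicontinuity. For the Toeplitz algebra the limit itself must be
    shown to exist. It is visible on the vectors T_w D h, where f(rT) factors through a fixed
    operator applied to a dilated Fourier series, and complete non-coisometry makes these vectors
    span a dense subspace. *)

(** * Real parts and moduli of complex numbers *)

Section ComplexParts.
Context (R : realType).
Implicit Types c d : R[i].

Lemma ReD c d : complex.Re (c + d) = complex.Re c + complex.Re d.
Proof. by case: c d => [? ?] [? ?]. Qed.

Lemma ReN c : complex.Re (- c) = - complex.Re c.
Proof. by case: c. Qed.

Lemma ReJ c : complex.Re c^* = complex.Re c.
Proof. by case: c. Qed.

Lemma ReZ (t : R) c : complex.Re (t%:C * c) = t * complex.Re c.
Proof. by case: c => a b /=; rewrite mul0r subr0. Qed.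

Lemma Re_sum (I : Type) (s : seq I) (P : pred I) (f : I -> R[i]) :
  complex.Re (\sum_(i <- s | P i) f i) = \sum_(i <- s | P i) complex.Re (f i).
Proof. by apply: (big_morph _ ReD). Qed.

Lemma Re_normc_ge0 c : 0 <= complex.Re `|c|.
Proof. by rewrite -ler0c RRe_real// ger0_real. Qed.

Lemma Re_normcE c : (complex.Re `|c|)%:C = `|c|.
Proof. by rewrite RRe_real// ger0_real. Qed.

Lemma Re_norm_sqr c : (complex.Re `|c|) ^+ 2 = complex.Re c ^+ 2 + complex.Im c ^+ 2.
Proof. by rewrite normc_def /= sqr_sqrtr// addr_ge0// sqr_ge0. Qed.

Lemma Re_norm_mulJ c : (complex.Re `|c|) ^+ 2 = complex.Re (c * c^*).
Proof. by rewrite Re_norm_sqr; case: c => a b /=; ring. Qed.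

Lemma Re_norm_conj c : complex.Re `|c^*| = complex.Re `|c|.
Proof. by rewrite norm_conjC. Qed.

Lemma Re_normM c d : complex.Re `|c * d| = complex.Re `|c| * complex.Re `|d|.
Proof. by apply: complexI; rewrite rmorphM /= !Re_normcE normrM. Qed.

Lemma Re_normD c d : complex.Re `|c + d| <= complex.Re `|c| + complex.Re `|d|.
Proof. by rewrite -lecR rmorphD /= !Re_normcE ler_normD. Qed.

Lemma Re_le_norm c : complex.Re c <= complex.Re `|c|.
Proof.
apply: le_trans (ler_norm _) _.
by rewrite -(@ler_pXn2r _ 2)// ?nnegrE ?normr_ge0 ?Re_normc_ge0// real_normK ?num_real//
  Re_norm_sqr lerDl sqr_ge0.
Qed.

Lemma Re_norm_real (t : R) : complex.Re `|t%:C| = `|t|.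
Proof. by rewrite normc_def /= expr0n addr0 sqrtr_sqr. Qed.

Lemma Re_norm_eq0 c : complex.Re `|c| = 0 -> c = 0.
Proof. by move=> c0; apply/eqP; rewrite -normr_eq0 -Re_normcE c0. Qed.

Lemma phaseP c : {u : R[i] | complex.Re `|u| <= 1 & complex.Re `|c| = complex.Re (u * c)}.
Proof.
have [->|c0] := eqVneq c 0.
  by exists 0; rewrite ?mulr0 ?normr0/=.
exists (`|c|^-1 * c^*).
  by rewrite -lecR Re_normcE normrM normrV ?unitfE ?normr_eq0// normr_id norm_conjC mulVf
    ?normr_eq0.
by rewrite -mulrA [_^* * _]mulrC -normCK expr2 mulrA mulVf ?normr_eq0// mul1r.
Qed.

End ComplexParts.

(** * Positive hermitian forms, Cauchy-Schwarz and diagonalisation *)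

Section PositiveForms.
Context (R : realType) (H : hilbertType R).

(** [A] is a bare map: hermitian symmetry already makes the form conjugate-linear in its second
    argument, so the defect and its rank-one corrections can be used without being built as bounded
    operators. *)
Definition positive_form (A : H -> H) :=
  (forall u v, hdot u (A v) = (hdot v (A u))^*) /\
  (forall u, 0 <= complex.Re (hdot u (A u))).

Definition qform (A : H -> H) (u : H) : R := complex.Re (hdot u (A u)).

Lemma positive_formE (A : H -> H) u : positive_form A ->
  hdot u (A u) = (qform A u)%:C.
Proof.
move=> [Ah A0]; rewrite /qform; have := Ah u u.
case: (hdot u _) => a b /eqP; rewrite eq_complex /= => /andP[_ /eqP b0].
by congr (_ +i* _); lra.
Qed.

Lemma positive_formDl (A : H -> H) (a : R[i]) u v w : positive_form A ->
  hdot w (A (a *: u + v)) = a^* * hdot w (A u) + hdot w (A v).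
Proof.
move=> [Ah _]; rewrite Ah hdotDl hdotZl rmorphD rmorphM /=.
by rewrite -!Ah.
Qed.

Lemma qformDZ (A : H -> H) (a : R[i]) u v : positive_form A ->
  qform A (a *: u + v) =
  complex.Re `|a| ^+ 2 * qform A u + 2 * complex.Re (a * hdot u (A v)) + qform A v.
Proof.
move=> PA; rewrite [LHS]/qform positive_formDl// !hdotDl !hdotZl.
rewrite (positive_formE u PA) (positive_formE v PA) (PA.1 v u) Re_norm_sqr.
case: (hdot u (A v)) a => [p q] [x y] /=; ring.
Qed.

Lemma quadratic_discr (a b c : R) : 0 <= a -> 0 <= c ->
  (forall t, 0 <= t ^+ 2 * a + 2 * t * b + c) -> b ^+ 2 <= a * c.
Proof.
move=> a0 c0 h.
have [a_eq0|a_neq0] := eqVneq a 0.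
  have [->|b0] := eqVneq b 0; first by rewrite expr0n mulr_ge0.
  (* With a = 0, this t turns the quadratic into - (c + 1) + c = -1. *)
  have := h (- (c + 1) / (2 * b)).
  rewrite a_eq0 mulr0 add0r.
  have -> : 2 * (- (c + 1) / (2 * b)) * b = - (c + 1) by field; exact: b0.
  lra.
have ap : 0 < a by rewrite lt_def a_neq0.
have := h (- b / a).
have -> : (- b / a) ^+ 2 * a + 2 * (- b / a) * b + c = (a * c - b ^+ 2) / a.
  by field.
by rewrite pmulr_lge0 ?invr_gt0// subr_ge0.
Qed.

Lemma positive_form_CS (A : H -> H) u v : positive_form A ->
  complex.Re `|hdot u (A v)| ^+ 2 <= qform A u * qform A v.
Proof.
(* Multiplying u by a phase makes the cross term real, so that only real t have to be considered. *)
move=> PA; have [w w1 ->] := phaseP (hdot u (A v)).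
apply: quadratic_discr; rewrite ?PA.2// => t.
have := PA.2 ((t%:C * w) *: u + v); rewrite -/(qform _ _) qformDZ//.
move/le_trans; apply; rewrite -mulrA ReZ mulrA lerD2r lerD2r ler_wpM2r ?PA.2//.
rewrite Re_normM Re_norm_real exprMn real_normK ?num_real//.
rewrite ler_piMr ?sqr_ge0// expr_le1 ?Re_normc_ge0//.
Qed.

Lemma positive_form_id : positive_form id.
Proof.
by split=> [u v|u]; [exact: hdotC|rewrite hdot_hnorm /= sqr_ge0].
Qed.

Lemma qform_id u : qform id u = hnorm u ^+ 2.
Proof. by rewrite /qform hdot_hnorm. Qed.

Lemma hdot_CS (u v : H) : complex.Re `|hdot u v| <= hnorm u * hnorm v.
Proof.
rewrite -(@ler_pXn2r _ 2)// ?nnegrE ?mulr_ge0 ?hnorm_ge0 ?Re_normc_ge0//.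
have := positive_form_CS u v positive_form_id.
by rewrite !qform_id -exprMn.
Qed.

(* Gram-Schmidt orthogonalisation with respect to the form <u, A v>. *)
Lemma positive_form_diagonalize (s : seq H) (A : H -> H) : positive_form A ->
  exists zs : seq H,
    (forall u, u \in s -> qform A u = \sum_(z <- zs) complex.Re `|hdot u z| ^+ 2) /\
    (forall x, \sum_(z <- zs) complex.Re `|hdot x z| ^+ 2 <= qform A x).
Proof.
elim: s A => [|v s IHs] A PA.
  by exists [::]; split=> // x; rewrite big_nil PA.2.
have sum_ge0 (zs : seq H) x : 0 <= \sum_(z <- zs) complex.Re `|hdot x z| ^+ 2.
  by apply: sumr_ge0 => z _; rewrite sqr_ge0.
have [v0|v0] := eqVneq (qform A v) 0.
  (* If the form vanishes at v, the inequality valid for all x already forces the sum at v to be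
     0. *)
  have [zs [zs1 zs2]] := IHs A PA; exists zs; split=> // u.
  rewrite inE => /predU1P[->|/zs1//].
  by apply: le_anti; rewrite zs2 v0 sum_ge0.
set d := qform A v in v0.
have dp : 0 < d by rewrite lt_def v0 PA.2.
(* Normalised so that |<v, z0>|^2 equals the form at v. Subtracting the rank-one form of z0 gives a
   form that vanishes at v and is still positive, by Cauchy-Schwarz. *)
pose z0 : H := ((Num.sqrt d)^-1)%:C *: A v.
pose A' u := A u - hdot u z0 *: z0.
have A'E u w : hdot u (A' w) = hdot u (A w) - (d^-1)%:C * (hdot u (A v) * (hdot w (A v))^*).
  rewrite /A' hdotDr hdotNr hdotZr; congr (_ - _).
  rewrite /z0 !hdotZr !rmorphM /= conjCK.
  have -> : (d^-1)%:C = ((Num.sqrt d)^-1)%:C * ((Num.sqrt d)^-1)%:C :> R[i].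
    by rewrite -rmorphM /= -invfM -expr2 sqr_sqrtr ?(ltW dp).
  have rJ (t : R) : (t%:C)^* = t%:C :> R[i].
    by apply/eqP; rewrite eq_complex /= oppr0 !eqxx.
  rewrite !rJ; ring.
have qA' u : qform A' u = qform A u - complex.Re `|hdot u z0| ^+ 2.
  rewrite /qform A'E ReD ReN ReZ -Re_norm_mulJ /z0 hdotZr Re_normM Re_norm_conj.
  by rewrite Re_norm_real exprMn real_normK ?num_real// exprVn sqr_sqrtr ?(ltW dp).
have PA' : positive_form A'.
  split=> [u w|u].
    rewrite !A'E rmorphB !rmorphM /= conjCK -(PA.1 u w); congr (_ - _).
    have -> : ((d^-1)%:C)^* = (d^-1)%:C :> R[i].
      by apply/eqP; rewrite eq_complex /= oppr0 !eqxx.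
    by congr (_ * _); rewrite mulrC.
  rewrite -/(qform A' u) qA' subr_ge0 /z0 hdotZr Re_normM Re_norm_conj.
  rewrite Re_norm_real exprMn real_normK ?num_real// exprVn sqr_sqrtr ?(ltW dp)//.
  by rewrite ler_pdivrMl// mulrC positive_form_CS.
have [zs [zs1 zs2]] := IHs A' PA'.
have vz0 : complex.Re `|hdot v z0| ^+ 2 = d.
  rewrite /z0 hdotZr Re_normM Re_norm_conj positive_formE// -/d !Re_norm_real.
  rewrite exprMn !real_normK ?num_real// exprVn sqr_sqrtr ?(ltW dp)//.
  by field; exact: v0.
exists (z0 :: zs); split=> [u|x]; last first.
  by rewrite big_cons; have := zs2 x; rewrite qA'; lra.
rewrite inE big_cons => /predU1P[->|us]; last first.
  by rewrite -(zs1 _ us) qA'; lra.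
(* The vectors found for the reduced form contribute nothing at v, where that form is 0, so z0 alone
   gives equality there. *)
have := zs2 v; rewrite qA' vz0 -/d subrr => vle.
by rewrite (le_anti (introT andP (conj vle (sum_ge0 zs v)))) addr0.
Qed.

End PositiveForms.

(** * Limits in Hilbert spaces *)

Section HilbertLimits.
Context (R : realType).
Implicit Type H : hilbertType R.

Lemma cvg_le_bound (T : Type) (F : set_system T) {FF : ProperFilter F} (f : T -> R) (l b : R) :
  f @ F --> l -> (\forall x \near F, f x <= b) -> l <= b.
Proof.
move=> fl fb; apply: (@closed_cvg _ _ F FF f (fun r => r <= b) (@closed_le R b) _ l) => //.
Qed.

Lemma hcvgP H (T : Type) (F : set_system T) {FF : Filter F} (f : T -> H) (l : H) :
  f @ F --> l <-> forall e : R, 0 < e -> \forall x \near F, hnorm (l - f x) < e.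
Proof.
split=> [/cvgrPdist_lt fl e e0|fl].
  have := fl e%:C; rewrite ltcR => /(_ e0); apply: filterS => x.
  by rewrite -hnormE ltcR.
apply/cvgrPdist_lt => e e0.
have [r er] := complex_realP _ (gtr0_real e0); subst e.
have := fl r; rewrite -ltcR => /(_ e0); apply: filterS => x.
by rewrite -hnormE ltcR.
Qed.

Lemma hcvg_cauchy H (T : Type) (F : set_system T) {FF : ProperFilter F} (f : T -> H) :
  (forall e : R, 0 < e -> exists y, \forall x \near F, hnorm (y - f x) < e) ->
  exists l : H, f @ F --> l.
Proof.
move=> fc; have : cauchy (f @ F) -> cvg ((f @ F) : set_system H).
  exact: cauchy_cvg.
move=> fF; apply/cvg_ex; apply: fF; apply/cauchyP => e e0.
have [r er] := complex_realP _ (gtr0_real e0); subst e.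
have [|y fy] := fc r; first by rewrite -ltcR.
by exists y; apply: filterS fy => x; rewrite -ball_normE /= -hnormE ltcR.
Qed.

Lemma cvg_hnorm H (T : Type) (F : set_system T) {FF : Filter F} (f : T -> H) (l : H) :
  f @ F --> l -> hnorm (f x) @[x --> F] --> hnorm l.
Proof.
move=> /hcvgP fl; apply/cvgrPdist_lt => e e0; apply: filterS (fl e e0) => x.
exact/le_lt_trans/hnorm_dist.
Qed.

Lemma cvg_bop H (K : hilbertType R) (X : bop H K) (T : Type) (F : set_system T)
    {FF : Filter F} (f : T -> H) (l : H) :
  f @ F --> l -> X (f x) @[x --> F] --> X l.
Proof.
move=> /hcvgP fl; apply/hcvgP => e e0; have [C C0 XC] := bop_bound X.
have C1 : 0 < C + 1 by rewrite ltr_wpDl.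
apply: filterS (fl (e / (C + 1)) (divr_gt0 e0 C1)) => x.
rewrite ltr_pdivlMr// -linearB => h.
apply: le_lt_trans (XC _) _; apply: le_lt_trans h.
by rewrite mulrC ler_wpM2l ?hnorm_ge0// lerDl.
Qed.

Lemma cvg_Re_hdot H (T : Type) (F : set_system T) {FF : Filter F} (f : T -> H) (l y : H) :
  f @ F --> l -> complex.Re (hdot (f x) y) @[x --> F] --> complex.Re (hdot l y).
Proof.
move=> /hcvgP fl; apply/cvgrPdist_lt => e e0.
have C1 : 0 < hnorm y + 1 by rewrite ltr_wpDl ?hnorm_ge0.
apply: filterS (fl (e / (hnorm y + 1)) (divr_gt0 e0 C1)) => x.
rewrite ltr_pdivlMr// -ReN -ReD -hdotNl -hdotDl => h.
apply: le_lt_trans h; apply: le_trans (_ : complex.Re `|hdot (l - f x) y| <= _).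
  rewrite ler_norml Re_le_norm andbT lerNl -ReN -hdotNl.
  by rewrite (le_trans (Re_le_norm _))// hdotNl normrN.
by rewrite (le_trans (hdot_CS _ _))// ler_wpM2l ?hnorm_ge0// lerDl ler01.
Qed.

Lemma hnorm_eq0 H (x : H) : hnorm x = 0 -> x = 0.
Proof. by move=> x0; apply/normr0_eq0; rewrite -hnormE x0. Qed.

Lemma hdot_ext H (x y : H) : (forall z, complex.Re (hdot x z) = complex.Re (hdot y z)) -> x = y.
Proof.
move=> xy; apply/eqP; rewrite -subr_eq0; apply/eqP/hnorm_eq0/eqP.
have : complex.Re (hdot (x - y) (x - y)) = 0.
  by rewrite {1}hdotDl hdotNl ReD ReN xy subrr.
by rewrite hdot_hnorm /= => /eqP; rewrite sqrf_eq0.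
Qed.

Lemma hdot_extr H (x y : H) : (forall z, hdot z x = hdot z y) -> x = y.
Proof.
by move=> xy; apply: hdot_ext => z; rewrite hdotC ReJ xy hdotC ReJ.
Qed.

Lemma Re_hdotC H (x y : H) : complex.Re (hdot x y) = complex.Re (hdot y x).
Proof. by rewrite hdotC ReJ. Qed.

End HilbertLimits.

(** * Riesz representation on closed subspaces *)

Section Riesz.
Context (R : realType) (H : hilbertType R).

(* Minimise |x|^2 - 2 Re (phi x) over M; by the parallelogram identity every
   minimising sequence is Cauchy. *)
Lemma riesz_on (M : set H) (phi : H -> R[i]) (C : R) :
  M 0 -> (forall a x y, M x -> M y -> M (a *: x + y)) ->
  (forall x, (forall e : R, 0 < e -> exists2 y, M y & hnorm (x - y) < e) -> M x) ->
  (forall a x y, phi (a *: x + y) = a * phi x + phi y) ->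
  (forall x, complex.Re (phi x) <= C * hnorm x) ->
  exists2 x, M x & forall y, M y -> phi y = hdot y x.
Proof.
move=> M0 Mlin Mcl philin phiC.
have phiD x y : phi (x + y) = phi x + phi y.
  by rewrite -[x in LHS]scale1r philin mul1r.
have phi0 : phi 0 = 0 by apply: (addrI (phi 0)); rewrite -phiD !addr0.
have phiZ a x : phi (a *: x) = a * phi x.
  by rewrite -[a *: x]addr0 philin phi0 addr0.
have MD x y : M x -> M y -> M (x + y).
  by move=> Mx My; rewrite -[x]scale1r; exact: Mlin.
have MZ a x : M x -> M (a *: x).
  by move=> Mx; rewrite -[a *: x]addr0; exact: Mlin.
pose J x : R := hnorm x ^+ 2 - 2 * complex.Re (phi x).
pose S := [set J x | x in M].
(* Since |x|^2 - 2 C |x| = (|x| - C)^2 - C^2. *)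
have Slb : lbound S (- C ^+ 2).
  move=> _ [x Mx <-]; rewrite /J; have := phiC x; have := sqr_ge0 (hnorm x - C).
  by move: (hnorm x) (complex.Re _) => u v; nra.
have Sinf : has_inf S by split; [exists (J 0); exists 0|exists (- C ^+ 2)].
set d := inf S.
have dJ x : M x -> d <= J x.
  by move=> Mx; apply: ge_inf; [exists (- C ^+ 2)|exists x].
have /choice[x xP] : forall n : nat, exists x, M x /\ J x < d + n.+1%:R^-1.
  move=> n; have e0 : 0 < n.+1%:R^-1 :> R by rewrite invr_gt0 ltr0Sn.
  by have [_ [x Mx <-] ?] := inf_adherent e0 Sinf; exists x.
have JD u v : J (u + v) = J u + 2 * complex.Re (hdot v u - phi v) + hnorm v ^+ 2.
  by rewrite /J hnorm_sqrD phiD !ReD ReN (Re_hdotC u v); ring.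
have xx n m : hnorm (x n - x m) ^+ 2 <= 2 * n.+1%:R^-1 + 2 * m.+1%:R^-1.
  have [[Mn Jn] [Mm Jm]] := (xP n, xP m).
  have := dJ (2^-1 *: (x n + x m)) (MZ _ _ (MD _ _ Mn Mm)).
  have n2 : complex.Re `|2^-1 : R[i]| = 2^-1.
    have -> : (2^-1 : R[i]) = (2^-1)%:C by rewrite fmorphV /= rmorphD.
    by rewrite Re_norm_real ger0_norm.
  have RJ : complex.Re (phi (2^-1 *: (x n + x m))) = 2^-1 * complex.Re (phi (x n) + phi (x m)).
    have -> : (2^-1 : R[i]) = (2^-1)%:C by rewrite fmorphV /= rmorphD.
    by rewrite phiZ ReZ phiD.
  move: Jn Jm; rewrite /J RJ hnormZ n2 exprMn hnorm_sqrD hnorm_sqrD ReD hnormN hdotNr ReN.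
  move: (hnorm _) (hnorm _) (complex.Re _) (complex.Re _) (complex.Re _) => a b c e f.
  move: (n.+1%:R^-1) (m.+1%:R^-1) => p q; lra.
have small (e : R) : 0 < e -> exists N : nat, forall n, (N <= n)%N -> n.+1%:R^-1 < e.
  move=> e0; exists (Num.truncn e^-1) => n Nn.
  rewrite invf_plt ?posrE ?ltr0Sn//.
  apply: lt_le_trans (truncnS_gt _) _; rewrite ler_nat ltnS //.
have [l xl] : exists l : H, x @ \oo --> l.
  apply: hcvg_cauchy => e e0.
  have [|N NP] := small (e ^+ 2 / 4); first by rewrite divr_gt0 ?exprn_gt0.
  exists (x N); exists N => // n /= Nn.
  rewrite -(@ltr_pXn2r _ 2)// ?nnegrE ?hnorm_ge0 ?(ltW e0)//.
  apply: le_lt_trans (xx _ _) _; have := NP _ (leqnn N); have := NP _ Nn.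
  by move: (N.+1%:R^-1) (n.+1%:R^-1) => p q; lra.
have Ml : M l.
  apply: Mcl => e e0; have /hcvgP/(_ _ e0)[N _ /(_ N (leqnn N))] := xl.
  by exists (x N) => //; have [] := xP N.
(* First variation at the minimiser: comparing x_n with x_n + t y and letting n grow leaves a
   nonnegative quadratic in t with constant term 0, whose linear coefficient must vanish. *)
have Re0 y : M y -> complex.Re (phi y) = complex.Re (hdot y l).
  move=> My; set a := complex.Re (hdot y l) - complex.Re (phi y).
  suff a0 : a ^+ 2 <= hnorm y ^+ 2 * 0.
    move: a0; rewrite mulr0 => a0.
    have /eqP : a ^+ 2 = 0 by apply: le_anti; rewrite a0 sqr_ge0.
    by rewrite sqrf_eq0 subr_eq0 => /eqP.
  apply: quadratic_discr => // [|t]; first exact: sqr_ge0.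
  have lim : t ^+ 2 * hnorm y ^+ 2 + 2 * t * (complex.Re (hdot (x n) y) - complex.Re (phi y)) +
    n.+1%:R^-1
     @[n --> \oo] --> t ^+ 2 * hnorm y ^+ 2 + 2 * t * (complex.Re (hdot l y) - complex.Re (phi
       y)) + 0.
    apply: cvgD; last first.
      by apply/cvgrPdist_lt => e /small[N NP]; exists N => // n /= /NP;
        rewrite sub0r normrN ger0_norm ?invr_ge0.
    apply: cvgD; first exact: cvg_cst.
    apply: cvgM; first exact: cvg_cst.
    by apply: cvgB; [exact: cvg_Re_hdot|exact: cvg_cst].
  rewrite /a (Re_hdotC y).
  rewrite -oppr_le0; apply: (cvg_le_bound (cvgN lim)); near=> n; rewrite oppr_le0.
  have [Mn Jn] := xP n.
  have := dJ (x n + t%:C *: y) (MD _ _ Mn (MZ _ _ My)).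
  rewrite JD hdotZl phiZ ReD ReN !ReZ hnormZ Re_norm_real exprMn.
  rewrite real_normK ?num_real// (Re_hdotC y); move: Jn.
  move: (complex.Re _) (complex.Re _) (hnorm y) (n.+1%:R^-1) => p q r s; lra.
exists l => // y My.
(* The imaginary part at y is the real part at -i y. *)
have h1 := Re0 _ My; have := Re0 _ (MZ (-'i%C) _ My).
rewrite phiZ hdotZl; move: h1; case: (phi y) => p q; case: (hdot y l) => r s /=.
by move=> -> h; apply/eqP; rewrite eq_complex /= eqxx /=; apply/eqP; lra.
Unshelve. all: by end_near. Qed.

Lemma riesz (phi : H -> R[i]) (C : R) :
  (forall a x y, phi (a *: x + y) = a * phi x + phi y) ->
  (forall x, complex.Re (phi x) <= C * hnorm x) ->
  exists x, forall y, phi y = hdot y x.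
Proof.
move=> pl pC; have [x _ xP] := @riesz_on setT phi C I (fun _ _ _ _ _ => I) (fun _ _ => I) pl pC.
by exists x => y; exact: xP.
Qed.

(** The Riesz vector of y |-> <y, x> on M is the orthogonal projection of x, so the difference is
    orthogonal to M. This is the density criterion behind [abel_cvg]. *)
Lemma closed_submodule_full (M : set H) :
  M 0 -> (forall a x y, M x -> M y -> M (a *: x + y)) ->
  (forall x, (forall e : R, 0 < e -> exists2 y, M y & hnorm (x - y) < e) -> M x) ->
  (forall x, (forall y, M y -> hdot y x = 0) -> x = 0) -> M = setT.
Proof.
move=> M0 Ml Mc M1; apply/seteqP; split=> // x _.
have [a y z|y|p Mp pP] := @riesz_on M (fun y => hdot y x) (hnorm x) M0 Ml Mc.
- exact: hdotP.
- by rewrite mulrC (le_trans (Re_le_norm _))// hdot_CS.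
suff /eqP : x - p = 0 by rewrite subr_eq0 => /eqP ->.
by apply: M1 => y My; rewrite hdotDr hdotNr (pP _ My) subrr.
Qed.

End Riesz.

(** * Operator norm, adjoints and limits of operators *)

Section Operators.
Context (R : realType).
Implicit Types H K L : hilbertType R.

Lemma bop_ext H K (f g : bop H K) : (forall x, f x = g x) -> f = g.
Proof. by move=> fg; apply/val_inj/funext. Qed.

Lemma bopD H K (f g : bop H K) x : (f + g) x = f x + g x. Proof. by []. Qed.
Lemma bopB H K (f g : bop H K) x : (f - g) x = f x - g x. Proof. by []. Qed.
Lemma bopZ H K a (f : bop H K) x : (a *: f) x = a *: f x. Proof. by []. Qed.
Lemma bop0 H K x : (0 : bop H K) x = 0. Proof. by []. Qed.
Lemma bcompE H K L (f : bop K L) (g : bop H K) x : (f \ob g) x = f (g x).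
Proof. by []. Qed.

Lemma bop_sum H K (I : Type) (s : seq I) (P : pred I) (f : I -> bop H K) x :
  (\sum_(i <- s | P i) f i) x = \sum_(i <- s | P i) f i x.
Proof. by apply: (big_morph (fun g : bop H K => g x)). Qed.

Lemma hdot_suml H (I : Type) (s : seq I) (P : pred I) (f : I -> H) y :
  hdot (\sum_(i <- s | P i) f i) y = \sum_(i <- s | P i) hdot (f i) y.
Proof. by apply: (big_morph (fun x => hdot x y)) => [u v|]; rewrite ?hdotDl ?hdot0l. Qed.

Lemma hdot0r H (y : H) : hdot y 0 = 0.
Proof. by rewrite hdotC hdot0l conjC0. Qed.

Lemma hdot_sumr H (I : Type) (s : seq I) (P : pred I) (f : I -> H) y :
  hdot y (\sum_(i <- s | P i) f i) = \sum_(i <- s | P i) hdot y (f i).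
Proof. by apply: (big_morph (fun x => hdot y x)) => [u v|]; rewrite ?hdotDr ?hdot0r. Qed.

Lemma linear_bounded_bop H K (f : H -> K) : linear f ->
  (exists C : R, forall x, hnorm (f x) <= C * hnorm x) ->
  exists g : bop H K, forall x, g x = f x.
Proof.
move=> fl fb; have fP : f \in @bounded_linear R H K by apply/bounded_linearP.
by exists (Bop fP).
Qed.

Lemma opnorm_has_sup H K (f : bop H K) :
  has_sup [set hnorm (f x) | x in [set x : H | hnorm x <= 1]].
Proof.
split; first by exists (hnorm (f 0)); exists 0 => //=; rewrite hnorm0.
have [C C0 fC] := bop_bound f; exists C => _ [x /= x1 <-].
by rewrite (le_trans (fC x))// ler_piMr.
Qed.

Lemma opnorm_ge0 H K (f : bop H K) : 0 <= opnorm f.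
Proof.
rewrite -[0](_ : hnorm (f 0) = 0); last by rewrite linear0 hnorm0.
apply: ub_le_sup; first by have [] := opnorm_has_sup f.
by exists 0 => //=; rewrite hnorm0.
Qed.

Lemma opnorm_le H K (f : bop H K) x : hnorm (f x) <= opnorm f * hnorm x.
Proof.
have [x0|x0] := eqVneq (hnorm x) 0.
  by rewrite (hnorm_eq0 x0) linear0 hnorm0 mulr_ge0 ?opnorm_ge0 ?hnorm_ge0.
have xp : 0 < hnorm x by rewrite lt_def x0 hnorm_ge0.
rewrite -ler_pdivrMr//.
have -> : hnorm (f x) / hnorm x = hnorm (f (((hnorm x)^-1)%:C *: x)).
  by rewrite linearZ /= hnormZ Re_norm_real ger0_norm ?invr_ge0 ?hnorm_ge0// mulrC.
apply: ub_le_sup; first by have [] := opnorm_has_sup f.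
eexists; last by [].
by rewrite /= hnormZ Re_norm_real ger0_norm ?invr_ge0 ?hnorm_ge0// mulVf.
Qed.

Lemma opnorm_bound H K (f : bop H K) (C : R) : 0 <= C ->
  (forall x, hnorm (f x) <= C * hnorm x) -> opnorm f <= C.
Proof.
move=> C0 fC; apply: ge_sup; first by have [] := opnorm_has_sup f.
by move=> _ [x /= x1 <-]; rewrite (le_trans (fC x))// ler_piMr.
Qed.

Lemma opnorm_sqr_bound H K (f : bop H K) (C : R) : 0 <= C ->
  (forall x, hnorm (f x) ^+ 2 <= C ^+ 2 * hnorm x ^+ 2) -> opnorm f <= C.
Proof.
move=> C0 fC; apply: opnorm_bound => // x.
by rewrite -(@ler_pXn2r _ 2)// ?nnegrE ?mulr_ge0 ?hnorm_ge0// exprMn.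
Qed.

Lemma opnormD H K (f g : bop H K) : opnorm (f + g) <= opnorm f + opnorm g.
Proof.
apply: opnorm_bound; rewrite ?addr_ge0 ?opnorm_ge0// => x.
by rewrite (le_trans (hnormD _ _))// mulrDl lerD// opnorm_le.
Qed.

Lemma opnormZ H K a (f : bop H K) : opnorm (a *: f) <= complex.Re `|a| * opnorm f.
Proof.
apply: opnorm_bound; rewrite ?mulr_ge0 ?Re_normc_ge0 ?opnorm_ge0// => x.
by rewrite bopZ hnormZ -mulrA ler_wpM2l ?Re_normc_ge0// opnorm_le.
Qed.

Lemma opnormN H K (f : bop H K) : opnorm (- f) = opnorm f.
Proof.
have h (g : bop H K) : opnorm (- g) <= opnorm g.
  by rewrite -scaleN1r (le_trans (opnormZ _ _))// normrN normr1 mul1r.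
by apply: le_anti; rewrite h -{1}[f]opprK h.
Qed.

Lemma opnormM H K L (f : bop K L) (g : bop H K) :
  opnorm (f \ob g) <= opnorm f * opnorm g.
Proof.
apply: opnorm_bound; rewrite ?mulr_ge0 ?opnorm_ge0// => x.
rewrite (le_trans (opnorm_le f _))// -mulrA ler_wpM2l ?opnorm_ge0//.
exact: opnorm_le.
Qed.

Lemma adj_exists H K (f : bop H K) :
  exists g : bop K H, forall x y, hdot (f x) y = hdot x (g y).
Proof.
have [C C0 fC] := bop_bound f.
have /choice[g gP] y : exists z, forall x, hdot (f x) y = hdot x z.
  apply: (@riesz R H (fun x => hdot (f x) y) (C * hnorm y)) => [a x x'|x].
    by rewrite linearP hdotP.
  rewrite (le_trans (Re_le_norm _))// (le_trans (hdot_CS _ _))//.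
  by rewrite -mulrA [hnorm y * _]mulrC mulrA ler_wpM2r ?hnorm_ge0.
have gl : linear g.
  move=> a x y; apply: hdot_extr => z.
  by rewrite -gP !hdotDr !hdotZr -!gP.
have [|g' g'E] := linear_bounded_bop gl; last first.
  by exists g' => x y; rewrite g'E.
exists C => y.
have [->|g0] := eqVneq (g y) 0; first by rewrite hnorm0 mulr_ge0 ?hnorm_ge0.
have gp : 0 < hnorm (g y).
  by rewrite lt_def hnorm_ge0 andbT; apply: contra_neq g0; exact: hnorm_eq0.
rewrite -(ler_pM2r gp) -expr2.
have := gP y (g y); rewrite hdot_hnorm => /(congr1 (@complex.Re R)) /= <-.
rewrite (le_trans (Re_le_norm _))// (le_trans (hdot_CS _ _))//.
by rewrite mulrAC ler_wpM2r ?hnorm_ge0.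
Qed.

Lemma adjP H K (f : bop H K) x y : hdot (f x) y = hdot x (adj f y).
Proof. by rewrite /adj; case: xgetP => [g _ ->//|]; have [g ?] := adj_exists f => /(_ g). Qed.

Lemma adjPr H K (f : bop H K) x y : hdot y (f x) = hdot (adj f y) x.
Proof. by rewrite hdotC adjP -hdotC. Qed.

Lemma adj_unique H K (f : bop H K) (g : bop K H) :
  (forall x y, hdot (f x) y = hdot x (g y)) -> adj f = g.
Proof. by move=> fg; apply: bop_ext => y; apply: hdot_extr => x; rewrite -adjP. Qed.

Lemma adjK H K (f : bop H K) : adj (adj f) = f.
Proof. by apply: adj_unique => x y; rewrite -adjPr. Qed.

Lemma adj_inj H K : injective (@adj R H K).
Proof. exact: can_inj (@adjK H K). Qed.

Lemma adj_comp H K L (f : bop K L) (g : bop H K) : adj (f \ob g) = adj g \ob adj f.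
Proof. by apply: adj_unique => x y; rewrite !bcompE -!adjP. Qed.

Lemma adjD H K (f g : bop H K) : adj (f + g) = adj f + adj g.
Proof. by apply: adj_unique => x y; rewrite !bopD hdotDl hdotDr -!adjP. Qed.

Lemma adjZ H K a (f : bop H K) : adj (a *: f) = a^* *: adj f.
Proof.
by apply: adj_unique => x y; rewrite !bopZ hdotZl hdotZr -adjP conjCK.
Qed.

Lemma adj0 H K : adj (0 : bop H K) = 0.
Proof. by apply: adj_unique => x y; rewrite !bop0 hdot0l hdot0r. Qed.

Lemma adj_id H : adj (bid H) = bid H.
Proof. by apply: adj_unique. Qed.

Lemma adj_sum H K (I : Type) (s : seq I) (P : pred I) (f : I -> bop H K) :
  adj (\sum_(i <- s | P i) f i) = \sum_(i <- s | P i) adj (f i).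
Proof. by apply: (big_morph (@adj R H K)) => [f' g|]; rewrite ?adjD ?adj0. Qed.

Lemma hnorm_adj_le H K (f : bop H K) (C : R) y : 0 <= C ->
  (forall x, hnorm (f x) <= C * hnorm x) -> hnorm (adj f y) <= C * hnorm y.
Proof.
move=> C0 fC; have [->|g0] := eqVneq (adj f y) 0.
  by rewrite hnorm0 mulr_ge0 ?hnorm_ge0.
have gp : 0 < hnorm (adj f y).
  by rewrite lt_def hnorm_ge0 andbT; apply: contra_neq g0; exact: hnorm_eq0.
rewrite -(ler_pM2r gp) -expr2.
have := adjP f (adj f y) y.
rewrite hdot_hnorm => /(congr1 (@complex.Re R)) /= <-.
rewrite (le_trans (Re_le_norm _))// (le_trans (hdot_CS _ _))//.
by rewrite mulrAC ler_wpM2r ?hnorm_ge0.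
Qed.

Lemma opnorm_adj H K (f : bop H K) : opnorm (adj f) = opnorm f.
Proof.
have h H' K' (g : bop H' K') : opnorm (adj g) <= opnorm g.
  apply: opnorm_bound; rewrite ?opnorm_ge0// => x.
  by apply: hnorm_adj_le; rewrite ?opnorm_ge0//; exact: opnorm_le.
by apply: le_anti; rewrite h -{1}[f]adjK h.
Qed.

Lemma hcvg_unique H (T : Type) (F : set_system T) {FF : ProperFilter F} (f : T -> H) (l l' : H) :
  f @ F --> l -> f @ F --> l' -> l = l'.
Proof. by move=> fl fl'; apply: (@cvg_unique _ (@norm_hausdorff _ H) (f @ F) _ _ _ fl). Qed.

(** The limit is linear by uniqueness of limits, and the eventual uniform bound, which every
    application supplies, does the work of Banach-Steinhaus. *)
Lemma pointwise_limit_bop H K (T : Type) (F : set_system T) {FF : ProperFilter F}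
    (X : T -> bop H K) (M : R) :
  (\forall t \near F, forall h, hnorm (X t h) <= M * hnorm h) ->
  (forall h, exists l : K, X t h @[t --> F] --> l) ->
  exists Y : bop H K, forall h, X t h @[t --> F] --> Y h.
Proof.
move=> XM /choice[Y XY].
have Yl : linear Y.
  move=> a x y; apply: hcvg_unique (XY _) _.
  have -> : (fun t => X t (a *: x + y)) = (fun t => a *: X t x + X t y).
    by apply/funext => t; rewrite linearP.
  by apply: cvgD; [apply: cvgZr; exact: XY|exact: XY].
have [|Y' Y'E] := linear_bounded_bop Yl; last first.
  by exists Y' => h; rewrite Y'E.
exists M => h; apply: cvg_le_bound (cvg_hnorm (XY h)) _.
by apply: filterS XM => t; exact.
Qed.

Lemma op_cvg_pointwise H K (X : nat -> bop H K) (Y : bop H K) h :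
  op_cvg X Y -> X l h @[l --> \oo] --> Y h.
Proof.
move=> XY; apply/hcvgP => e e0.
have C1 : 0 < hnorm h + 1 by rewrite ltr_wpDl ?hnorm_ge0.
move/cvgrPdist_lt : XY => /(_ (e / (hnorm h + 1)) (divr_gt0 e0 C1)).
apply: filterS => l; rewrite sub0r normrN ger0_norm ?opnorm_ge0// => Xl.
rewrite -opprB hnormN -bopB; apply: le_lt_trans (opnorm_le _ _) _.
move: Xl; rewrite ltr_pdivlMr//; apply: le_lt_trans.
by rewrite ler_wpM2l ?opnorm_ge0// lerDl.
Qed.

Lemma op_cauchy_cvg H K (X : nat -> bop H K) :
  (forall e : R, 0 < e -> exists N : nat, forall n, (N <= n)%N -> opnorm (X n - X N) < e) ->
  exists Y, op_cvg X Y.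
Proof.
move=> Xc.
have [N0 N0P] := Xc 1 ltr01.
have Xb : \forall n \near \oo, forall h, hnorm (X n h) <= (1 + opnorm (X N0)) * hnorm h.
  exists N0 => // n /= /N0P nN h; rewrite (le_trans (opnorm_le _ _))// ler_wpM2r ?hnorm_ge0//.
  by rewrite -[X n](subrK (X N0)) (le_trans (opnormD _ _))// lerD// ltW.
have [|Y XY] := pointwise_limit_bop Xb.
  move=> h; apply: hcvg_cauchy => e e0.
  have C1 : 0 < hnorm h + 1 by rewrite ltr_wpDl ?hnorm_ge0.
  have [N NP] := Xc (e / (hnorm h + 1)) (divr_gt0 e0 C1).
  exists (X N h); exists N => // n /= /NP nN.
  rewrite -opprB hnormN -bopB; apply: le_lt_trans (opnorm_le _ _) _.
  move: nN; rewrite ltr_pdivlMr//; apply: le_lt_trans.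
  by rewrite ler_wpM2l ?opnorm_ge0// lerDl.
exists Y; apply/cvgrPdist_le => e e0.
have [|N NP] := Xc (e / 2); first by rewrite divr_gt0.
exists N => // n /= Nn; rewrite sub0r normrN ger0_norm ?opnorm_ge0//.
apply: opnorm_bound => [|h]; first exact: ltW.
have lim : hnorm (X n h - X m h) @[m --> \oo] --> hnorm ((X n - Y) h).
  by apply: cvg_hnorm; apply: cvgB; [exact: cvg_cst|exact: XY].
apply: (cvg_le_bound lim).
exists N => // m /= Nm; rewrite -bopB (le_trans (opnorm_le _ _))//.
rewrite ler_wpM2r ?hnorm_ge0//.
have -> : X n - X m = (X n - X N) - (X m - X N) by rewrite opprB addrA subrK.
rewrite (le_trans (opnormD _ _))// opnormN.
have := NP _ Nn; have := NP _ Nm; lra.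
Qed.

Lemma op_cvgP H K (X : nat -> bop H K) (Y : bop H K) : op_cvg X Y <->
  (forall e : R, 0 < e -> exists N : nat, forall n, (N <= n)%N -> opnorm (X n - Y) < e).
Proof.
split=> [/cvgrPdist_lt h e e0|h].
  have [N _ NP] := h e e0; exists N => n Nn; have := NP n Nn.
  by rewrite sub0r normrN ger0_norm ?opnorm_ge0.
apply/cvgrPdist_lt => e e0; have [N NP] := h e e0; exists N => // n Nn /=.
by rewrite sub0r normrN ger0_norm ?opnorm_ge0//; exact: NP.
Qed.

End Operators.

(** * Hilbert sums: coordinates, restrictions and relabelling *)

Section HilbertSums.
Context (R : realType) (I : choiceType) (H : hilbertType R).
Implicit Type x y : hsum I H.

Lemma hsum_ext x y : (forall i, x i = y i) -> x = y.
Proof. by move=> xy; apply/val_inj/funext. Qed.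

Lemma hsumD_coord x y i : (x + y) i = x i + y i. Proof. by []. Qed.
Lemma hsumB_coord x y i : (x - y) i = x i - y i. Proof. by []. Qed.
Lemma hsumZ_coord a x i : (a *: x) i = a *: x i. Proof. by []. Qed.

Lemma hsum_sum_coord (J : Type) (s : seq J) (P : pred J) (f : J -> hsum I H) i :
  (\sum_(j <- s | P j) f j) i = \sum_(j <- s | P j) f j i.
Proof. by apply: (big_morph (fun x : hsum I H => x i)). Qed.

Lemma hsum_injE (i : I) (h : H) (j : I) : hsum_inj H i h j = if j == i then h else 0.
Proof. by []. Qed.

Lemma sum_le_hnorm_sqr x (s : seq I) : uniq s ->
  \sum_(i <- s) hnorm (x i) ^+ 2 <= hnorm x ^+ 2.
Proof.
by move=> us; rewrite hsum_hnorm sum_le_psum// ?hsum_summable// => i; exact: sqr_ge0.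
Qed.

Lemma hnorm_sqr_le x (B : R) :
  (forall s : seq I, uniq s -> \sum_(i <- s) hnorm (x i) ^+ 2 <= B) ->
  hnorm x ^+ 2 <= B.
Proof.
move=> xB; rewrite hsum_hnorm -lee_fin -esum_psum.
- by apply: psum_le_esum => // i; exact: sqr_ge0.
- by move=> i; exact: sqr_ge0.
- exact: hsum_summable.
Qed.

Lemma hsum_bop (K : hilbertType R) (f : K -> I -> H) (C : R) : 0 <= C ->
  (forall i, linear (f^~ i)) ->
  (forall k (s : seq I), uniq s ->
     \sum_(i <- s) hnorm (f k i) ^+ 2 <= C ^+ 2 * hnorm k ^+ 2) ->
  exists g : bop K (hsum I H), (forall k i, g k i = f k i) /\
    (forall k, hnorm (g k) <= C * hnorm k).
Proof.
move=> C0 fl fC.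
have fS k : f k \in @square_summable R I H.
  apply/square_summableP/abs_summableE.
  under eq_esum do rewrite ger0_norm ?sqr_ge0//.
  apply: le_lt_trans (ltry (C ^+ 2 * hnorm k ^+ 2)).
  by apply: psum_le_esum => [i|]; [exact: sqr_ge0|exact: fC].
have gC k : hnorm (HSum (fS k)) <= C * hnorm k.
  rewrite -(@ler_pXn2r _ 2)// ?nnegrE ?mulr_ge0 ?hnorm_ge0// exprMn.
  by apply: hnorm_sqr_le => s; exact: fC.
have gl : linear (fun k => HSum (fS k)).
  by move=> a x y; apply: hsum_ext => i; rewrite /= fl.
have [|g gE] := linear_bounded_bop gl; first by exists C.
by exists g; split=> [k i|k]; rewrite gE.
Qed.

Lemma psum_single (i : I) (c : R) : 0 <= c ->
  psum (fun j => if j == i then c else 0) = c.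
Proof.
move=> c0; rewrite /psum (_ : \esum_(_ in _) _ = c%:E)//.
rewrite -[RHS](@esum_set1 R I i (fun=> c%:E)) ?lee_fin// [RHS]esum_mkcond.
apply: eq_esum => j _ /=; case: eqVneq => [->|ji]; first by rewrite mem_set.
by rewrite memNset// => /eqP; apply/negP.
Qed.

Lemma csum_single (i : I) (f : I -> R[i]) : (forall j, j != i -> f j = 0) ->
  csum f = f i.
Proof.
move=> f0; have rs (g : I -> R) : (forall j, j != i -> g j = 0) -> rsum g = g i.
  move=> g0; rewrite /rsum.
  have E (h : I -> R) : (forall j, j != i -> h j = 0) ->
      psum (fun j => Num.max (h j) 0) = Num.max (h i) 0.
    move=> h0; rewrite -[RHS](@psum_single i); last by rewrite le_max lexx orbT.
    by apply: eq_psum => j; case: eqVneq => [->//|/h0 ->]; rewrite maxxx.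
  rewrite !E//; last by move=> j /g0 ->; rewrite oppr0.
  case: (leP (g i) 0) => gi; first by rewrite max_l ?oppr_ge0// sub0r opprK.
  by rewrite max_r ?subr0 ?oppr_le0 ?ltW.
by rewrite /csum !rs; [case: (f i)|move=> j /f0 ->|move=> j /f0 ->].
Qed.

Lemma hdot_inj_r x i (h : H) : hdot x (hsum_inj H i h) = hdot (x i) h.
Proof.
rewrite -[LHS]/(csum _) (@csum_single i) ?hsum_injE ?eqxx// => j /negPf ji.
by rewrite [X in hdot _ X]hsum_injE ji hdot0r.
Qed.

Lemma adj_inj_coord (i : I) : adj (hsum_inj H i) = hsum_coord H i.
Proof. by apply: adj_unique => h x; rewrite hdotC hdot_inj_r -hdotC. Qed.

Lemma adj_coord (i : I) : adj (hsum_coord H i) = hsum_inj H i.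
Proof. by rewrite -adj_inj_coord adjK. Qed.

(** Passing to adjoints replaces density of the finite sums: f^* y is known from its coordinates,
    and these test f on single summands. *)
Lemma hsum_bop_ext (K : hilbertType R) (f g : bop (hsum I H) K) :
  (forall i h, f (hsum_inj H i h) = g (hsum_inj H i h)) -> f = g.
Proof.
move=> fg; apply: adj_inj; apply: bop_ext => y; apply: hsum_ext => i.
by apply: hdot_extr => h; rewrite hdotC [RHS]hdotC -!hdot_inj_r -!adjPr fg.
Qed.

Lemma hdot_disjoint x y : (forall i, x i = 0 \/ y i = 0) -> hdot x y = 0.
Proof.
move=> xy; rewrite -[LHS]/(csum _) (_ : (fun i => _) = (fun=> 0)).
  have p0 : psum (fun _ : I => 0 : R) = 0 by rewrite /psum esum1.
  by rewrite /csum /rsum /= oppr0 maxxx p0 subrr.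
by apply/funext => i; case: (xy i) => ->; rewrite ?hdot0l ?hdot0r.
Qed.

Lemma restr_exists (A : pred I) : exists g : bop (hsum I H) (hsum I H),
  forall x i, g x i = if A i then x i else 0.
Proof.
have [//|i a x y|x s us|g [gE _]] :=
  @hsum_bop _ (fun (x : hsum I H) i => if A i then x i else 0) 1.
- by case: ifP => // _; rewrite scaler0 addr0.
- rewrite expr1n mul1r; apply: le_trans (sum_le_hnorm_sqr x us).
  apply: ler_sum => i _; case: ifP => // _; rewrite hnorm0 expr0n sqr_ge0//.
by exists g.
Qed.

Definition restr (A : pred I) : bop (hsum I H) (hsum I H) :=
  projT1 (cid (restr_exists A)).

Lemma restrE A x i : restr A x i = if A i then x i else 0.
Proof. exact: (projT2 (cid (restr_exists A))). Qed.

Lemma restr_cvg (A : nat -> pred I) x :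
  (forall i, exists N, forall n, (N <= n)%N -> A n i) ->
  restr (A n) x @[n --> \oo] --> x.
Proof.
move=> Ai; apply/hcvgP => e e0; have e20 : 0 < e ^+ 2 by rewrite exprn_gt0.
(* A finite [s] carries all but [e ^+ 2] of the squared norm. Once [A n] contains [s], the discarded
   coordinates are disjoint from [s] and share what is left. *)
have [s us sx] : exists2 s : seq I, uniq s &
    hnorm x ^+ 2 - e ^+ 2 < \sum_(i <- s) hnorm (x i) ^+ 2.
  apply: contrapT => ns; suff : hnorm x ^+ 2 <= hnorm x ^+ 2 - e ^+ 2 by lra.
  by apply: hnorm_sqr_le => s us; rewrite leNgt; apply/negP => h; apply: ns; exists s.
have [N NP] : exists N, forall n, (N <= n)%N -> all (A n) s.
  elim: (s) => [|i s' [N NP]]; first by exists 0%N.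
  have [M MP] := Ai i; exists (maxn N M) => n; rewrite geq_max => /andP[Nn Mn] /=.
  by rewrite MP// NP.
exists N => // n /= /NP An.
rewrite -(@ltr_pXn2r _ 2)// ?nnegrE ?hnorm_ge0 ?(ltW e0)//.
apply: le_lt_trans (_ : hnorm x ^+ 2 - \sum_(i <- s) hnorm (x i) ^+ 2 < _); last by lra.
apply: hnorm_sqr_le => s' us'.
have -> : \sum_(i <- s') hnorm ((x - restr (A n) x) i) ^+ 2 =
    \sum_(i <- [seq i <- s' | ~~ A n i]) hnorm (x i) ^+ 2.
  rewrite big_filter [RHS]big_mkcond; apply: eq_bigr => i _.
  rewrite hsumB_coord restrE; case: ifP => _ /=; first by rewrite subrr hnorm0 expr0n.
  by rewrite subr0.
rewrite lerBrDr -big_cat /=; apply: sum_le_hnorm_sqr.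
rewrite cat_uniq filter_uniq// us andbT /=; apply/hasPn => i /(allP An) Ani.
by rewrite mem_filter Ani.
Qed.

End HilbertSums.

Section Pull.
Context (R : realType) (I J : choiceType) (H : hilbertType R) (f : J -> I).
Hypothesis finj : injective f.

Lemma pull_exists : exists g : bop (hsum I H) (hsum J H),
  forall x j, g x j = x (f j).
Proof.
have [//|//|x s us|g [gE _]] := @hsum_bop R J H _ (fun (x : hsum I H) j => x (f j)) 1.
  rewrite expr1n mul1r -(big_map f xpredT (fun i => hnorm (x i) ^+ 2)).
  by apply: sum_le_hnorm_sqr; rewrite map_inj_uniq.
by exists g.
Qed.

(** Introduced for its adjoint, which relabels basis vectors along [f]; for f u = u ++ w that is a
    right creation operator. *)
Definition pull : bop (hsum I H) (hsum J H) := projT1 (cid pull_exists).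

Lemma pullE x j : pull x j = x (f j).
Proof. exact: (projT2 (cid pull_exists)). Qed.

Lemma adj_pull_inj j h : adj pull (hsum_inj H j h) = hsum_inj H (f j) h.
Proof.
by apply: hdot_extr => x; rewrite -adjP !hdot_inj_r pullE.
Qed.

End Pull.

Section FiniteSums.
Context (R : realType) (I : finType) (H : hilbertType R).

Lemma hnorm_fin (x : hsum I H) : hnorm x ^+ 2 = \sum_i hnorm (x i) ^+ 2.
Proof.
apply: le_anti; apply/andP; split; last first.
  by rewrite -big_enum sum_le_hnorm_sqr ?enum_uniq.
apply: hnorm_sqr_le => s us.
rewrite [leRHS](bigID (mem s)) /= -[leLHS]addr0 lerD//; last first.
  by apply: sumr_ge0 => i _; exact: sqr_ge0.
by rewrite -big_uniq.
Qed.

Lemma hsum_of (u : I -> H) : exists x : hsum I H, forall i, x i = u i.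
Proof.
exists (\sum_i hsum_inj H i (u i)) => i.
rewrite hsum_sum_coord; under eq_bigr do rewrite hsum_injE.
by rewrite (bigD1 i)//= eqxx big1 ?addr0// => j; rewrite eq_sym => /negPf ->.
Qed.

End FiniteSums.

(** * Operator matrices and row operators through their adjoints *)

Section MatrixOperators.
Context (R : realType).

Lemma mx_opE (H : hilbertType R) m (X : 'M[bop H H]_m) x a :
  mx_op X x a = \sum_b X a b (x b).
Proof.
rewrite /mx_op bop_sum hsum_sum_coord.
under eq_bigr do rewrite bop_sum hsum_sum_coord.
rewrite exchange_big /=; apply: eq_bigr => b _.
by rewrite /hsum_single_fun (bigD1 a)//= eqxx big1 ?addr0// => c; rewrite eq_sym => /negPf ->.
Qed.

Lemma adj_mx_opE (H : hilbertType R) m (X : 'M[bop H H]_m) x b :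
  adj (mx_op X) x b = \sum_a adj (X a b) (x a).
Proof.
have -> : adj (mx_op X) = mx_op (\matrix_(b, a) adj (X a b)).
  rewrite /mx_op adj_sum exchange_big /=; apply: eq_bigr => a _.
  rewrite adj_sum; apply: eq_bigr => c _.
  rewrite !adj_comp adj_coord adj_inj_coord mxE.
  by apply: bop_ext.
by rewrite mx_opE; apply: eq_bigr => a _; rewrite mxE.
Qed.

Lemma adj_row_opE (H K : hilbertType R) k (X : 'I_k -> bop K H) h j :
  adj (row_op X) h j = adj (X j) h.
Proof.
rewrite /row_op adj_sum bop_sum hsum_sum_coord.
under eq_bigr do rewrite adj_comp adj_coord bcompE hsum_injE.
by rewrite (bigD1 j)//= eqxx big1 ?addr0// => i; rewrite eq_sym => /negPf ->.
Qed.

Lemma row_norm_adj (H K : hilbertType R) k (X : 'I_k -> bop K H) h :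
  \sum_j hnorm (adj (X j) h) ^+ 2 <= row_norm X ^+ 2 * hnorm h ^+ 2.
Proof.
rewrite -exprMn.
have -> : \sum_j hnorm (adj (X j) h) ^+ 2 = hnorm (adj (row_op X) h) ^+ 2.
  by rewrite hnorm_fin; apply: eq_bigr => j _; rewrite adj_row_opE.
rewrite ler_sqr ?nnegrE ?mulr_ge0 ?hnorm_ge0 ?opnorm_ge0//.
by rewrite /row_norm -opnorm_adj opnorm_le.
Qed.

Lemma row_norm_ge0 (H K : hilbertType R) k (X : 'I_k -> bop K H) : 0 <= row_norm X.
Proof. exact: opnorm_ge0. Qed.

Lemma row_norm_le (H K : hilbertType R) k (X : 'I_k -> bop K H) (B : R) : 0 <= B ->
  (forall h, \sum_j hnorm (adj (X j) h) ^+ 2 <= B ^+ 2 * hnorm h ^+ 2) -> row_norm X <= B.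
Proof.
move=> B0 XB; rewrite /row_norm -opnorm_adj; apply: opnorm_sqr_bound => // h.
by apply: le_trans (XB h); rewrite hnorm_fin ler_sum// => j _; rewrite adj_row_opE.
Qed.

End MatrixOperators.

Lemma cvg_sum (K : numFieldType) (V : normedModType K) (T : Type) (F : set_system T)
    {FF : Filter F} (I : Type) (s : seq I) (P : pred I) (f : I -> T -> V) (l : I -> V) :
  (forall i, P i -> f i t @[t --> F] --> l i) ->
  \sum_(i <- s | P i) f i t @[t --> F] --> \sum_(i <- s | P i) l i.
Proof.
move=> fl; elim: s => [|i s IHs].
  by rewrite big_nil; under eq_fun do rewrite big_nil; exact: cvg_cst.
rewrite big_cons; under eq_fun do rewrite big_cons.
by case: ifP => // Pi; apply: cvgD => //; exact: fl.
Qed.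

(** * Sums over words *)

Section WordSums.
Context (I : finType) (V : nmodType).

Lemma sum_tuple0 (G : seq I -> V) : \sum_(w : 0.-tuple I) G w = G [::].
Proof.
rewrite (bigD1 [tuple])//= big1 ?addr0// => w.
by move=> /negP[]; apply/eqP; exact: tuple0.
Qed.

Lemma sum_tupleS q (G : seq I -> V) :
  \sum_(w : q.+1.-tuple I) G w = \sum_i \sum_(w : q.-tuple I) G (i :: w).
Proof.
rewrite pair_big /=.
rewrite (reindex (fun p : I * q.-tuple I => [tuple of p.1 :: p.2])) //=.
exists (fun w => (thead w, [tuple of behead w])) => [[i w] _|w _] /=.
  by congr (_, _); apply/val_inj.
by rewrite [RHS]tuple_eta; apply/val_inj.
Qed.

Lemma sum_tupleD p q (G : seq I -> V) :
  \sum_(w : (p + q).-tuple I) G w =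
  \sum_(v : p.-tuple I) \sum_(w : q.-tuple I) G (v ++ w).
Proof.
elim: p G => [|p IHp] G.
  by rewrite (sum_tuple0 (fun v => \sum_(w : q.-tuple I) G (v ++ w))).
rewrite sum_tupleS [RHS](sum_tupleS _ (fun v => \sum_(w : q.-tuple I) G (v ++ w))).
by apply: eq_bigr => i _; exact: (IHp (fun w => G (i :: w))).
Qed.

(** A list without repetitions, because norms in a Hilbert sum are bounded through sums over such
    lists. *)
Fixpoint words_lt (N : nat) : seq (seq I) :=
  if N is N'.+1 then words_lt N' ++ [seq tval w | w <- enum {: N'.-tuple I}] else [::].

Lemma mem_words_lt N w : (w \in words_lt N) = (size w < N)%N.
Proof.
elim: N => [//|N IHN] /=; rewrite mem_cat IHN [RHS]ltnS [RHS]leq_eqVlt orbC.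
congr (_ || _); apply/mapP/eqP => [[v _ ->]|<-]; first by rewrite size_tuple.
by exists (in_tuple w); rewrite ?mem_enum.
Qed.

Lemma words_lt_uniq N : uniq (words_lt N).
Proof.
elim: N => [//|N IHN] /=; rewrite cat_uniq IHN map_inj_uniq ?enum_uniq ?andbT.
  by apply/hasPn => _ /mapP[v _ ->]; rewrite mem_words_lt size_tuple ltnn.
exact: val_inj.
Qed.

Lemma sum_words_lt N (G : seq I -> V) :
  \sum_(w <- words_lt N) G w = \sum_(k < N) \sum_(w : k.-tuple I) G w.
Proof.
elim: N => [|N IHN] /=; first by rewrite big_nil big_ord0.
by rewrite big_cat big_ord_recr /= IHN big_map big_enum.
Qed.

End WordSums.

Lemma sum_uniq_le (R : numDomainType) (I : eqType) (s t : seq I) (G : I -> R) :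
  uniq s -> uniq t -> {subset s <= t} -> (forall i, 0 <= G i) ->
  \sum_(i <- s) G i <= \sum_(i <- t) G i.
Proof.
move=> us ut st G0; rewrite [leRHS](bigID (mem s)) /=.
rewrite -[X in _ <= X + _]big_filter.
have ts : perm_eq [seq i <- t | i \in s] s.
  apply: uniq_perm => [||i]; rewrite ?filter_uniq// mem_filter.
  by apply/andP/idP => [[]//|si]; split=> //; exact: st.
by rewrite [X in _ <= X + _](perm_big s ts) lerDl sumr_ge0.
Qed.

(** The bound is on all j jointly and does not split into bounds for the single x_j. So the squared
    norms are first merged into one summable family over I. *)
Lemma sum_hnorm_sqr_le (R : realType) (I : choiceType) (H : hilbertType R)
    (J : Type) (xs : seq J) (x : J -> hsum I H) (B : R) :
  (forall s : seq I, uniq s -> \sum_(j <- xs) \sum_(i <- s) hnorm (x j i) ^+ 2 <= B) ->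
  \sum_(j <- xs) hnorm (x j) ^+ 2 <= B.
Proof.
move=> xB.
have [E S] : \sum_(j <- xs) hnorm (x j) ^+ 2 = psum (fun i => \sum_(j <- xs) hnorm (x j i) ^+ 2)
    /\ abs_summable (fun i => \sum_(j <- xs) hnorm (x j i) ^+ 2).
  elim: xs {xB} => [|j xs [E S]].
    rewrite big_nil; split; last by apply/abs_summableE; rewrite esum1// => i _; rewrite
      big_nil normr0.
    by rewrite /psum esum1// => i _; rewrite big_nil.
  have -> : (fun i => \sum_(k <- j :: xs) hnorm (x k i) ^+ 2) =
      (fun i => hnorm (x j i) ^+ 2 + \sum_(k <- xs) hnorm (x k i) ^+ 2).
    by apply/funext => i; rewrite big_cons.
  split; last by apply: abs_summableD => //; exact: hsum_summable.
  rewrite big_cons E hsum_hnorm psumD//.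
  - by move=> i; exact: sqr_ge0.
  - by move=> i; apply: sumr_ge0 => k _; exact: sqr_ge0.
  - exact: hsum_summable.
rewrite E -lee_fin -esum_psum//; last by move=> i; apply: sumr_ge0 => k _; exact: sqr_ge0.
apply: psum_le_esum => [i|s us]; first by apply: sumr_ge0 => k _; exact: sqr_ge0.
by rewrite exchange_big xB.
Qed.

(** * Words in a row contraction and the defect form *)

Section WordOperators.
Context (R : realType) (H : hilbertType R) (n : nat) (T : 'I_n -> bop H H).

Lemma word_op_cons i w : word_op T (i :: w) = T i \ob word_op T w.
Proof. by []. Qed.

Lemma word_op_cat v w : word_op T (v ++ w) = word_op T v \ob word_op T w.
Proof. by elim: v => [|i v IHv]; apply: bop_ext => x //=; rewrite IHv. Qed.

Lemma adj_word_op_cons i w h :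
  adj (word_op T (i :: w)) h = adj (word_op T w) (adj (T i) h).
Proof. by rewrite word_op_cons adj_comp. Qed.

Lemma adj_word_op_nil h : adj (word_op T [::]) h = h.
Proof. by rewrite /= adj_id. Qed.

Lemma adj_word_op_cat v w h :
  adj (word_op T (v ++ w)) h = adj (word_op T w) (adj (word_op T v) h).
Proof. by rewrite word_op_cat adj_comp. Qed.

Lemma row_contraction_le h : row_contraction T ->
  \sum_i hnorm (adj (T i) h) ^+ 2 <= hnorm h ^+ 2.
Proof.
move=> /(_ h); rewrite bop_sum hdot_suml hdot_hnorm.
rewrite (_ : \sum_i _ = (\sum_i hnorm (adj (T i) h) ^+ 2)%:C) ?lecR//.
rewrite rmorph_sum; apply: eq_bigr => i _.
by rewrite bcompE adjP hdot_hnorm.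
Qed.

Definition defect (h : H) : H := h - \sum_i T i (adj (T i) h).

Lemma hdot_defect u v :
  hdot u (defect v) = hdot u v - \sum_i hdot (adj (T i) u) (adj (T i) v).
Proof.
rewrite hdotDr hdotNr hdot_sumr; congr (_ - _).
by apply: eq_bigr => i _; rewrite adjPr.
Qed.

Lemma qform_defect h :
  qform defect h = hnorm h ^+ 2 - \sum_i hnorm (adj (T i) h) ^+ 2.
Proof.
rewrite /qform hdot_defect ReD ReN hdot_hnorm Re_sum; congr (_ - _).
by apply: eq_bigr => i _; rewrite hdot_hnorm.
Qed.

Hypothesis T_contr : row_contraction T.

Lemma defect_positive : positive_form defect.
Proof.
split=> [u v|u]; last by rewrite -/(qform _ _) qform_defect subr_ge0 row_contraction_le.
rewrite !hdot_defect rmorphB rmorph_sum /= -hdotC; congr (_ - _).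
by apply: eq_bigr => i _; rewrite -hdotC.
Qed.

(** Telescoping: the defect form at T_w^* h is |T_w^* h|^2 minus the sum over i of |T_(wi)^* h|^2.
    The new letter goes to the right end, since T_(wi)^* = T_i^* T_w^*. *)
Lemma sum_defect N h :
  \sum_(w <- words_lt 'I_n N) qform defect (adj (word_op T w) h) =
  hnorm h ^+ 2 - \sum_(w : N.-tuple 'I_n) hnorm (adj (word_op T w) h) ^+ 2.
Proof.
rewrite sum_words_lt; elim: N => [|N IHN].
  rewrite big_ord0 (sum_tuple0 (fun w => hnorm (adj (word_op T w) h) ^+ 2)).
  by rewrite adj_word_op_nil subrr.
rewrite big_ord_recr /= IHN.
under [X in _ + X]eq_bigr do rewrite qform_defect.
rewrite sumrB addrA subrK; congr (_ - _).
rewrite -[N.+1]addn1 (sum_tupleD _ _ (fun w => hnorm (adj (word_op T w) h) ^+ 2)).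
apply: eq_bigr => v _.
rewrite (sum_tupleS _ (fun w => hnorm (adj (word_op T (v ++ w)) h) ^+ 2)).
apply: eq_bigr => i _.
rewrite (sum_tuple0 (fun w => hnorm (adj (word_op T (v ++ i :: w)) h) ^+ 2)).
by rewrite adj_word_op_cat adj_word_op_cons adj_word_op_nil.
Qed.

Lemma sum_defect_le (s : seq (seq 'I_n)) h : uniq s ->
  \sum_(w <- s) qform defect (adj (word_op T w) h) <= hnorm h ^+ 2.
Proof.
move=> us; pose N := (\max_(w <- s) size w).+1.
apply: le_trans (_ : _ <= \sum_(w <- words_lt 'I_n N) qform defect (adj (word_op T w) h)) _.
  apply: (sum_uniq_le us (words_lt_uniq _ N)) => [w ws|w].
    by rewrite mem_words_lt ltnS; apply: leq_bigmax_seq.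
  exact: defect_positive.2.
rewrite sum_defect gerBl sumr_ge0// => w _; exact: sqr_ge0.
Qed.

Lemma sum_word_le N h :
  \sum_(w : N.-tuple 'I_n) hnorm (adj (word_op T w) h) ^+ 2 <= hnorm h ^+ 2.
Proof.
rewrite -subr_ge0 -sum_defect; apply: sumr_ge0 => w _; exact: defect_positive.2.
Qed.

End WordOperators.

(** * Scalar components of the Poisson kernel *)

Section Poisson.
Context (R : realType) (H : hilbertType R) (n : nat) (T : 'I_n -> bop H H).
Local Notation F2 := (fock R n).

(* A scalar component h |-> \sum_alpha <T_alpha^* h, z> e_alpha of the Poisson
   kernel of T. *)
Definition poisson (z : H) (K : bop H F2) :=
  forall h w, K h w = hdot (adj (word_op T w) h) z.

(** By Douglas' criterion this says that z is in the range of the square root of the defect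
    operator, without having to construct that root. *)
Definition admissible (z : H) :=
  exists2 c : R, 0 <= c & forall x, complex.Re `|hdot x z| ^+ 2 <= c ^+ 2 * qform (defect T) x.

Lemma hnorm_complex_line (c : R[i]) : hnorm (c : complex_line R) = complex.Re `|c|.
Proof. by []. Qed.

Hypothesis T_contr : row_contraction T.

Lemma poisson_exists z : admissible z -> exists K, poisson z K.
Proof.
move=> [c c0 zc].
have [//|w a x y|h s us|K [KE _]] := @hsum_bop R (seq 'I_n) (complex_line R) H
  (fun h w => hdot (adj (word_op T w) h) z) c.
- by rewrite linearP hdotP.
- apply: le_trans (_ : c ^+ 2 * \sum_(w <- s) qform (defect T) (adj (word_op T w) h) <= _).
    by rewrite mulr_sumr; apply: ler_sum => w _; exact: zc.
  by rewrite ler_wpM2l ?sqr_ge0// sum_defect_le.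
- by exists K.
Qed.

Definition pure := forall h,
  \sum_(w : N.-tuple 'I_n) hnorm (adj (word_op T w) h) ^+ 2 @[N --> \oo] --> (0 : R).

(** Summed over a diagonalising family, |K y|^2 dominates the truncated defect sum of y, which tends
    to |y|^2 by purity, while |K x|^2 adds up to at most |x|^2. *)
Lemma poisson_domination (I J : finType) (x : I -> H) (y : J -> H) (C : R) :
  pure -> 0 <= C ->
  (forall z K, poisson z K ->
     \sum_j hnorm (K (y j)) ^+ 2 <= C * \sum_i hnorm (K (x i)) ^+ 2) ->
  \sum_j hnorm (y j) ^+ 2 <= C * \sum_i hnorm (x i) ^+ 2.
Proof.
move=> Tp C0 yx.
have PA := defect_positive T_contr.
have lim : \sum_j (hnorm (y j) ^+ 2 - \sum_(w : N.-tuple 'I_n) hnorm (adj (word_op T w) (y j))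
  ^+ 2)
    @[N --> \oo] --> \sum_j (hnorm (y j) ^+ 2 - 0).
  apply: cvg_sum => j _; apply: cvgB; [exact: cvg_cst|exact: Tp].
under eq_bigr do rewrite -[hnorm _ ^+ 2]subr0.
apply: (cvg_le_bound lim); near=> N.
under eq_bigr do rewrite -sum_defect//.
(* The diagonalisation is exact at the vectors T_w^* y_j of the list. At the T_w^* x_i it is only an
   inequality, in the direction that the right side needs. *)
have [zs [zs1 zs2]] := positive_form_diagonalize
  [seq adj (word_op T w) (y j) | j <- enum J, w <- words_lt 'I_n N] PA.
have /choice[K KP] : forall z : H, exists K, z \in zs -> poisson z K.
  move=> z; have [zz|zz] := boolP (z \in zs); last by exists 0.
  have [|K KP] := @poisson_exists z; last by exists K.
  (* Each z is one term of a sum bounded by the defect form, hence admissible with constant 1. *)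
  exists 1; rewrite ?ler01// => u; rewrite expr1n mul1r; apply: le_trans (zs2 u).
  by rewrite (big_rem z)//= lerDl sumr_ge0// => v _; exact: sqr_ge0.
apply: (@le_trans _ _ (\sum_(z <- zs) \sum_j hnorm (K z (y j)) ^+ 2)).
  rewrite [leRHS]exchange_big /=; apply: ler_sum => j _.
  apply: (@le_trans _ _ (\sum_(z <- zs) \sum_(w <- words_lt 'I_n N) hnorm (K z (y j) w) ^+ 2)).
    rewrite [leRHS]exchange_big /= [leLHS]big_seq [leRHS]big_seq.
    apply: ler_sum => w wN; rewrite zs1; last first.
      by apply/allpairsP; exists (j, w); rewrite mem_enum.
    rewrite [leLHS]big_seq [leRHS]big_seq; apply: ler_sum => z zz.
    by rewrite (KP z zz) hnorm_complex_line.
  by apply: ler_sum => z _; rewrite sum_le_hnorm_sqr// words_lt_uniq.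
apply: (@le_trans _ _ (\sum_(z <- zs) C * \sum_i hnorm (K z (x i)) ^+ 2)).
  rewrite big_seq [leRHS]big_seq; apply: ler_sum => z zz; exact: yx (KP z zz).
rewrite -mulr_sumr ler_wpM2l// exchange_big /=; apply: ler_sum => i _.
apply: sum_hnorm_sqr_le => s us; rewrite exchange_big /=.
apply: le_trans (sum_defect_le T_contr (x i) us); apply: ler_sum => w _.
apply: le_trans (zs2 _); rewrite big_seq [leRHS]big_seq; apply: ler_sum => z zz.
by rewrite (KP z zz).
Unshelve. all: by end_near. Qed.

End Poisson.

(** * The full Fock space and its Toeplitz operators *)

Section FockSpace.
Context (R : realType) (n : nat).
Local Notation F2 := (fock R n).
Local Notation e w := (fock_basis R w).
Local Notation S := (@creation R n).
Implicit Types (x y v : F2) (w u : seq 'I_n).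

Lemma hdot_basis x w : hdot x (e w) = x w.
Proof. by rewrite /fock_basis hdot_inj_r -[LHS]/(x w * 1^*) conjC1 mulr1. Qed.

Lemma basisE w u : e w u = if u == w then 1 else 0.
Proof. by []. Qed.

Lemma fock_bop_ext (K : hilbertType R) (f g : bop F2 K) :
  (forall w, f (e w) = g (e w)) -> f = g.
Proof.
move=> fg; apply: hsum_bop_ext => w c.
have -> : hsum_inj (complex_line R) w c = (c : R[i]) *: e w.
  rewrite /fock_basis -linearZ /=; congr (hsum_inj _ _ _).
  by rewrite -[RHS]/(c * 1) mulr1.
by rewrite !linearZ /= fg.
Qed.

Lemma creation_basis i w : S i (e w) = e (i :: w).
Proof.
apply: hsum_ext => -[|j u] /=; rewrite /hsum_single_fun //.
rewrite eqseq_cons; case: eqP => // _.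
Qed.

Lemma adj_creationE i x w : adj (S i) x w = x (i :: w).
Proof. by rewrite -hdot_basis -adjPr creation_basis hdot_basis. Qed.

Lemma adj_word_creationE u x w : adj (word_op S u) x w = x (u ++ w).
Proof.
elim: u x => [|i u IHu] x; first by rewrite adj_word_op_nil.
by rewrite adj_word_op_cons IHu adj_creationE.
Qed.

Lemma word_creation_proj u x w :
  word_op S u (adj (word_op S u) x) w = if take (size u) w == u then x w else 0.
Proof.
rewrite -hdot_basis adjP.
have [wu|wu] := eqVneq (take (size u) w) u.
  have wE : w = u ++ drop (size u) w by rewrite -{1}wu cat_take_drop.
  have -> : adj (word_op S u) (e w) = e (drop (size u) w).
    apply: hsum_ext => v; rewrite adj_word_creationE !basisE {1}wE.
    by rewrite eqseq_cat// eqxx.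
  by rewrite hdot_basis adj_word_creationE -wE.
have -> : adj (word_op S u) (e w) = 0; last by rewrite hdot0r.
apply: hsum_ext => v; rewrite adj_word_creationE basisE.
case: eqP => // uvw; move: wu; rewrite -uvw take_size_cat// eqxx.
by [].
Qed.

(** The S_u S_u^* with |u| = q project onto the words beginning with u. These sets are disjoint and
    together make up all words of length at least q. *)
Lemma hnorm_restr_size q x :
  hnorm (restr (complex_line R) (fun w : seq 'I_n => (q <= size w)%N) x) ^+ 2 =
  \sum_(u : q.-tuple 'I_n) hnorm (adj (word_op S u) x) ^+ 2.
Proof.
set y := restr _ _ x.
have yE : y = \sum_(u : q.-tuple 'I_n) word_op S u (adj (word_op S u) x).
  apply: hsum_ext => w; rewrite hsum_sum_coord restrE.
  under eq_bigr do rewrite word_creation_proj size_tuple.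
  case: ifPn => qw.
    have tw : size (take q w) == q by rewrite size_takel.
    rewrite (bigD1 (Tuple tw))//= eqxx big1 ?addr0// => u.
    by rewrite -val_eqE /= eq_sym => /negPf ->.
  rewrite big1// => u _; case: eqP => // wu; move: qw; rewrite -ltnNge => qw.
  by have := size_tuple u; rewrite -wu take_oversize ?(ltnW qw)// => qw'; rewrite qw' ltnn in qw.
have : hdot y y = hdot y x.
  have xy : hdot y (x - y) = 0.
    apply: hdot_disjoint => w; rewrite hsumB_coord /y restrE; case: ifP => _; last by left.
    by right; rewrite subrr.
  have xE : x = (x - y) + y by rewrite subrK.
  by rewrite [X in _ = hdot _ X]xE hdotDr xy add0r.
rewrite [hdot y y]hdot_hnorm {2}yE hdot_suml => /(congr1 (@complex.Re R)) /= ->.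
rewrite Re_sum; apply: eq_bigr => u _.
by rewrite adjP hdot_hnorm.
Qed.

Lemma cat_right_inj w : injective (fun u : seq 'I_n => u ++ w).
Proof. move=> u v /= /(congr1 rev); rewrite !rev_cat => /eqP.
by rewrite eqseq_cat// eqxx => /eqP/(can_inj revK). Qed.

(** Right creation by e_w; it commutes with every left creation operator. *)
Definition rmul w : bop F2 F2 := adj (pull (complex_line R) (@cat_right_inj w)).

Lemma rmul_basis w u : rmul w (e u) = e (u ++ w).
Proof. exact: adj_pull_inj. Qed.

Lemma adj_rmulE w x u : adj (rmul w) x u = x (u ++ w).
Proof. by rewrite adjK pullE. Qed.

(** The Toeplitz algebra is given as a smallest set, so its elements are reached by induction over
    WOT-closed subalgebras. Equalities between matrix coefficients are the WOT-closed conditions in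
    which the needed properties are phrased. *)
Lemma wot_closed_eq (H : hilbertType R) (I : Type) (x1 y1 x2 y2 : I -> H) :
  wot_closed [set f : bop H H | forall t, hdot (f (x1 t)) (y1 t) = hdot (f (x2 t)) (y2 t)].
Proof.
move=> f fP t; apply/eqP; rewrite -subr_eq0; apply/eqP/Re_norm_eq0/le_anti.
rewrite Re_normc_ge0 andbT; apply/ler_addgt0Pr => d d0; rewrite add0r.
have [|g gP gf] := fP [:: (x1 t, y1 t); (x2 t, y2 t)] (d / 2); first by rewrite divr_gt0.
have h1 := gf (x1 t, y1 t) (mem_head _ _).
have h2 := gf (x2 t, y2 t); rewrite inE mem_head orbT in h2; have {}h2 := h2 isT.
rewrite -Re_normcE ltcR bopB hdotDl hdotNl /= in h1.
rewrite -Re_normcE ltcR bopB hdotDl hdotNl /= in h2.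
have -> : hdot (f (x1 t)) (y1 t) - hdot (f (x2 t)) (y2 t) =
  (hdot (f (x1 t)) (y1 t) - hdot (g (x1 t)) (y1 t)) +
  - (hdot (f (x2 t)) (y2 t) - hdot (g (x2 t)) (y2 t)).
  by rewrite (gP t); ring.
apply: le_trans (Re_normD _ _) _; rewrite normrN [d]splitr.
by rewrite lerD// ltW.
Qed.

Lemma toeplitz_ind (A : set (bop F2 F2)) : subalgebra A -> wot_closed A ->
  A (bid F2) -> (forall i, A (S i)) -> forall f, toeplitz_algebra f -> A f.
Proof.
move=> As Aw A1 AS f fT; apply: fT; split=> //.
by move=> _ [[i _ <-]|->].
Qed.

Lemma toeplitz_subalgebra : subalgebra (@toeplitz_algebra R n).
Proof.
move=> c f g fT gT; split=> A [[As Aw] AG].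
  by apply: (As c f g _ _).1; [apply: fT|apply: gT].
by apply: (As c f g _ _).2; [apply: fT|apply: gT].
Qed.

Lemma toeplitz_id : toeplitz_algebra (bid F2).
Proof. by move=> A [_]; apply; right. Qed.

Lemma toeplitz_creation i : toeplitz_algebra (S i).
Proof. by move=> A [_]; apply; left; exists i. Qed.

(** Left and right creations commute. To pass to the WOT closure, commutation is written <f R_w u,
    v> = <f u, R_w^* v> with R_w = [rmul w]. *)
Lemma toeplitz_rmul f w x : toeplitz_algebra f -> f (rmul w x) = rmul w (f x).
Proof.
move=> fT; apply: hdot_ext => y; rewrite [X in _ = complex.Re X]adjP; congr (complex.Re _).
have := @toeplitz_ind _ _ (@wot_closed_eq _ (F2 * F2) (fun p => rmul w p.1) snd fst
  (fun p => adj (rmul w) p.2)) _ _ f fT (x, y).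
apply=> [c g h gP hP|[u v]|i]; last 2 first.
- exact: (adjP (rmul w) u v).
- move=> [u v]; change (hdot (S i (rmul w u)) v = hdot (S i u) (adj (rmul w) v)).
  have E : S i \ob rmul w = rmul w \ob S i :> bop F2 F2.
    by apply: fock_bop_ext => z; rewrite !bcompE creation_basis !rmul_basis creation_basis.
  by rewrite -[RHS]adjP -!bcompE E.
-
  split=> -[u v].
    change (hdot ((c *: g + h) (rmul w u)) v = hdot ((c *: g + h) u) (adj (rmul w) v)).
    by rewrite !bopD !bopZ !hdotDl !hdotZl (gP (u, v)) (hP (u, v)).
  change (hdot ((g \ob h) (rmul w u)) v = hdot ((g \ob h) u) (adj (rmul w) v)).
  rewrite !bcompE (_ : h (rmul w u) = rmul w (h u)); first exact: (gP (h u, v)).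
  by apply: hdot_ext => z; congr (complex.Re _); rewrite [RHS]adjP; exact: (hP (u, z)).
Qed.

(** Consequently the Fourier series f 1 determines f. *)
Lemma toeplitz_basis f w : toeplitz_algebra f -> f (e w) = rmul w (f (vacuum R n)).
Proof. by move=> fT; rewrite -toeplitz_rmul// /vacuum rmul_basis. Qed.

(* If f 1 has no constant term then f raises degrees, so f^* lowers them. *)
Lemma adj_toeplitz_support f p x : toeplitz_algebra f -> f (vacuum R n) [::] = 0 ->
  (forall w, (p < size w)%N -> x w = 0) -> forall w, (p <= size w)%N -> adj f x w = 0.
Proof.
move=> fT f0 xp w pw; rewrite -hdot_basis -adjPr toeplitz_basis// adjPr.
apply: hdot_disjoint => -[|i u]; first by right.
by left; rewrite adj_rmulE xp// size_cat addSn ltnS (leq_trans pw)// leq_addl.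
Qed.

End FockSpace.

Lemma bop_sum_arg (R : realType) (H K : hilbertType R) (f : bop H K) (I : Type)
    (s : seq I) (P : pred I) (x : I -> H) :
  f (\sum_(i <- s | P i) x i) = \sum_(i <- s | P i) f (x i).
Proof. exact: linear_sum. Qed.

(** * Intertwining through the Poisson kernel *)

Section PoissonIntertwining.
Context (R : realType) (H : hilbertType R) (n : nat) (T : 'I_n -> bop H H).
Local Notation F2 := (fock R n).

Lemma poisson_adj_word z K w h : poisson T z K ->
  K (adj (word_op T w) h) = adj (word_op (@creation R n) w) (K h).
Proof.
move=> KP; apply: hsum_ext => u.
by rewrite adj_word_creationE !KP adj_word_op_cat.
Qed.

Lemma poisson_adj_basis z K w : poisson T z K ->
  adj K (fock_basis R w) = word_op T w z.
Proof.
by move=> KP; apply: hdot_extr => h; rewrite -adjP hdot_basis KP adjPr.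
Qed.

Definition intertwines (f : bop F2 F2) (X : bop H H) :=
  forall z K, poisson T z K -> forall h, K (adj X h) = adj f (K h).

End PoissonIntertwining.

(** * Words in the F_j acting on the Fock space *)

Section WordBound.
Context (R : realType) (n k m : nat).
Local Notation F2 := (fock R n).
Variables (F : 'I_k -> 'M[bop F2 F2]_m) (E : set F2) (C : R).
Let Fop j := mx_op (F j).
Hypothesis FT : forall j a b, toeplitz_algebra (F j a b).
Hypothesis F0 : forall j a b, F j a b (vacuum R n) [::] = 0.
Hypothesis ET : forall f x, toeplitz_algebra f -> E x -> E (adj f x).
Hypothesis E0 : E 0.
Hypothesis ED : forall x y, E x -> E y -> E (x + y).
Hypothesis Er : forall q x, E x ->
  E (restr (complex_line R) (fun w : seq 'I_n => (q <= size w)%N) x).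
Hypothesis FC : forall x : hsum 'I_m F2, (forall a, E (x a)) ->
  \sum_j hnorm (adj (Fop j) x) ^+ 2 <= C ^+ 2 * hnorm x ^+ 2.

(** E is stable under the adjoints, so the row bound on E applies again at each letter. *)
Let Fword_le q (x : hsum 'I_m F2) : (forall a, E (x a)) ->
  \sum_(w : q.-tuple 'I_k) hnorm (adj (word_op Fop w) x) ^+ 2
    <= (C ^+ 2) ^+ q * hnorm x ^+ 2.
Proof.
elim: q x => [|q IHq] x Ex.
  rewrite (sum_tuple0 (fun w => hnorm (adj (word_op Fop w) x) ^+ 2)).
  by rewrite adj_word_op_nil mul1r.
rewrite (sum_tupleS _ (fun w => hnorm (adj (word_op Fop w) x) ^+ 2)).
under eq_bigr do under eq_bigr do rewrite adj_word_op_cons.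
apply: (@le_trans _ _ (\sum_j (C ^+ 2) ^+ q * hnorm (adj (Fop j) x) ^+ 2)).
  apply: ler_sum => j _; apply: IHq => b; rewrite adj_mx_opE.
  by apply: (big_ind E) => // a _; exact: ET.
rewrite -mulr_sumr (exprSr (C ^+ 2)) -mulrA; apply: ler_wpM2l; last exact: FC.
by rewrite exprn_ge0// sqr_ge0.
Qed.

(** Each letter lowers the bound on the degrees by one, and after q letters nothing is left. *)
Let Fword_support q (w : seq 'I_k) (x : hsum 'I_m F2) : size w = q ->
  (forall a u, (q <= size u)%N -> x a u = 0) -> adj (word_op Fop w) x = 0.
Proof.
elim: q w x => [|q IHq] [|j w]//.
  by move=> x _ x0; rewrite adj_word_op_nil; apply: hsum_ext => a; apply: hsum_ext => u; exact:
    x0.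
move=> x [wq] xq; rewrite adj_word_op_cons IHq// => b u qu.
rewrite adj_mx_opE hsum_sum_coord big1// => a _.
by apply: (@adj_toeplitz_support _ _ _ q) => // v; exact: xq.
Qed.

Lemma toeplitz_word_le q (x : hsum 'I_m F2) : (forall a, E (x a)) ->
  \sum_(w : q.-tuple 'I_k) hnorm (adj (word_op Fop w) x) ^+ 2
    <= (C ^+ 2) ^+ q *
       \sum_a \sum_(u : q.-tuple 'I_n) hnorm (adj (word_op (@creation R n) u) (x a)) ^+ 2.
Proof.
(* The iterated bound alone would give C^(2q) |x|^2. Truncating x beforehand, which leaves the left
   side unchanged, is what later yields the factor omega(T). *)
move=> Ex; pose rq := restr (complex_line R) (fun w : seq 'I_n => (q <= size w)%N).
have [x1 x1E] := hsum_of (fun a => rq (x a)).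
have x1w (w : q.-tuple 'I_k) : adj (word_op Fop w) x = adj (word_op Fop w) x1.
  apply/eqP; rewrite -subr_eq0 -linearB; apply/eqP.
  apply: (@Fword_support q); first exact: size_tuple.
  move=> a u qu; rewrite (_ : (x - x1) a u = x a u - x1 a u)//.
  by rewrite x1E restrE qu subrr.
under eq_bigr do rewrite x1w.
have Ex1 a : E (x1 a) by rewrite x1E; exact: Er.
apply: le_trans (Fword_le q Ex1) _.
rewrite hnorm_fin; under eq_bigr do rewrite x1E hnorm_restr_size.
by [].
Qed.

End WordBound.

(** * Transport of the word estimate to a pure row contraction *)

Section VonNeumann.
Context (R : realType) (H : hilbertType R) (n k m : nat) (T : 'I_n -> bop H H).
Local Notation F2 := (fock R n).

(** All q with one constant: both choices of omega can be read off, and the statement is stable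
    under strong limits. *)
Definition word_bound (X : 'I_k -> bop (hsum 'I_m H) (hsum 'I_m H)) (C : R) :=
  forall q (h : hsum 'I_m H),
    \sum_(w : q.-tuple 'I_k) hnorm (adj (word_op X w) h) ^+ 2
      <= (C ^+ 2) ^+ q *
         \sum_a \sum_(u : q.-tuple 'I_n) hnorm (adj (word_op T u) (h a)) ^+ 2.

Variables (F : 'I_k -> 'M[bop F2 F2]_m) (X : 'I_k -> 'M[bop H H]_m).
Variables (E : set F2) (C : R).
Hypothesis T_contr : row_contraction T.
Hypothesis T_pure : pure T.
Hypothesis FT : forall j a b, toeplitz_algebra (F j a b).
Hypothesis F0 : forall j a b, F j a b (vacuum R n) [::] = 0.
Hypothesis FX : forall j a b, intertwines T (F j a b) (X j a b).
Hypothesis ET : forall f x, toeplitz_algebra f -> E x -> E (adj f x).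
Hypothesis E0 : E 0.
Hypothesis ED : forall x y, E x -> E y -> E (x + y).
Hypothesis Er : forall q x, E x ->
  E (restr (complex_line R) (fun w : seq 'I_n => (q <= size w)%N) x).
Hypothesis EK : forall z K h, poisson T z K -> E (K h).
Hypothesis FC : forall x : hsum 'I_m F2, (forall a, E (x a)) ->
  \sum_j hnorm (adj (mx_op (F j)) x) ^+ 2 <= C ^+ 2 * hnorm x ^+ 2.

Let intertwines_word z K w (h : hsum 'I_m H) (x : hsum 'I_m F2) : poisson T z K ->
  (forall a, x a = K (h a)) -> forall b,
  adj (word_op (fun j => mx_op (F j)) w) x b = K (adj (word_op (fun j => mx_op (X j)) w) h b).
Proof.
move=> KP; elim: w h x => [|j w IHw] h x xh b; first by rewrite !adj_word_op_nil.
rewrite [in LHS]adj_word_op_cons [in RHS]adj_word_op_cons; apply: IHw => a.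
rewrite [LHS]adj_mx_opE [X in K X]adj_mx_opE bop_sum_arg.
by apply: eq_bigr => c _; rewrite xh; apply/esym; exact: (FX _ _ _ KP).
Qed.

Lemma pure_word_bound : word_bound (fun j => mx_op (X j)) C.
Proof.
move=> q h; under eq_bigr do rewrite hnorm_fin.
rewrite !pair_big /=.
(* Both sides are flattened into finite families of vectors of H, indexed by a coordinate and a
   word. *)
apply: (@poisson_domination _ _ _ T T_contr ('I_m * q.-tuple 'I_n)%type (q.-tuple 'I_k *
  'I_m)%type
  (fun p => adj (word_op T p.2) (h p.1))
  (fun p => adj (word_op (fun j => mx_op (X j)) p.1) h p.2) ((C ^+ 2) ^+ q) T_pure).
  by rewrite exprn_ge0// sqr_ge0.
move=> z K KP; have [x xE] := hsum_of (fun a => K (h a)).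
rewrite -(pair_big xpredT xpredT (fun (w : q.-tuple 'I_k) (b : 'I_m) => hnorm (K (adj (word_op
  (fun j => mx_op (X j)) w) h b)) ^+ 2)) /=.
rewrite -(pair_big xpredT xpredT (fun (a : 'I_m) (u : q.-tuple 'I_n) => hnorm (K (adj (word_op
  T u) (h a))) ^+ 2)) /=.
under eq_bigr do (under eq_bigr do rewrite -(intertwines_word _ KP xE)).
under eq_bigr do rewrite -hnorm_fin.
have Ex a : E (x a) by rewrite xE; exact: EK KP.
apply: le_trans (toeplitz_word_le FT F0 ET E0 ED Er FC q Ex) _.
apply: ler_wpM2l; first by rewrite exprn_ge0// sqr_ge0.
apply: ler_sum => a _; apply: ler_sum => u _.
by rewrite xE (poisson_adj_word _ _ KP).
Qed.

End VonNeumann.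

(** * Word estimates under strong limits *)

Section Limits.
Context (R : realType) (H : hilbertType R) (n k m : nat) (T : 'I_n -> bop H H).
Local Notation Hm := (hsum 'I_m H).

(** Strong convergence of Y gives only weak convergence of the adjoints, under which the sum of
    squares is lower semicontinuous. *)
Lemma sum_adj_limit (J : finType) (K L : hilbertType R) (Y : nat -> J -> bop K L) (Z : J -> bop
  K L)
    (h : L) (b : nat -> R) (B : R) :
  (forall j g, Y l j g @[l --> \oo] --> Z j g) ->
  (forall l, \sum_j hnorm (adj (Y l j) h) ^+ 2 <= b l) ->
  b l @[l --> \oo] --> B ->
  \sum_j hnorm (adj (Z j) h) ^+ 2 <= B.
Proof.
move=> YZ Yb bB; set s := \sum_j _.
(* Here s is the limit of the sums of Re <Z^* h, Y^* h>, and each such term is at most half of |Z^*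
   h|^2 + |Y^* h|^2. *)
suff : s <= 2^-1 * (s + B) by lra.
have lim : \sum_j complex.Re (hdot (Y l j (adj (Z j) h)) h) - 2^-1 * (s + b l) @[l --> \oo]
    --> \sum_j complex.Re (hdot (Z j (adj (Z j) h)) h) - 2^-1 * (s + B).
  apply: cvgB; first by apply: cvg_sum => j _; apply: cvg_Re_hdot; exact: YZ.
  by apply: cvgM; [exact: cvg_cst|apply: cvgD => //; exact: cvg_cst].
have sE : \sum_j complex.Re (hdot (Z j (adj (Z j) h)) h) = s.
  by apply: eq_bigr => j _; rewrite adjP hdot_hnorm.
rewrite sE in lim; rewrite -subr_le0.
apply: (cvg_le_bound lim); near=> l; rewrite subr_le0.
apply: (@le_trans _ _ (\sum_j 2^-1 * (hnorm (adj (Z j) h) ^+ 2 + hnorm (adj (Y l j) h) ^+ 2))).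
  apply: ler_sum => j _; rewrite adjP.
  have := sqr_ge0 (hnorm (adj (Z j) h - adj (Y l j) h)).
  rewrite hnorm_sqrD hnormN hdotNr ReN.
  move: (hnorm _) (hnorm _) (complex.Re _) => p q r; lra.
rewrite -mulr_sumr big_split /= ler_pM2l ?invr_gt0// lerD2l.
exact: Yb.
Unshelve. all: by end_near. Qed.

Lemma word_op_cvg (K : hilbertType R) (Y : nat -> 'I_k -> bop K K) (Z : 'I_k -> bop K K) (M :
  R) w g :
  (forall j x, Y l j x @[l --> \oo] --> Z j x) ->
  (\forall l \near \oo, forall j x, hnorm (Y l j x) <= M * hnorm x) ->
  word_op (Y l) w g @[l --> \oo] --> word_op Z w g.
Proof.
move=> YZ YM; elim: w => [|j w IHw]; first exact: cvg_cst.
have small : Y l j (word_op (Y l) w g - word_op Z w g) @[l --> \oo] --> (0 : K).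
  apply/hcvgP => e e0; have M1 : 0 < `|M| + 1 by rewrite ltr_wpDl.
  move/hcvgP : IHw => /(_ (e / (`|M| + 1)) (divr_gt0 e0 M1)).
  apply: filterS2 YM => l YM.
  rewrite sub0r hnormN ltr_pdivlMr// -hnormN opprB => h.
  apply: le_lt_trans (YM _ _) _; apply: le_lt_trans h.
  by rewrite mulrC ler_wpM2l ?hnorm_ge0// (le_trans (ler_norm _))// lerDl.
have -> : (fun l => word_op (Y l) (j :: w) g) =
    (fun l => Y l j (word_op (Y l) w g - word_op Z w g) + Y l j (word_op Z w g)).
  by apply/funext => l; rewrite -linearD subrK.
by rewrite -[word_op Z (j :: w) g]add0r; apply: cvgD => //; exact: YZ.
Qed.

Lemma word_bound1 (X : 'I_k -> bop Hm Hm) (C : R) h :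
  word_bound T X C ->
  \sum_j hnorm (adj (X j) h) ^+ 2 <=
    C ^+ 2 * \sum_a \sum_i hnorm (adj (T i) (h a)) ^+ 2.
Proof.
move=> /(_ 1%N h); rewrite (expr1 (C ^+ 2)).
rewrite (sum_tupleS _ (fun w => hnorm (adj (word_op X w) h) ^+ 2)).
under eq_bigr do rewrite (sum_tuple0 (fun w => hnorm (adj (word_op X (_ :: w)) h) ^+ 2))
  adj_word_op_cons adj_word_op_nil.
move=> /le_trans; apply; rewrite le_eqVlt; apply/orP; left; apply/eqP.
congr (_ * _); apply: eq_bigr => a _.
rewrite (sum_tupleS _ (fun u => hnorm (adj (word_op T u) (h a)) ^+ 2)).
apply: eq_bigr => i _.
rewrite (sum_tuple0 (fun w => hnorm (adj (word_op T (i :: w)) (h a)) ^+ 2)).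
by rewrite adj_word_op_cons adj_word_op_nil.
Qed.

Lemma word_bound_limit (Y : nat -> 'I_k -> bop Hm Hm) (Z : 'I_k -> bop Hm Hm)
    (c : nat -> R) (C : R) : row_contraction T ->
  (forall l, 0 <= c l) ->
  (forall j x, Y l j x @[l --> \oo] --> Z j x) ->
  (forall l, word_bound T (Y l) (c l)) ->
  c l @[l --> \oo] --> C ->
  word_bound T Z C.
Proof.
move=> T_contr c0 YZ Yc cC q h.
(* Products of strong limits require a uniform bound; it is the case q = 1 of the hypothesis, with
   slack 1 because c l is only near C. *)
have YM : \forall l \near \oo, forall j x, hnorm (Y l j x) <= (C + 1) * hnorm x.
  move/cvgrPdist_le : cC => /(_ 1 ltr01); apply: filterS => l cl j x.
  have C1 : c l <= C + 1 by move: cl; rewrite ler_norml => /andP[? ?]; lra.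
  rewrite -[Y l j]adjK; apply: hnorm_adj_le => [|y]; first exact: le_trans (c0 l) C1.
  apply: (@le_trans _ _ (c l * hnorm y)); last by rewrite ler_wpM2r ?hnorm_ge0.
  rewrite -(@ler_pXn2r _ 2)// ?nnegrE ?mulr_ge0 ?hnorm_ge0// exprMn.
  apply: (@le_trans _ _ (\sum_j hnorm (adj (Y l j) y) ^+ 2)).
    by rewrite (bigD1 j)//= lerDl sumr_ge0// => i _; exact: sqr_ge0.
  apply: le_trans (word_bound1 _ (Yc l)) _; apply: ler_wpM2l; first exact: sqr_ge0.
  rewrite [leRHS]hnorm_fin; apply: ler_sum => a _; exact: row_contraction_le.
apply: (@sum_adj_limit _ _ _ (fun l (w : q.-tuple 'I_k) => word_op (Y l) w) _ h
  (fun l => (c l ^+ 2) ^+ q * \sum_a \sum_(u : q.-tuple 'I_n) hnorm (adj (word_op T u) (h a))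
    ^+ 2)).
- by move=> w g; apply: word_op_cvg YZ YM.
- by move=> l; exact: Yc.
- apply: cvgM; last exact: cvg_cst.
  elim: (q) => [|p IHp]; first exact: cvg_cst.
  rewrite (exprS (C ^+ 2)); under eq_fun do rewrite (exprS (c _ ^+ 2)); apply: cvgM => //.
  by rewrite expr2; under eq_fun do rewrite expr2; exact: cvgM.
Qed.

End Limits.

(** * The joint spectral radius *)

Section SpectralRadius.
Context (R : realType).

Section OperatorSum.
Context (H K : hilbertType R) (J : finType) (Y : J -> bop K H).
Let Q : bop H H := \sum_j Y j \ob adj (Y j).

Let hdotQ u v : hdot u (Q v) = \sum_j hdot (adj (Y j) u) (adj (Y j) v).
Proof. by rewrite bop_sum hdot_sumr; apply: eq_bigr => j _; rewrite bcompE adjPr. Qed.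

Let qformQ u : qform Q u = \sum_j hnorm (adj (Y j) u) ^+ 2.
Proof. by rewrite /qform hdotQ Re_sum; apply: eq_bigr => j _; rewrite hdot_hnorm. Qed.

Let Q_positive : positive_form Q.
Proof.
split=> [u v|u]; last first.
  by rewrite -/(qform _ _) qformQ sumr_ge0// => j _; exact: sqr_ge0.
by rewrite !hdotQ rmorph_sum /=; apply: eq_bigr => j _; rewrite -hdotC.
Qed.

(** A positive operator is controlled by its form: Cauchy-Schwarz for Q at Q h and h gives |Q h|^4
    <= (b |Q h|^2) (b |h|^2). *)
Lemma opnorm_sum_adj_le (b : R) : 0 <= b ->
  (forall h, \sum_j hnorm (adj (Y j) h) ^+ 2 <= b * hnorm h ^+ 2) -> opnorm Q <= b.
Proof.
move=> b0 Yb; apply: opnorm_bound => // h.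
have [->|Q0] := eqVneq (hnorm (Q h)) 0; first by rewrite mulr_ge0 ?hnorm_ge0.
have Qp : 0 < hnorm (Q h) by rewrite lt_def Q0 hnorm_ge0.
rewrite -(@ler_pXn2r _ 2)// ?nnegrE ?mulr_ge0 ?hnorm_ge0//.
rewrite -(ler_pM2r (exprn_gt0 2 Qp)).
have := positive_form_CS (Q h) h Q_positive.
rewrite hdot_hnorm Re_norm_real ger0_norm ?sqr_ge0// !qformQ => /le_trans; apply.
apply: (@le_trans _ _ ((b * hnorm (Q h) ^+ 2) * (b * hnorm h ^+ 2))).
  by apply: ler_pM; rewrite ?sumr_ge0// => j _; exact: sqr_ge0.
by rewrite le_eqVlt; apply/orP; left; apply/eqP; ring.
Qed.

Lemma sum_adj_opnorm h :
  \sum_j hnorm (adj (Y j) h) ^+ 2 <= opnorm Q * hnorm h ^+ 2.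
Proof.
rewrite -qformQ /qform (le_trans (Re_le_norm _))// (le_trans (hdot_CS _ _))//.
by rewrite mulrC expr2 mulrA ler_wpM2r ?hnorm_ge0// opnorm_le.
Qed.

End OperatorSum.

Lemma powR_root_le (a u : R) (N : nat) : 0 <= a -> 0 <= u -> (0 < N)%N ->
  (a `^ N%:R^-1 <= u) = (a <= u ^+ N).
Proof.
move=> a0 u0 N0; have NR : (N%:R : R) != 0 by rewrite pnatr_eq0 -lt0n.
apply/idP/idP => h.
  have -> : a = (a `^ N%:R^-1) ^+ N.
    by rewrite -powR_mulrn ?powR_ge0// -powRrM mulVf// powRr1.
  by rewrite lerXn2r// ?nnegrE ?powR_ge0.
have -> : u = (u ^+ N) `^ N%:R^-1.
  by rewrite -powR_mulrn// -powRrM mulfV// powRr1.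
by apply: ge0_ler_powR; rewrite ?invr_ge0 ?nnegrE ?exprn_ge0.
Qed.

(** Fekete's lemma. It is what makes the [lim] in [joint_spectral_radius] an actual limit. *)
Lemma submultiplicative_root_cvg (a : nat -> R) : (forall q, 0 <= a q) ->
  (forall p q, a (p + q)%N <= a p * a q) ->
  exists l : R, a q `^ ((2 * q)%:R)^-1 @[q --> \oo] --> l.
Proof.
move=> a0 aM; pose s q := a q `^ ((2 * q)%:R)^-1.
(* The index starts at 1: for q = 0 the exponent is the inverse of 0, which is 0, and the root is 1
   whatever a 0 is. *)
pose A := [set s q.+1 | q in [set: nat]].
have Ainf : has_inf A.
  split; first by exists (s 1%N); exists 0%N.
  by exists 0 => _ [q _ <-]; exact: powR_ge0.
pose L := inf A.
have L0 : 0 <= L.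
  by apply: lb_le_inf; [exists (s 1%N); exists 0%N|move=> _ [q _ <-]; exact: powR_ge0].
have Ls q : L <= s q.+1.
  by apply: ge_inf; [exact: Ainf.2|exists q].
exists L; apply/cvgrPdist_le => e e0.
(* With q = d p + r, the remainders r < p cost a constant M. The gap between t' and t absorbs it, as
   (t' / t)^(2q) tends to 0. *)
pose t := L + e; pose t' := L + e / 2.
have t'0 : 0 < t' by rewrite ltr_wpDl// divr_gt0.
have tt' : t' < t by rewrite /t /t'; lra.
have t0 : 0 < t by exact: lt_trans tt'.
have [|_ [p' _ <-] sp] := @inf_adherent _ A (e / 2) _ Ainf; first by rewrite divr_gt0.
set p := p'.+1 in sp.
have ap : a p <= t' ^+ (2 * p).
  by rewrite -powR_root_le ?(ltW t'0)// ltW.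
pose M := 1 + \sum_(r < p) a r / t' ^+ (2 * r).
have sum0 : 0 <= \sum_(r < p) a r / t' ^+ (2 * r).
  by apply: sumr_ge0 => r _; rewrite divr_ge0// exprn_ge0// ltW.
have adp d r : a (d * p + r)%N <= t' ^+ (2 * (d * p)) * a r.
  elim: d => [|d IHd]; first by rewrite mul0n muln0 mul1r.
  rewrite mulSn -addnA mulnDr exprD -mulrA.
  by apply: le_trans (aM _ _) _; apply: ler_pM.
have aq q : a q <= M * t' ^+ (2 * q).
  rewrite {1}(divn_eq q p); apply: le_trans (adp _ _) _.
  have -> : t' ^+ (2 * q) = t' ^+ (2 * (q %/ p * p)) * t' ^+ (2 * (q %% p)).
    by rewrite -exprD -mulnDr -divn_eq.
  rewrite mulrCA ler_wpM2l ?exprn_ge0 ?(ltW t'0)//.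
  rewrite -ler_pdivrMr ?exprn_gt0//.
  have qp : (q %% p < p)%N by rewrite ltn_mod.
  rewrite /M (bigD1 (Ordinal qp))//= addrCA lerDl addr_ge0// sumr_ge0// => r _.
  by rewrite divr_ge0// exprn_ge0// ltW.
have x1 : `|(t' / t) ^+ 2| < 1.
  rewrite ger0_norm ?sqr_ge0// expr_lt1// ?divr_ge0 ?ltW//.
  by rewrite ltr_pdivrMr// mul1r.
have M0 : M * ((t' / t) ^+ 2) ^+ q @[q --> \oo] --> (0 : R).
  by rewrite -[0](mulr0 M); apply: cvgM; [exact: cvg_cst|exact: cvg_expr].
move/cvgrPdist_le : M0 => /(_ 1 ltr01)[N _ NP]; exists N.+1 => // -[//|q] /ltnW Nq /=.
rewrite -/(s q.+1) distrC ger0_norm ?subr_ge0// lerBlDl.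
rewrite powR_root_le ?(ltW t0)//; apply: le_trans (aq _) _.
have := NP q.+1; rewrite /= (leq_trans Nq)// => /(_ isT).
rewrite sub0r normrN ger0_norm; last by rewrite mulr_ge0 ?exprn_ge0 ?divr_ge0 ?(ltW t0) ?(ltW
  t'0) ?addr_ge0.
by rewrite -exprM expr_div_n mulrA ler_pdivrMr ?exprn_gt0// mul1r.
Qed.

Section JointSpectralRadius.
Context (H : hilbertType R) (k : nat) (X : 'I_k -> bop H H).

Definition word_norm (q : nat) : R :=
  opnorm (\sum_(w : q.-tuple 'I_k) word_op X w \ob adj (word_op X w)).

Lemma word_norm_le q h :
  \sum_(w : q.-tuple 'I_k) hnorm (adj (word_op X w) h) ^+ 2 <= word_norm q * hnorm h ^+ 2.
Proof. exact: sum_adj_opnorm. Qed.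

Lemma word_normD p q : word_norm (p + q) <= word_norm p * word_norm q.
Proof.
apply: opnorm_sum_adj_le => [|h]; first by rewrite mulr_ge0 ?opnorm_ge0.
rewrite (sum_tupleD _ _ (fun w => hnorm (adj (word_op X w) h) ^+ 2)).
apply: (@le_trans _ _ (\sum_(v : p.-tuple 'I_k) word_norm q * hnorm (adj (word_op X v) h) ^+ 2)).
  apply: ler_sum => v _; under eq_bigr do rewrite adj_word_op_cat.
  exact: word_norm_le.
rewrite -mulr_sumr -mulrA mulrCA ler_wpM2l ?opnorm_ge0//.
exact: word_norm_le.
Qed.

Lemma joint_spectral_radius_cvg :
  word_norm q `^ ((2 * q)%:R)^-1 @[q --> \oo] --> joint_spectral_radius X.
Proof.
have [l lP] := submultiplicative_root_cvg (fun q => opnorm_ge0 _) word_normD.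
have -> : joint_spectral_radius X = l by exact: cvg_lim.
by [].
Qed.

End JointSpectralRadius.

Lemma word_bound_omega (H : hilbertType R) (n k m : nat) (T : 'I_n -> bop H H)
    (X : 'I_k -> bop (hsum 'I_m H) (hsum 'I_m H)) (C : R) : 0 <= C ->
  word_bound T X C ->
  row_norm X <= row_norm T * C /\
  joint_spectral_radius X <= joint_spectral_radius T * C.
Proof.
move=> C0 XC; split.
  apply: row_norm_le => [|h]; first by rewrite mulr_ge0 ?row_norm_ge0.
  apply: le_trans (word_bound1 h XC) _.
  have -> : (row_norm T * C) ^+ 2 * hnorm h ^+ 2 = C ^+ 2 * (row_norm T ^+ 2 * hnorm h ^+ 2) by
    ring.
  apply: ler_wpM2l; first exact: sqr_ge0.
  rewrite hnorm_fin mulr_sumr; apply: ler_sum => a _.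
  exact: row_norm_adj.
have XT q : word_norm X q <= (C ^+ 2) ^+ q * word_norm T q.
  apply: opnorm_sum_adj_le => [|h]; first by rewrite mulr_ge0 ?opnorm_ge0// exprn_ge0// sqr_ge0.
  apply: le_trans (XC q h) _; rewrite -mulrA ler_wpM2l//.
    by rewrite exprn_ge0// sqr_ge0.
  by rewrite hnorm_fin mulr_sumr; apply: ler_sum => a _; exact: word_norm_le.
have lim : word_norm X q `^ ((2 * q)%:R)^-1 - word_norm T q `^ ((2 * q)%:R)^-1 * C @[q --> \oo]
    --> joint_spectral_radius X - joint_spectral_radius T * C.
  apply: cvgB; first exact: joint_spectral_radius_cvg.
  by apply: cvgM; [exact: joint_spectral_radius_cvg|exact: cvg_cst].
rewrite -subr_le0; apply: (cvg_le_bound lim).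
exists 1%N => // q /= q0; rewrite subr_le0 powR_root_le ?opnorm_ge0 ?muln_gt0//; last first.
  by rewrite mulr_ge0 ?powR_ge0.
apply: le_trans (XT q) _; rewrite [leRHS]exprMn [leRHS]mulrC (exprM C 2 q).
apply: ler_wpM2l; first by rewrite exprn_ge0// sqr_ge0.
by rewrite -powR_root_le ?powR_ge0 ?opnorm_ge0 ?muln_gt0.
Qed.

End SpectralRadius.

(** * The scaled tuples r T *)

Section Scaling.
Context (R : realType) (H : hilbertType R) (n : nat) (T : 'I_n -> bop H H).

Definition scale_tuple (r : R) : 'I_n -> bop H H := fun i => r%:C *: T i.

Lemma word_op_scale r w : word_op (scale_tuple r) w = (r ^+ size w)%:C *: word_op T w.
Proof.
elim: w => [|i w IHw]; apply: bop_ext => x; first by rewrite bopZ scale1r.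
rewrite !word_op_cons bcompE IHw !bopZ linearZ /= scalerA -rmorphM /=.
by rewrite exprS.
Qed.

Lemma hnorm_adj_word_scale r w h :
  hnorm (adj (word_op (scale_tuple r) w) h) ^+ 2 =
  (r ^+ 2) ^+ size w * hnorm (adj (word_op T w) h) ^+ 2.
Proof.
rewrite word_op_scale adjZ bopZ hnormZ Re_norm_conj Re_norm_real exprMn.
by rewrite real_normK ?num_real// -!exprM mulnC.
Qed.

Lemma sum_word_scale r q h :
  \sum_(w : q.-tuple 'I_n) hnorm (adj (word_op (scale_tuple r) w) h) ^+ 2 =
  (r ^+ 2) ^+ q * \sum_(w : q.-tuple 'I_n) hnorm (adj (word_op T w) h) ^+ 2.
Proof.
rewrite mulr_sumr; apply: eq_bigr => w _.
by rewrite hnorm_adj_word_scale size_tuple.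
Qed.

Hypothesis T_contr : row_contraction T.
Variable r : R.
Hypothesis r01 : 0 <= r < 1.

Let r2 : 0 <= r ^+ 2 < 1.
Proof. by rewrite sqr_ge0 expr_lt1//; case/andP: r01. Qed.

Lemma scale_row_contraction : row_contraction (scale_tuple r).
Proof.
move=> x; rewrite bop_sum hdot_suml hdot_hnorm.
rewrite (_ : \sum_i _ = (r ^+ 2 * \sum_i hnorm (adj (T i) x) ^+ 2)%:C).
  rewrite lecR; have := row_contraction_le x T_contr.
  case/andP: r2 => r20 r21; move=> h; apply: le_trans h.
  by rewrite ler_piMl ?sumr_ge0 ?ltW// => i _; exact: sqr_ge0.
rewrite mulr_sumr rmorph_sum; apply: eq_bigr => i _.
rewrite bcompE adjP hdot_hnorm adjZ bopZ hnormZ Re_norm_conj Re_norm_real exprMn.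
by rewrite real_normK ?num_real.
Qed.

Lemma scale_pure : pure (scale_tuple r).
Proof.
move=> h; under eq_fun do rewrite sum_word_scale.
apply: (@squeeze_cvgr _ _ _ _ (fun=> 0) (fun N => (r ^+ 2) ^+ N * hnorm h ^+ 2)).
- have rN0 N : 0 <= (r ^+ 2) ^+ N by rewrite exprn_ge0// sqr_ge0.
  apply: nearW => N; apply/andP; split.
    by apply: mulr_ge0 => //; apply: sumr_ge0 => w _; exact: sqr_ge0.
  by apply: ler_wpM2l => //; exact: sum_word_le.
- exact: cvg_cst.
- rewrite -[0](mul0r (hnorm h ^+ 2)); apply: cvgM; last exact: cvg_cst.
  by apply: cvg_expr; case/andP: r2 => ? ?; rewrite ger0_norm.
Qed.

(** The right side for r T is r^(2q) <= 1 times the one for T. *)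
Lemma scale_word_bound k m (X : 'I_k -> bop (hsum 'I_m H) (hsum 'I_m H)) C :
  word_bound (scale_tuple r) X C -> word_bound T X C.
Proof.
move=> XC q h; apply: le_trans (XC q h) _.
apply: ler_wpM2l; first by rewrite exprn_ge0// sqr_ge0.
apply: ler_sum => a _; rewrite sum_word_scale ler_piMl//.
  by rewrite sumr_ge0// => w _; exact: sqr_ge0.
by case/andP: r2 => r20 r21; rewrite exprn_ile1// ltW.
Qed.

End Scaling.

(** * A sequence of radii tending to 1 *)

Section Radii.
Context (R : realType).

Definition radius (l : nat) : R := 1 - l.+1%:R^-1.

Lemma radius_itv l : 0 <= radius l < 1.
Proof.
rewrite /radius subr_ge0 invf_le1 ?ltr0Sn// ler1n /=.
by rewrite gtrBl invr_gt0 ltr0Sn.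
Qed.

Lemma radius_cvg1 : radius l @[l --> \oo] --> (1 : R).
Proof.
rewrite -[X in _ --> X]subr0; apply: cvgB; [exact: cvg_cst|exact: cvg_harmonic].
Qed.

Lemma cvgX_cst (T : Type) (F : set_system T) {FF : Filter F} (f : T -> R) (l : R) k :
  f @ F --> l -> f x ^+ k @[x --> F] --> l ^+ k.
Proof.
move=> fl; elim: k => [|k IHk]; first by under eq_fun do rewrite expr0; rewrite expr0; exact:
  cvg_cst.
by under eq_fun do rewrite exprS; rewrite exprS; apply: cvgM.
Qed.

Lemma cvg_realZ (H : hilbertType R) (T : Type) (F : set_system T) {FF : Filter F}
    (f : T -> R) (l : R) (h : H) :
  f @ F --> l -> (f x)%:C *: h @[x --> F] --> l%:C *: h.
Proof.
move=> /cvgrPdist_lt fl; apply/hcvgP => e e0.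
have C1 : 0 < hnorm h + 1 by rewrite ltr_wpDl ?hnorm_ge0.
apply: filterS (fl (e / (hnorm h + 1)) (divr_gt0 e0 C1)) => x.
rewrite ltr_pdivlMr// -scalerBl -rmorphB hnormZ Re_norm_real; apply: le_lt_trans.
by rewrite ler_wpM2l// lerDl.
Qed.

End Radii.

(** * Noncommutative polynomials *)

Section Polynomials.
Context (R : realType) (n : nat).
Implicit Type p q : ncpoly R n.

Definition oppp p : ncpoly R n := [seq (- t.1, t.2) | t <- p].

Lemma nceval_cat (H : hilbertType R) (V : 'I_n -> bop H H) p q :
  nceval V (p ++ q) = nceval V p + nceval V q.
Proof. by rewrite /nceval big_cat. Qed.

Lemma nceval_opp (H : hilbertType R) (V : 'I_n -> bop H H) p :
  nceval V (oppp p) = - nceval V p.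
Proof.
by rewrite /nceval big_map -sumrN; apply: eq_bigr => t _; rewrite scaleNr.
Qed.

Lemma nceval_cons (H : hilbertType R) (V : 'I_n -> bop H H) t p :
  nceval V (t :: p) = t.1 *: word_op V t.2 + nceval V p.
Proof. by rewrite /nceval big_cons. Qed.

Lemma ncevalZ (H : hilbertType R) (V : 'I_n -> bop H H) c p :
  exists q, nceval V q = c *: nceval V p.
Proof.
exists [seq (c * t.1, t.2) | t <- p]; rewrite /nceval big_map scaler_sumr.
by apply: eq_bigr => t _; rewrite scalerA.
Qed.

Lemma ncevalM (H : hilbertType R) (V : 'I_n -> bop H H) p q :
  exists s, nceval V s = nceval V p \ob nceval V q.
Proof.
elim: p => [|t p [s sE]].
  by exists [::]; apply: bop_ext => x; rewrite /nceval !big_nil.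
exists ([seq (t.1 * u.1, t.2 ++ u.2) | u <- q] ++ s).
rewrite nceval_cat sE nceval_cons; apply: bop_ext => x.
rewrite bopD !bcompE bopD bopZ; congr (_ + _).
rewrite /nceval big_map !bop_sum bop_sum_arg scaler_sumr; apply: eq_bigr => u _.
rewrite !bopZ word_op_cat bcompE linearZ /= scalerA.
by [].
Qed.

Lemma nceval_toeplitz p : toeplitz_algebra (nceval (@creation R n) p).
Proof.
elim: p => [|t p IHp].
  have [] := @toeplitz_subalgebra R n (-1) _ _ (@toeplitz_id R n) (@toeplitz_id R n).
  by rewrite scaleN1r addNr /nceval big_nil.
rewrite nceval_cons; suff tT : toeplitz_algebra (word_op (@creation R n) t.2).
  by have [] := @toeplitz_subalgebra R n t.1 _ _ tT IHp.
elim: t.2 => [|i w IHw]; first exact: toeplitz_id.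
by have [_] := @toeplitz_subalgebra R n 0 _ _ (@toeplitz_creation R n i) IHw.
Qed.

Lemma nceval_intertwines (H : hilbertType R) (T : 'I_n -> bop H H) p :
  intertwines T (nceval (@creation R n) p) (nceval T p).
Proof.
move=> z K KP h; rewrite /nceval !adj_sum !bop_sum bop_sum_arg.
apply: eq_bigr => t _; rewrite !adjZ !bopZ linearZ /=.
by rewrite (poisson_adj_word _ _ KP).
Qed.

Lemma nceval_scale_cvg (H : hilbertType R) (T : 'I_n -> bop H H) p h :
  nceval (scale_tuple T (radius R l)) p h @[l --> \oo] --> nceval T p h.
Proof.
rewrite /nceval bop_sum; under eq_fun do rewrite bop_sum.
apply: cvg_sum => t _; rewrite bopZ.
under eq_fun do rewrite bopZ word_op_scale bopZ.
apply: cvgZr; rewrite -[X in _ --> X]scale1r.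
apply: cvg_realZ.
rewrite -[X in _ --> X](expr1n R (size t.2)); apply: cvgX_cst.
exact: radius_cvg1.
Qed.

End Polynomials.

(** * The functional calculus by norm limits *)

Section NormCalculus.
Context (R : realType) (n : nat) (K H : hilbertType R).
Variables (V : 'I_n -> bop K K) (T : 'I_n -> bop H H).

Lemma norm_closed_algebra_approx f : norm_closed_algebra (generators V) f ->
  exists p, op_cvg (fun j => nceval V (p j)) f.
Proof.
pose A := [set f | forall e : R, 0 < e -> exists p, opnorm (f - nceval V p) < e].
move=> fV; have /choice[p pP] : forall j : nat, exists p, opnorm (f - nceval V p) < j.+1%:R^-1.
  have : A f.
    apply: fV; split; last first.
      move=> _ [[i _ <-]|->] e e0.
        exists [:: (1, [:: i])]; rewrite nceval_cons /nceval big_nil addr0 scale1r.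
        rewrite (_ : V i - _ = 0); last by apply: bop_ext => x; rewrite bopB subrr.
        apply: le_lt_trans e0; apply: opnorm_bound => // x.
        by rewrite bop0 hnorm0 mul0r.
      exists [:: (1, [::])]; rewrite nceval_cons /nceval big_nil addr0 scale1r subrr.
      apply: le_lt_trans e0; apply: opnorm_bound => // x.
      by rewrite bop0 hnorm0 mul0r.
    split; last first.
      move=> g gA e e0; have e20 : 0 < e / 2 by rewrite divr_gt0.
      have [g' Ag' gg'] := gA _ e20; have [p pg'] := Ag' _ e20.
      exists p; rewrite -[g](subrK g') -addrA [e]splitr.
      by apply: le_lt_trans (opnormD _ _) _; rewrite ltrD.
    move=> c g h Ag Ah; split=> e e0.
      pose d := complex.Re `|c| + 1.
      have d0 : 0 < d by rewrite ltr_wpDl ?Re_normc_ge0.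
      have [|p pg] := Ag (e / 2 / d); first by rewrite !divr_gt0.
      have [|q qh] := Ah (e / 2); first by rewrite divr_gt0.
      have [p' p'E] := ncevalZ V c p.
      exists (p' ++ q); rewrite nceval_cat p'E opprD addrACA -scalerBr [e]splitr.
      apply: le_lt_trans (opnormD _ _) _; apply: ltrD => //.
      apply: le_lt_trans (opnormZ _ _) _; move: pg; rewrite ltr_pdivlMr//.
      by apply: le_lt_trans; rewrite mulrC ler_wpM2l ?opnorm_ge0// lerDl.
    pose d := opnorm g + opnorm h + 1.
    have d0 : 0 < d by rewrite ltr_wpDl ?addr_ge0 ?opnorm_ge0.
    (* The 1 keeps the norm of the polynomial p below |g| + 1; the error of the product is then less
       than (|h| + |g| + 1) e / d = e. *)
    have m0 : 0 < Num.min 1 (e / d) by rewrite lt_min ltr01 divr_gt0.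
    have [p pg] := Ag _ m0; have [q qh] := Ah _ m0; have [s sE] := ncevalM V p q.
    exists s; rewrite sE.
    have -> : g \ob h - nceval V p \ob nceval V q =
        (g - nceval V p) \ob h + nceval V p \ob (h - nceval V q).
      apply: bop_ext => x; rewrite bopB bopD !bcompE !bopB linearB /=.
      by rewrite addrA subrK.
    have pn : opnorm (nceval V p) <= opnorm g + 1.
      rewrite -[nceval V p](subKr g) -opprB opprD opprK addrC.
      apply: le_trans (opnormD _ _) _; rewrite opnormN.
      rewrite lerD// (le_trans (ltW pg))// ge_min lexx.
      by [].
    apply: le_lt_trans (opnormD _ _) _.
    apply: le_lt_trans (lerD (opnormM _ _) (opnormM _ _)) _.
    move: pg qh; rewrite !lt_min => /andP[_ pg] /andP[_ qh].
    move: pg qh; rewrite !ltr_pdivlMr// => pg qh.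
    rewrite -(ltr_pM2r d0) mulrDl.
    have h1 := ler_wpM2r (opnorm_ge0 h) (ltW pg).
    have h2 := ler_wpM2r (mulr_ge0 (opnorm_ge0 (h - nceval V q)) (ltW d0)) pn.
    have h3 : (opnorm g + 1) * (opnorm (h - nceval V q) * d) < (opnorm g + 1) * e.
      by rewrite ltr_pM2l// ltr_wpDl ?opnorm_ge0.
    have -> : e * d = e * opnorm h + (opnorm g + 1) * e by rewrite /d; ring.
    apply: ler_ltD; first by rewrite mulrAC.
    by rewrite -mulrA; apply: le_lt_trans h2 h3.
  by move=> Af j; apply: Af; rewrite invr_gt0 ltr0Sn.
exists p; apply/op_cvgP => e e0.
have /cvgrPdist_lt/(_ e e0)[N _ NP] := @cvg_harmonic R.
exists N => j Nj; rewrite -opnormN opprB; apply: lt_trans (pP j) _.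
by have := NP j Nj; rewrite sub0r normrN ger0_norm ?invr_ge0.
Qed.

Hypothesis VN : forall p, opnorm (nceval T p) <= opnorm (nceval V p).

(** The inequality [VN], applied to differences of polynomials, carries Cauchy sequences from V to T
    and makes the limit independent of the approximating sequence. *)
Lemma norm_calculusP f p : op_cvg (fun j => nceval V (p j)) f ->
  op_cvg (fun j => nceval T (p j)) (norm_calculus V T f).
Proof.
move=> pf.
have VNB p1 p2 : opnorm (nceval T p1 - nceval T p2) <= opnorm (nceval V p1 - nceval V p2).
  by rewrite -!nceval_opp -!nceval_cat.
have [|X TX] := @op_cauchy_cvg _ _ _ (fun j => nceval T (p j)).
  move=> e e0; have e20 : 0 < e / 2 by rewrite divr_gt0.
  have [N NP] := (op_cvgP _ _).1 pf _ e20; exists N => j Nj.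
  apply: le_lt_trans (VNB _ _) _.
  rewrite -[nceval V (p j)](subrK f) -addrA -[f - _]opprB [e]splitr.
  by apply: le_lt_trans (opnormD _ _) _; rewrite opnormN ltrD ?NP.
suff XP : forall q, op_cvg (fun j => nceval V (q j)) f -> op_cvg (fun j => nceval T (q j)) X.
  by rewrite /norm_calculus; case: xgetP => [Y _ YP|/(_ X)//]; exact: YP.
move=> q qf; apply/op_cvgP => e e0; have e30 : 0 < e / 3 by rewrite divr_gt0.
have [N1 N1P] := (op_cvgP _ _).1 pf _ e30; have [N2 N2P] := (op_cvgP _ _).1 qf _ e30.
have [N3 N3P] := (op_cvgP _ _).1 TX _ e30.
exists (maxn N1 (maxn N2 N3)) => j; rewrite !geq_max => /and3P[j1 j2 j3].
rewrite -[nceval T (q j)](subrK (nceval T (p j))) -addrA.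
apply: le_lt_trans (opnormD _ _) _.
have := N3P _ j3; have := N1P _ j1; have := N2P _ j2.
have := VNB (q j) (p j).
have := opnormD (nceval V (q j) - f) (f - nceval V (p j)).
rewrite addrA subrK -(opnormN (f - _)) opprB; lra.
Qed.

End NormCalculus.

(** * Entrywise limits of operator matrices *)

Section MatrixLimits.
Context (R : realType).

Lemma opnorm_sum (H K : hilbertType R) (I : Type) (s : seq I) (P : pred I) (f : I -> bop H K) :
  opnorm (\sum_(i <- s | P i) f i) <= \sum_(i <- s | P i) opnorm (f i).
Proof.
apply: (big_ind2 (fun (X : bop H K) c => opnorm X <= c)) => // [|X c Y d Xc Yd].
  by apply: opnorm_bound => // x; rewrite bop0 hnorm0 mul0r.
by rewrite (le_trans (opnormD _ _))// lerD.
Qed.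

Lemma opnorm_coord (I : choiceType) (H : hilbertType R) (i : I) : opnorm (hsum_coord H i) <= 1.
Proof. by apply: opnorm_bound => // x; rewrite mul1r; exact: hnorm_coord. Qed.

Lemma opnorm_inj (I : choiceType) (H : hilbertType R) (i : I) : opnorm (hsum_inj H i) <= 1.
Proof. by rewrite -opnorm_adj adj_inj_coord opnorm_coord. Qed.

Lemma opnorm_dist (H K : hilbertType R) (f g : bop H K) : `|opnorm f - opnorm g| <= opnorm (f -
  g).
Proof.
have h (f' g' : bop H K) : opnorm f' <= opnorm (f' - g') + opnorm g'.
  by rewrite -{1}[f'](subrK g') opnormD.
have h1 := h f g; have h2 := h g f; rewrite -(opnormN (g - f)) opprB in h2.
by rewrite ler_norml; apply/andP; split; lra.
Qed.

Lemma mx_op_cvg (H : hilbertType R) m (X : nat -> 'M[bop H H]_m) (Y : 'M[bop H H]_m) x :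
  (forall a b g, X l a b g @[l --> \oo] --> Y a b g) ->
  mx_op (X l) x @[l --> \oo] --> mx_op Y x.
Proof.
move=> XY; rewrite /mx_op bop_sum; under eq_fun do rewrite bop_sum.
apply: cvg_sum => a _; rewrite bop_sum; under eq_fun do rewrite bop_sum.
apply: cvg_sum => b _; rewrite !bcompE; under eq_fun do rewrite !bcompE.
by apply: cvg_bop; exact: XY.
Qed.

Lemma row_norm_dist (H : hilbertType R) k m (X Y : 'I_k -> 'M[bop H H]_m) :
  `|row_norm (fun j => mx_op (X j)) - row_norm (fun j => mx_op (Y j))| <=
  \sum_j \sum_a \sum_b opnorm (X j a b - Y j a b).
Proof.
apply: le_trans (opnorm_dist _ _) _; rewrite /row_op -sumrB.
apply: le_trans (opnorm_sum _ _ _) _; apply: ler_sum => j _.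
have -> : mx_op (X j) \ob hsum_coord (hsum 'I_m H) j - mx_op (Y j) \ob hsum_coord (hsum 'I_m H)
  j =
    mx_op (X j - Y j) \ob hsum_coord (hsum 'I_m H) j.
  apply: bop_ext => x; rewrite bopB !bcompE; apply: hsum_ext => a.
  rewrite hsumB_coord !mx_opE -sumrB; apply: eq_bigr => b _.
  by rewrite !mxE.
apply: le_trans (opnormM _ _) _.
apply: le_trans (_ : opnorm (mx_op (X j - Y j)) * 1 <= _).
  by rewrite ler_wpM2l ?opnorm_ge0 ?opnorm_coord.
rewrite mulr1; apply: le_trans (opnorm_sum _ _ _) _; apply: ler_sum => a _.
apply: le_trans (opnorm_sum _ _ _) _; apply: ler_sum => b _.
rewrite !mxE.
apply: le_trans (opnormM _ _) _; rewrite -[leRHS]mulr1.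
apply: ler_pM; rewrite ?opnorm_ge0 ?opnorm_coord//.
apply: le_trans (opnormM _ _) _; rewrite -[leRHS]mul1r.
by rewrite ler_wpM2r ?opnorm_ge0 ?opnorm_inj.
Qed.

Lemma row_norm_cvg (H : hilbertType R) k m (X : nat -> 'I_k -> 'M[bop H H]_m) (Y : 'I_k ->
  'M[bop H H]_m) :
  (forall j a b, op_cvg (fun l => X l j a b) (Y j a b)) ->
  row_norm (fun j => mx_op (X l j)) @[l --> \oo] --> row_norm (fun j => mx_op (Y j)).
Proof.
move=> XY; apply/cvgrPdist_le => e e0.
have lim : \sum_j \sum_a \sum_b opnorm (X l j a b - Y j a b) @[l --> \oo]
    --> \sum_(j < k) \sum_(a < m) \sum_(b < m) (0 : R).
  apply: cvg_sum => j _; apply: cvg_sum => a _; apply: cvg_sum => b _; exact: XY.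
have z : \sum_(j < k) \sum_(a < m) \sum_(b < m) (0 : R) = 0.
  by rewrite big1// => j _; rewrite big1// => a _; rewrite big1.
rewrite z in lim.
move/cvgrPdist_le : lim => /(_ e e0); apply: filterS => l.
rewrite sub0r normrN distrC => h; apply: le_trans (row_norm_dist _ _) _.
exact: le_trans (ler_norm _) h.
Qed.

End MatrixLimits.

(** * From polynomials to the norm closed algebra *)

Section NormCalculusBound.
Context (R : realType) (n k m : nat) (K H : hilbertType R).
Variables (V : 'I_n -> bop K K) (T : 'I_n -> bop H H) (one : K).
Hypothesis T_contr : row_contraction T.
Hypothesis one1 : hdot one one = 1.
Hypothesis VN : forall p, opnorm (nceval T p) <= opnorm (nceval V p).
Hypothesis poly_bound : forall P : 'I_k -> 'I_m -> 'I_m -> ncpoly R n,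
  (forall j a b, hdot (nceval V (P j a b) one) one = 0) ->
  word_bound T (fun j => mx_op (\matrix_(a, b) nceval T (P j a b)))
    (row_norm (fun j => mx_op (\matrix_(a, b) nceval V (P j a b)))).

Lemma norm_calculus_omega_bound (F : 'I_k -> 'M[bop K K]_m) :
  (forall j a b, norm_closed_algebra (generators V) (F j a b)) ->
  (forall j, mx_at0 one (F j) = 0) ->
  omega_bound T (norm_calculus V T) F.
Proof.
move=> FV F0.
have /choice[p0 p0P] : forall t : 'I_k * 'I_m * 'I_m, exists p,
    op_cvg (fun l => nceval V (p l)) (F t.1.1 t.1.2 t.2).
  by move=> t; apply: norm_closed_algebra_approx; exact: FV.
pose c t l := hdot (nceval V (p0 t l) one) one.
(* The approximating polynomials need not vanish at 0. Their constant terms tend to F(0) = 0, so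
   subtracting them keeps the limit and makes [poly_bound] applicable. *)
pose p t l : ncpoly R n := (- c t l, [::]) :: p0 t l.
have pE t l : nceval V (p t l) = nceval V (p0 t l) - c t l *: bid K.
  by rewrite /p nceval_cons /= scaleNr addrC.
have pP t : op_cvg (fun l => nceval V (p t l)) (F t.1.1 t.1.2 t.2).
  have F0t : hdot (F t.1.1 t.1.2 t.2 one) one = 0.
    by have /matrixP/(_ t.1.2 t.2) := F0 t.1.1; rewrite !mxE.
  have n1 : hnorm one = 1.
    apply/eqP; rewrite -(@eqrXn2 _ 2)// ?hnorm_ge0//.
    by have /(congr1 (@complex.Re R)) := one1; rewrite hdot_hnorm /= => ->; rewrite expr1n.
  apply/op_cvgP => e e0; have e20 : 0 < e / 2 by rewrite divr_gt0.
  have [N NP] := (op_cvgP _ _).1 (p0P t) _ e20; exists N => l Nl.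
  rewrite pE addrAC [e]splitr; apply: le_lt_trans (opnormD _ _) _.
  apply: ltrD; first exact: NP.
  rewrite opnormN; apply: le_lt_trans (NP _ Nl); apply: opnorm_bound; first exact: opnorm_ge0.
  move=> x; rewrite bopZ hnormZ ler_wpM2r ?hnorm_ge0//.
  have -> : c t l = hdot ((nceval V (p0 t l) - F t.1.1 t.1.2 t.2) one) one.
    by rewrite bopB hdotDl hdotNl F0t subr0.
  apply: le_trans (hdot_CS _ _) _; rewrite n1 mulr1.
  by apply: le_trans (opnorm_le _ _) _; rewrite n1 mulr1.
apply: word_bound_omega; first exact: row_norm_ge0.
apply: (@word_bound_limit _ _ _ _ _ _
  (fun l j => mx_op (\matrix_(a, b) nceval T (p (j, a, b) l))) _
  (fun l => row_norm (fun j => mx_op (\matrix_(a, b) nceval V (p (j, a, b) l))))) => //.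
- by move=> l; exact: row_norm_ge0.
- move=> j x; apply: mx_op_cvg => a b g; rewrite mxE; under eq_fun do rewrite mxE.
  by apply: op_cvg_pointwise; exact: norm_calculusP VN _ _ (pP (j, a, b)).
- move=> l; apply: poly_bound => j a b; rewrite pE bopB hdotDl hdotNl bopZ hdotZl.
  by rewrite one1 mulr1 subrr.
- apply: row_norm_cvg => j a b; have := pP (j, a, b).
  by under [in X in _ -> X]eq_fun do rewrite mxE.
Qed.

End NormCalculusBound.

(** * Fourier expansions and dilations on the Fock space *)

Section Series.
Context (R : realType) (n : nat).
Local Notation F2 := (fock R n).
Local Notation e w := (fock_basis R w).

Lemma restr_size_lt (N : nat) (x : F2) :
  restr (complex_line R) (fun w : seq 'I_n => (size w < N)%N) x =
  \sum_(w <- words_lt 'I_n N) (x w : R[i]) *: e w.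
Proof.
apply: hsum_ext => u; rewrite restrE hsum_sum_coord.
under eq_bigr do rewrite hsumZ_coord basisE.
rewrite -mem_words_lt; case: ifPn => uN.
  rewrite (bigD1_seq u)//= ?words_lt_uniq// eqxx big1 ?addr0 => [|w wu].
    by rewrite -[RHS]/(x u * 1) mulr1.
  by rewrite eq_sym (negPf wu) scaler0.
rewrite big_seq big1// => w wN; case: eqP => [uw|_]; last by rewrite scaler0.
by rewrite uw wN in uN.
Qed.

Lemma basis_series_cvg (H : hilbertType R) (M : bop F2 H) (x : F2) :
  \sum_(k < N) \sum_(w : k.-tuple 'I_n) (x w : R[i]) *: M (e w) @[N --> \oo] --> M x.
Proof.
have -> : (fun N => \sum_(k < N) \sum_(w : k.-tuple 'I_n) (x w : R[i]) *: M (e w)) =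
    (fun N => M (restr (complex_line R) (fun w : seq 'I_n => (size w < N)%N) x)).
  apply/funext => N; rewrite restr_size_lt bop_sum_arg -(sum_words_lt N (fun w => (x w : R[i])
    *: M (e w))).
  by apply: eq_bigr => w _; rewrite linearZ.
apply: cvg_bop; apply: (@restr_cvg _ _ _ (fun N (w : seq 'I_n) => (size w < N)%N)) => w.
by exists (size w).+1.
Qed.

Lemma dilate_exists (r : R) : 0 <= r <= 1 -> exists D : bop F2 F2,
  forall x w, D x w = (r ^+ size w)%:C *: (x w : R[i]^o).
Proof.
move=> /andP[r0 r1].
have [//|w a x y|x s us|D [DE _]] := @hsum_bop R (seq 'I_n) (complex_line R) F2
  (fun x w => (r ^+ size w)%:C *: (x w : complex_line R)) 1; last by exists D.
  by rewrite hsumD_coord hsumZ_coord scalerDr !scalerA mulrC.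
rewrite expr1n mul1r; apply: le_trans (sum_le_hnorm_sqr x us).
apply: ler_sum => w _; rewrite hnormZ Re_norm_real exprMn ler_piMl ?sqr_ge0//.
by rewrite real_normK ?num_real// -exprM exprn_ile1.
Qed.

(** The second quantisation of r I; it turns the Fourier series f 1 into that of f(rS). *)
Definition dilate (r : R) : bop F2 F2 :=
  xget 0 [set D : bop F2 F2 | forall x w, D x w = (r ^+ size w)%:C *: (x w : R[i]^o)].

Lemma dilateE r x w : 0 <= r <= 1 -> dilate r x w = (r ^+ size w)%:C *: (x w : R[i]^o).
Proof.
by move=> /dilate_exists[D DP]; rewrite /dilate; case: xgetP => [D' _ ->//|/(_ D)/(_ DP)].
Qed.

Lemma at_left1_itv : \forall r \near (1 : R)^'-, 0 <= r < 1.
Proof.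
near=> r; apply/andP; split; last by near: r; exact: nbhs_left_lt.
by near: r; apply: nbhs_left_ge; exact: ltr01.
Unshelve. all: by end_near. Qed.

Lemma dilate_cvg x : dilate r x @[r --> (1 : R)^'-] --> x.
Proof.
apply/hcvgP => d d0; have d20 : 0 < d / 2 by rewrite divr_gt0.
have /hcvgP/(_ _ d20)[N _ /(_ N (leqnn N))] :=
  @restr_cvg _ _ _ (fun N (w : seq 'I_n) => (size w < N)%N) x (fun w => ex_intro _ (size w).+1
    (fun _ => id)).
set y := restr _ _ x => xy.
have rN : 1 - r ^+ N @[r --> (1 : R)^'-] --> 1 - (1 : R) ^+ N.
  apply: cvgB; first exact: cvg_cst.
  by apply: cvgX_cst; exact: cvg_at_left_filter cvg_id.
rewrite expr1n subrr in rN.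
have x1 : 0 < hnorm x + 1 by rewrite ltr_wpDl ?hnorm_ge0.
move/cvgrPdist_lt : rN => /(_ (d / 2 / (hnorm x + 1))); rewrite divr_gt0// => /(_ isT).
apply: filterS2 at_left1_itv => r /andP[r0 r1].
have r01 : 0 <= r <= 1 by rewrite r0 ltW.
rewrite sub0r normrN ger0_norm ?subr_ge0 ?exprn_ile1 ?(ltW r1)// ltr_pdivlMr// => rN.
(* On y, of degree < N, the dilation changes coordinates by a factor at most 1 - r^N; on the small
   rest x - y, the identity minus the dilation is a contraction. *)
have -> : x - dilate r x = (y - dilate r y) + ((x - y) - dilate r (x - y)).
  by rewrite linearB /= opprB addrACA [y + _]addrC subrK addKr.
have coordE z w : hnorm ((z - dilate r z) w) ^+ 2 = (1 - r ^+ size w) ^+ 2 * hnorm (z w) ^+ 2.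
  have -> : (z - dilate r z) w = (1 - r ^+ size w)%:C *: (z w : complex_line R).
    by rewrite hsumB_coord dilateE// rmorphB rmorph1 scalerBl scale1r.
  by rewrite hnormZ Re_norm_real exprMn real_normK ?num_real.
apply: le_lt_trans (hnormD _ _) _; rewrite [d]splitr; apply: ltr_leD.
  apply: le_lt_trans (_ : (1 - r ^+ N) * hnorm x < _); last first.
    by apply: le_lt_trans rN; rewrite ler_wpM2l ?subr_ge0 ?exprn_ile1 ?(ltW r1)// lerDl.
  rewrite -(@ler_pXn2r _ 2)// ?nnegrE ?mulr_ge0 ?hnorm_ge0 ?subr_ge0 ?exprn_ile1 ?(ltW r1)//.
  rewrite exprMn; apply: hnorm_sqr_le => s us.
  apply: (@le_trans _ _ (\sum_(w <- s) (1 - r ^+ N) ^+ 2 * hnorm (x w) ^+ 2)); last first.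
    by rewrite -mulr_sumr ler_wpM2l ?sqr_ge0// sum_le_hnorm_sqr.
  apply: ler_sum => w _; rewrite coordE /y restrE; case: ifPn => wN; last first.
    by rewrite hnorm0 expr0n mulr0 mulr_ge0 ?sqr_ge0.
  rewrite ler_wpM2r ?sqr_ge0// ler_sqr ?nnegrE ?subr_ge0 ?exprn_ile1 ?(ltW r1)//.
  by rewrite lerD2l lerN2 ler_wiXn2l ?(ltW r1)// ltnW.
apply: le_trans (ltW xy).
rewrite -(@ler_pXn2r _ 2)// ?nnegrE ?hnorm_ge0//; apply: hnorm_sqr_le => s us.
apply: le_trans (sum_le_hnorm_sqr _ us); apply: ler_sum => w _.
rewrite coordE ler_piMl ?sqr_ge0// expr_le1 ?subr_ge0 ?exprn_ile1 ?(ltW r1)//.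
by rewrite gerBl exprn_ge0.
Qed.

End Series.

(** * The operators f(rT) *)

Section AbelMeans.
Context (R : realType) (n : nat) (H : hilbertType R) (T : 'I_n -> bop H H).
Local Notation F2 := (fock R n).
Local Notation e w := (fock_basis R w).
Hypothesis T_contr : row_contraction T.
Variable f : bop F2 F2.
Hypothesis fT : toeplitz_algebra f.

Definition abel_part (r : R) (k : nat) : bop H H :=
  \sum_(w : k.-tuple 'I_n) ((r ^+ k)%:C * fourier f w) *: word_op T w.

(* f(rT_1, ..., rT_n) *)
Definition abel (r : R) : bop H H :=
  xget 0 [set A | op_cvg (fun N => \sum_(k < N) abel_part r k) A].

Lemma sum_CS (J : finType) (a b : J -> R) :
  (\sum_j a j * b j) ^+ 2 <= (\sum_j a j ^+ 2) * (\sum_j b j ^+ 2).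
Proof.
apply: quadratic_discr => [||t]; try by rewrite sumr_ge0// => j _; exact: sqr_ge0.
rewrite !mulr_sumr -!big_split /= sumr_ge0// => j _.
have -> : t ^+ 2 * a j ^+ 2 + 2 * t * (a j * b j) + b j ^+ 2 = (t * a j + b j) ^+ 2 by ring.
exact: sqr_ge0.
Qed.

(** Cauchy-Schwarz over the words of length k, on the adjoint: the coefficients give at most |f 1|
    and the vectors T_w^* y at most |y|, so the number of words does not enter. *)
Lemma opnorm_abel_part r k : 0 <= r -> opnorm (abel_part r k) <= r ^+ k * hnorm (f (vacuum R n)).
Proof.
move=> r0; rewrite -opnorm_adj; apply: opnorm_bound => [|y].
  by rewrite mulr_ge0 ?exprn_ge0 ?hnorm_ge0.
rewrite /abel_part adj_sum bop_sum.
pose a (w : k.-tuple 'I_n) := complex.Re `|fourier f w|.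
pose b (w : k.-tuple 'I_n) := hnorm (adj (word_op T w) y).
apply: (@le_trans _ _ (\sum_w r ^+ k * (a w * b w))).
  apply: (big_ind2 (fun (u : H) c => hnorm u <= c)) => [|u c v d uc vd|w _].
  - by rewrite hnorm0.
  - by rewrite (le_trans (hnormD _ _))// lerD.
  - rewrite adjZ bopZ hnormZ Re_norm_conj Re_normM Re_norm_real.
    by rewrite ger0_norm ?exprn_ge0// -mulrA.
rewrite -mulr_sumr -mulrA ler_wpM2l ?exprn_ge0//.
rewrite -(@ler_pXn2r _ 2)// ?nnegrE ?mulr_ge0 ?hnorm_ge0//; last first.
  by rewrite sumr_ge0// => w _; rewrite mulr_ge0 ?hnorm_ge0 ?Re_normc_ge0.
apply: le_trans (sum_CS a b) _; rewrite exprMn.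
apply: ler_pM; last exact: sum_word_le.
- by apply: sumr_ge0 => w _; exact: sqr_ge0.
- by apply: sumr_ge0 => w _; exact: sqr_ge0.
rewrite /a; have /(sum_le_hnorm_sqr (f (vacuum R n))) : uniq [seq tval w | w <- enum {:
  k.-tuple 'I_n}].
  by rewrite map_inj_uniq ?enum_uniq//; exact: val_inj.
by rewrite big_map big_enum.
Qed.

Lemma abelP r : 0 <= r < 1 -> op_cvg (fun N => \sum_(k < N) abel_part r k) (abel r).
Proof.
move=> /andP[r0 r1]; set B := hnorm (f (vacuum R n)).
suff [A AP] : exists A, op_cvg (fun N => \sum_(k < N) abel_part r k) A.
  by rewrite /abel; case: xgetP => [A' _ //|/(_ A)].
apply: op_cauchy_cvg => d d0.
have lim : r ^+ N * (B / (1 - r)) @[N --> \oo] --> (0 : R).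
  rewrite -[0](mul0r (B / (1 - r))); apply: cvgM; last exact: cvg_cst.
  by apply: cvg_expr; rewrite ger0_norm.
move/cvgrPdist_lt : lim => /(_ d d0)[N _ NP]; exists N => M NM.
have r10 : 0 < 1 - r by rewrite subr_gt0.
apply: le_lt_trans (_ : r ^+ N * (B / (1 - r)) < d); last first.
  have := NP N (leqnn N); rewrite sub0r normrN => /(le_lt_trans _); apply.
  exact: ler_norm.
rewrite -(subnKC NM) big_split_ord /= addrAC subrr add0r.
apply: le_trans (opnorm_sum _ _ _) _.
apply: (@le_trans _ _ (\sum_(i < M - N) r ^+ N * (r ^+ i * B))).
  apply: ler_sum => i _; apply: le_trans (opnorm_abel_part _ r0) _.
  by rewrite exprD mulrA.
rewrite -mulr_sumr ler_wpM2l ?exprn_ge0// -mulr_suml mulrC ler_wpM2l ?hnorm_ge0//.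
rewrite -[leRHS]mul1r ler_pdivlMr// mulrC.
have -> : (1 - r) * \sum_(i < M - N) r ^+ i = 1 - r ^+ (M - N).
  elim: (M - N)%N => [|L IHL]; first by rewrite big_ord0 mulr0 subrr.
  by rewrite big_ord_recr /= mulrDr IHL exprS; ring.
by rewrite gerBl exprn_ge0.
Qed.

Lemma abel_lim r h : 0 <= r < 1 ->
  lim (series (fun k => \sum_(w : k.-tuple 'I_n)
    ((r ^+ k)%:C * fourier f w) *: word_op T w h) @ \oo) = abel r h.
Proof.
move=> r01; apply: (@cvg_lim _ (@norm_hausdorff _ H)).
have -> : series (fun k => \sum_(w : k.-tuple 'I_n) ((r ^+ k)%:C * fourier f w) *: word_op T w
  h) =
    (fun N => (\sum_(k < N) abel_part r k) h).
  apply/funext => N; rewrite bop_sum /series /= big_mkord.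
  by apply: eq_bigr => k _; rewrite /abel_part bop_sum.
exact: op_cvg_pointwise (abelP r01).
Qed.

(** Tested on e_u, both sides are the sum of a_w (rT)_w (rT)_u z. The powers of r sit in the words
    of r T, which is why f appears undilated. *)
Lemma abel_intertwines r : 0 <= r < 1 -> intertwines (scale_tuple T r) f (abel r).
Proof.
move=> r01 z K KP h; apply: hsum_ext => u.
have AL : abel r (adj K (e u)) = adj K (f (e u)).
  rewrite (poisson_adj_basis _ KP).
  apply: hcvg_unique (op_cvg_pointwise (abelP r01)) _.
  have L := @basis_series_cvg R n _ (adj K \ob rmul R u) (f (vacuum R n)).
  rewrite bcompE -toeplitz_basis// in L.
  have E : (fun N => (\sum_(k < N) abel_part r k) (word_op (scale_tuple T r) u z)) =
      (fun N => \sum_(k < N) \sum_(w : k.-tuple 'I_n)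
         (f (vacuum R n) w : R[i]) *: (adj K \ob rmul R u) (e w)).
    apply/funext => N; rewrite bop_sum; apply: eq_bigr => k _.
    rewrite /abel_part bop_sum; apply: eq_bigr => w _.
    rewrite bcompE rmul_basis (poisson_adj_basis _ KP) word_op_cat bcompE bopZ.
    by rewrite [word_op (scale_tuple T r) w]word_op_scale bopZ scalerA size_tuple mulrC.
  by rewrite E.
by rewrite -[LHS]hdot_basis -[RHS]hdot_basis -[RHS]adjPr [LHS](adjP K) [RHS](adjP K) -adjPr AL.
Qed.

End AbelMeans.

(** * The functional calculus by strong limits *)

Section SotCalculus.
Context (R : realType) (n : nat) (H : hilbertType R).
Local Notation F2 := (fock R n).
Local Notation e w := (fock_basis R w).

Lemma intertwines_le (T : 'I_n -> bop H H) (f : bop F2 F2) (X : bop H H) (C : R) :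
  row_contraction T -> pure T -> intertwines T f X -> 0 <= C ->
  (forall z K h, poisson T z K -> hnorm (adj f (K h)) <= C * hnorm (K h)) ->
  forall h, hnorm (adj X h) <= C * hnorm h.
Proof.
move=> T_contr T_pure fX C0 fC h.
rewrite -(@ler_pXn2r _ 2)// ?nnegrE ?mulr_ge0 ?hnorm_ge0// exprMn.
have := @poisson_domination _ _ _ T T_contr 'I_1 'I_1 (fun=> h) (fun=> adj X h) (C ^+ 2) T_pure.
rewrite !big_ord1; apply=> [|z K KP]; first exact: sqr_ge0.
rewrite !big_ord1 (fX z K KP) -exprMn ler_sqr ?nnegrE ?mulr_ge0 ?hnorm_ge0//.
exact: fC KP.
Qed.

Lemma hcvg_near_eq (K : hilbertType R) (T : Type) (F : set_system T) {FF : Filter F}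
    (f g : T -> K) (l : K) :
  (\forall x \near F, f x = g x) -> g @ F --> l -> f @ F --> l.
Proof.
move=> fg /hcvgP gl; apply/hcvgP => d d0.
by apply: filterS2 fg (gl d d0) => x ->.
Qed.

Lemma radius_at_left (P : set R) :
  (\forall r \near (1 : R)^'-, P r) -> \forall l \near \oo, P (radius R l).
Proof.
move=> PP; have rP : \forall l \near \oo, radius R l < 1 -> P (radius R l).
  exact: (@radius_cvg1 R _ PP).
by apply: filterS rP => l; apply; have /andP[] := radius_itv R l.
Qed.

Variable T : 'I_n -> bop H H.
Hypothesis T_contr : row_contraction T.

Lemma opnorm_abel f r : toeplitz_algebra f -> 0 <= r < 1 -> opnorm (abel T f r) <= opnorm f.
Proof.
move=> fT r01; rewrite -opnorm_adj; apply: opnorm_bound; first exact: opnorm_ge0.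
apply: (intertwines_le (scale_row_contraction T_contr r01) (scale_pure T_contr r01)
  (abel_intertwines T_contr fT r01) (opnorm_ge0 f)) => z K h _.
by rewrite -opnorm_adj opnorm_le.
Qed.

(** Here K belongs to T itself, so f(rT) T_w z is the fixed operator [adj K \ob rmul R w] applied to
    the dilated series of f, and dilations tend strongly to the identity. *)
Lemma abel_word_cvg f z w : toeplitz_algebra f -> admissible T z ->
  exists l : H, abel T f r (word_op T w z) @[r --> (1 : R)^'-] --> l.
Proof.
move=> fT zA; have [K KP] := poisson_exists T_contr zA.
pose L := adj K \ob rmul R w.
exists (L (f (vacuum R n))).
apply: (@hcvg_near_eq _ _ _ _ _ (fun r => L (dilate n r (f (vacuum R n))))); last first.
  by apply: cvg_bop; exact: dilate_cvg.
apply: filterS (at_left1_itv R) => r r01.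
have r01' : 0 <= r <= 1 by case/andP: r01 => -> /ltW ->.
apply: hcvg_unique (op_cvg_pointwise (abelP T_contr f r01)) _.
have B := @basis_series_cvg R n _ L (dilate n r (f (vacuum R n))).
have E : (fun N => (\sum_(k < N) abel_part T f r k) (word_op T w z)) =
    (fun N => \sum_(k < N) \sum_(v : k.-tuple 'I_n)
       (dilate n r (f (vacuum R n)) v : R[i]) *: L (e v)).
  apply/funext => N; rewrite bop_sum; apply: eq_bigr => k _.
  rewrite /abel_part bop_sum; apply: eq_bigr => v _.
  rewrite bcompE rmul_basis (poisson_adj_basis _ KP) word_op_cat bcompE bopZ.
  by rewrite dilateE// size_tuple.
by rewrite E.
Qed.

Lemma defect_admissible h : admissible T (defect T h).
Proof.
have PA := defect_positive T_contr.
exists (Num.sqrt (qform (defect T) h)); first exact: sqrtr_ge0.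
move=> x; rewrite sqr_sqrtr; last exact: PA.2.
by rewrite mulrC; exact: positive_form_CS.
Qed.

Hypothesis T_cnc : completely_non_coisometric T.

(* The vectors T_w D h, D = 1 - \sum_i T_i T_i^*, span a dense subspace: a vector
   orthogonal to all of them satisfies D T_w^* x = 0 for all w. *)
Lemma abel_cvg f h : toeplitz_algebra f ->
  exists l : H, abel T f r h @[r --> (1 : R)^'-] --> l.
Proof.
move=> fT; pose M := [set y : H | exists l : H, abel T f r y @[r --> (1 : R)^'-] --> l].
suff MT : M = setT by have : M h by rewrite MT.
have fb : \forall r \near (1 : R)^'-, forall y, hnorm (abel T f r y) <= (opnorm f + 1) * hnorm y.
  apply: filterS (at_left1_itv R) => r r01 y.
  apply: le_trans (opnorm_le _ _) _; rewrite ler_wpM2r ?hnorm_ge0//.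
  by apply: le_trans (opnorm_abel fT r01) _; rewrite lerDl.
have f1 : 0 < opnorm f + 1 by rewrite ltr_wpDl ?opnorm_ge0.
apply: closed_submodule_full.
- by exists 0; under eq_fun do rewrite linear0; exact: cvg_cst.
- move=> a x y [l xl] [l' yl']; exists (a *: l + l').
  under eq_fun do rewrite linearP; apply: cvgD => //; exact: cvgZr.
- move=> x xM; apply: hcvg_cauchy => d d0; have d20 : 0 < d / 2 by rewrite divr_gt0.
  have [y [l /hcvgP yl] xy] := xM _ (divr_gt0 d20 f1).
  exists l; apply: filterS2 fb (yl _ d20) => r fr lr.
  have -> : l - abel T f r x = (l - abel T f r y) - abel T f r (x - y).
    by rewrite linearB /= opprB addrA subrK.
  apply: le_lt_trans (hnormD _ _) _; rewrite hnormN [d]splitr; apply: ltrD => //.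
  by apply: le_lt_trans (fr _) _; rewrite mulrC -ltr_pdivlMr.
move=> x xM; apply: contrapT => x0; apply: T_cnc; exists x; split; first exact/eqP.
have q0 w : qform (defect T) (adj (word_op T w) x) = 0.
  have : M (word_op T w (defect T (adj (word_op T w) x))).
    exact: abel_word_cvg (defect_admissible _).
  by move=> /xM; rewrite adjP hdotC => /(congr1 (@complex.Re R)); rewrite ReJ.
(* With no defect at any T_w^* x, the telescoping sum becomes the equality forbidden by complete
   non-coisometry. *)
move=> k _; have := sum_defect T k x; rewrite big1 => [/eqP|w _]; last exact: q0.
by rewrite eq_sym subr_eq0 => /eqP.
Qed.

Lemma sot_calculusP f h : toeplitz_algebra f ->
  abel T f r h @[r --> (1 : R)^'-] --> sot_calculus T f h.
Proof.
move=> fT; have [|X XP] := @pointwise_limit_bop _ _ _ _ _ _ (abel T f) (opnorm f) _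
    (fun h => abel_cvg h fT).
  apply: filterS (at_left1_itv R) => r r01 y.
  apply: le_trans (opnorm_le _ _) _; rewrite ler_wpM2r ?hnorm_ge0//.
  exact: opnorm_abel.
have E (Y : bop H H) :
    (forall h, lim (series (fun k => \sum_(w : k.-tuple 'I_n)
           ((r ^+ k)%:C * fourier f w) *: word_op T w h) @ \oo)
      @[r --> (1 : R)^'-] --> Y h) <-> (forall h, abel T f r h @[r --> (1 : R)^'-] --> Y h).
  by split=> YP g; apply: hcvg_near_eq (YP g);
    apply: filterS (at_left1_itv R) => r r01; rewrite abel_lim.
rewrite /sot_calculus; case: xgetP => [Y _ /E|/(_ X) nX]; first exact.
by exfalso; apply: nX; exact/E.
Qed.

Lemma sot_calculus_seq f h : toeplitz_algebra f ->
  abel T f (radius R l) h @[l --> \oo] --> sot_calculus T f h.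
Proof.
move=> fT; have /hcvgP fh := @sot_calculusP f h fT.
by apply/hcvgP => d d0; exact: radius_at_left (fh d d0).
Qed.

End SotCalculus.

(** * Estimates relative to a coinvariant subspace *)

Section CoinvariantBounds.
Context (R : realType) (n k m : nat) (H : hilbertType R) (T : 'I_n -> bop H H).
Local Notation F2 := (fock R n).
Hypothesis T_contr : row_contraction T.

(* The subspace E of the full Fock space is either the whole space or, when the
   T_i commute, the symmetric Fock space. *)
Variable E : set F2.
Hypothesis ET : forall f x, toeplitz_algebra f -> E x -> E (adj f x).
Hypothesis E0 : E 0.
Hypothesis ED : forall x y, E x -> E y -> E (x + y).
Hypothesis Er : forall q x, E x ->
  E (restr (complex_line R) (fun w : seq 'I_n => (q <= size w)%N) x).
Hypothesis EK : forall r z K h, poisson (scale_tuple T r) z K -> E (K h).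

(** Since K h lies in E, the bound is asked there: the symmetric vectors give von Neumann's
    inequality with the B_i in place of the S_i. It is shown for r T and passed to r -> 1. *)
Lemma von_neumann p (C : R) : 0 <= C ->
  (forall x, E x -> hnorm (adj (nceval (@creation R n) p) x) <= C * hnorm x) ->
  opnorm (nceval T p) <= C.
Proof.
move=> C0 pC; apply: opnorm_bound => // h.
have lim : hnorm (nceval (scale_tuple T (radius R l)) p h) @[l --> \oo] --> hnorm (nceval T p h).
  by apply: cvg_hnorm; exact: nceval_scale_cvg.
apply: (cvg_le_bound lim); near=> l.
rewrite -[nceval (scale_tuple _ _) p]adjK; apply: hnorm_adj_le => // y.
apply: (intertwines_le (scale_row_contraction T_contr (radius_itv R l))
  (scale_pure T_contr (radius_itv R l)) (@nceval_intertwines R n H (scale_tuple T (radius R l))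
    p) C0) => z K g KP.
by apply: pC; exact: EK KP.
Unshelve. all: by end_near. Qed.

Lemma poly_word_bound (P : 'I_k -> 'I_m -> 'I_m -> ncpoly R n) (C : R) : 0 <= C ->
  (forall j a b, nceval (@creation R n) (P j a b) (vacuum R n) [::] = 0) ->
  (forall x : hsum 'I_m F2, (forall a, E (x a)) ->
     \sum_j hnorm (adj (mx_op (\matrix_(a, b) nceval (@creation R n) (P j a b))) x) ^+ 2
       <= C ^+ 2 * hnorm x ^+ 2) ->
  word_bound T (fun j => mx_op (\matrix_(a, b) nceval T (P j a b))) C.
Proof.
move=> C0 P0 PC; apply: (@word_bound_limit _ _ _ _ _ _
  (fun l j => mx_op (\matrix_(a, b) nceval (scale_tuple T (radius R l)) (P j a b))) _
  (fun=> C)) => //; last exact: cvg_cst.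
- move=> j x; apply: mx_op_cvg => a b g; rewrite mxE; under eq_fun do rewrite mxE.
  exact: nceval_scale_cvg.
- move=> l; have r01 := radius_itv R l; apply: (scale_word_bound r01).
  apply: (@pure_word_bound _ _ _ _ _ _ _ _ E C (scale_row_contraction T_contr r01)
    (scale_pure T_contr r01) _ _ _ ET E0 ED Er _ PC).
  + by move=> j a b; rewrite mxE; exact: nceval_toeplitz.
  + by move=> j a b; rewrite mxE.
  + by move=> j a b; rewrite !mxE; exact: nceval_intertwines.
  + by move=> z K h; exact: EK.
Qed.

Lemma sot_word_bound (F : 'I_k -> 'M[bop F2 F2]_m) (C : R) : 0 <= C ->
  completely_non_coisometric T ->
  (forall j a b, toeplitz_algebra (F j a b)) ->
  (forall j a b, F j a b (vacuum R n) [::] = 0) ->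
  (forall x : hsum 'I_m F2, (forall a, E (x a)) ->
     \sum_j hnorm (adj (mx_op (F j)) x) ^+ 2 <= C ^+ 2 * hnorm x ^+ 2) ->
  word_bound T (fun j => mx_op (map_mx (sot_calculus T) (F j))) C.
Proof.
move=> C0 T_cnc FT F0 FC; apply: (@word_bound_limit _ _ _ _ _ _
  (fun l j => mx_op (map_mx (fun f => abel T f (radius R l)) (F j))) _
  (fun=> C)) => //; last exact: cvg_cst.
- move=> j x; apply: mx_op_cvg => a b g; rewrite mxE; under eq_fun do rewrite mxE.
  exact: sot_calculus_seq.
- move=> l; have r01 := radius_itv R l; apply: (scale_word_bound r01).
  apply: (@pure_word_bound _ _ _ _ _ _ _ _ E C (scale_row_contraction T_contr r01)
    (scale_pure T_contr r01) FT F0 _ ET E0 ED Er _ FC).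
  + by move=> j a b; rewrite mxE; exact: abel_intertwines.
  + by move=> z K h; exact: EK.
Qed.

End CoinvariantBounds.

Lemma bop_subr_eq0 (R : realType) (H K : hilbertType R) (f : bop H K) u v :
  f u = f v -> f (u - v) = 0.
Proof. by move=> uv; rewrite linearB /= uv subrr. Qed.

(** * The symmetric Fock space and compressions *)

Section SymmetricFock.
Context (R : realType) (n : nat).
Local Notation F2 := (fock R n).
Local Notation e w := (fock_basis R w).
Local Notation S := (@creation R n).
Local Notation SF := (sym_fock R n).
Implicit Types (f g : bop F2 F2) (x y : F2).

Definition symmetric x := forall v w : seq 'I_n, perm_eq v w -> x v = x w.

Lemma symmetricD x y : symmetric x -> symmetric y -> symmetric (x + y).
Proof. by move=> xs ys v w vw; rewrite !hsumD_coord (xs _ _ vw) (ys _ _ vw). Qed.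

Lemma symmetric_restr q x : symmetric x ->
  symmetric (restr (complex_line R) (fun w : seq 'I_n => (q <= size w)%N) x).
Proof. by move=> xs v w vw; rewrite !restrE (perm_size vw) (xs _ _ vw). Qed.

Let perp y := forall x, symmetric x -> hdot y x = 0.

Let toeplitz_perp f y : toeplitz_algebra f -> perp y -> perp (f y).
Proof.
move=> fT yP x xs.
(* Orthogonality <f y, x> = 0 is put in the form required by [wot_closed_eq] by writing 0 as <f 0,
   x>. Letting the pair range over all of I makes the condition stable under products. *)
pose I := {p : F2 * F2 | `[< perp p.1 /\ symmetric p.2 >]}.
have tP : `[< perp (y, x).1 /\ symmetric (y, x).2 >] by apply/asboolP.
have -> : 0 = hdot (f 0) x by rewrite linear0 hdot0l.
have := @toeplitz_ind R n _ _ (@wot_closed_eq R _ I (fun t => (val t).1) (fun t => (val t).2)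
  (fun=> 0) (fun t => (val t).2)) _ _ f fT (exist _ (y, x) tP).
apply=> [c g h gP hP||i].
- split=> t; have [t1 t2] := asboolP _ (valP t).
    change (hdot ((c *: g + h) (val t).1) (val t).2 = hdot ((c *: g + h) 0) (val t).2).
    by rewrite !bopD !bopZ !hdotDl !hdotZl (gP t) (hP t).
  change (hdot (g (h (val t).1)) (val t).2 = hdot (g (h 0)) (val t).2).
  have hp : perp (h (val t).1).
    move=> z zs; have pP : `[< perp ((val t).1, z).1 /\ symmetric ((val t).1, z).2 >] by
      apply/asboolP.
    have := hP (exist _ ((val t).1, z) pP).
    by rewrite [hdot (h 0) _](_ : _ = 0) ?linear0 ?hdot0l.
  have pP : `[< perp (h (val t).1, (val t).2).1 /\ symmetric (h (val t).1, (val t).2).2 >] by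
    apply/asboolP.
  have := gP (exist _ (h (val t).1, (val t).2) pP).
  by rewrite [h 0]linear0.
- move=> t; have [t1 t2] := asboolP _ (valP t).
  change (hdot (val t).1 (val t).2 = hdot 0 (val t).2).
  by rewrite hdot0l t1.
- move=> t; have [t1 t2] := asboolP _ (valP t).
  change (hdot (S i (val t).1) (val t).2 = hdot (S i 0) (val t).2).
  rewrite linear0 hdot0l adjP t1// => v w vw.
  by rewrite !adj_creationE; apply: t2; rewrite perm_cons.
Qed.

(** Symmetry of a vector is orthogonality to all e_v - e_w with w a permutation of v. These
    differences are orthogonal to the symmetric vectors, and f preserves that complement. *)
Lemma symmetric_adj f x : toeplitz_algebra f -> symmetric x -> symmetric (adj f x).
Proof.
move=> fT xs v w vw; apply/eqP; rewrite -subr_eq0 -!hdot_basis -hdotNr -hdotDr -adjPr.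
rewrite hdotC toeplitz_perp ?conjC0// => z zs.
by rewrite hdotC hdotDr hdotNr !hdot_basis (zs _ _ vw) subrr conjC0.
Qed.

Lemma symmetric_lift x : symmetric x -> exists x' : SF, sym_incl R n x' = x.
Proof.
by move=> xs; have xP : x \in @symmetric_tensors R n by [apply/asboolP]; exists (SymFock xP).
Qed.

Lemma sym_incl_symmetric (x : SF) : symmetric (sym_incl R n x).
Proof. by have /asboolP := valP x. Qed.

Lemma hdot_sym_incl (x y : SF) : hdot (sym_incl R n x) (sym_incl R n y) = hdot x y.
Proof. by []. Qed.

Lemma hnorm_sym_incl (x : SF) : hnorm (sym_incl R n x) = hnorm x.
Proof. by rewrite sym_hnorm. Qed.

Lemma sym_projE : sym_proj R n = adj (sym_incl R n).
Proof.
rewrite /sym_proj; case: xgetP => [P _ PP|/(_ (adj (sym_incl R n))) nP].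
  apply: bop_ext => x; apply: hdot_ext => y; congr (complex.Re _).
  rewrite -adjPr -hdot_sym_incl; apply/esym/eqP.
  by rewrite -subr_eq0 -hdotNl -hdotDl; apply/eqP; exact: PP.
exfalso; apply: nP => x y /=.
by rewrite hdotDl hdotNl hdot_sym_incl -adjPr subrr.
Qed.

Lemma adj_sym_inclK (x : SF) : adj (sym_incl R n) (sym_incl R n x) = x.
Proof. by apply: hdot_ext => y; rewrite -adjPr hdot_sym_incl. Qed.

Lemma sym_incl_adj f (x : SF) : toeplitz_algebra f ->
  sym_incl R n (adj (compression f) x) = adj f (sym_incl R n x).
Proof.
move=> fT; have [y yE] := symmetric_lift (symmetric_adj fT (sym_incl_symmetric x)).
rewrite /compression sym_projE !adj_comp adjK !bcompE -yE.
by rewrite adj_sym_inclK.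
Qed.

Lemma compressionD f g : compression (f + g) = compression f + compression g.
Proof. by apply: bop_ext => x; rewrite /compression bopD !bcompE bopD linearD. Qed.

Lemma compressionZ c f : compression (c *: f) = c *: compression f.
Proof. by apply: bop_ext => x; rewrite /compression bopZ !bcompE bopZ linearZ. Qed.

(** Adjoints of compressions are restrictions to a coinvariant subspace, and restrictions
    compose. *)
Lemma compressionM f g : toeplitz_algebra f -> toeplitz_algebra g ->
  compression (f \ob g) = compression f \ob compression g.
Proof.
move=> fT gT; apply: adj_inj; apply: bop_ext => x; rewrite adj_comp bcompE.
rewrite -[LHS]adj_sym_inclK -[RHS]adj_sym_inclK; congr (adj _ _).
rewrite !sym_incl_adj//; last exact: (toeplitz_subalgebra 0 fT gT).2.
by rewrite adj_comp.
Qed.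

Lemma compression_nceval p :
  compression (nceval S p) = nceval (@sym_creation R n) p.
Proof.
elim: p => [|t p IHp].
  by rewrite /nceval !big_nil; apply: bop_ext => x; rewrite /compression !bcompE bop0 linear0.
rewrite !nceval_cons compressionD compressionZ IHp; congr (_ *: _ + _).
have wT w : toeplitz_algebra (word_op S w).
  elim: w => [|i w IHw]; first exact: toeplitz_id.
  exact: (toeplitz_subalgebra 0 (@toeplitz_creation R n i) IHw).2.
elim: t.2 => [|i w IHw].
  by apply: bop_ext => x; rewrite /compression sym_projE !bcompE /= adj_sym_inclK.
by rewrite word_op_cons compressionM ?IHw//; exact: toeplitz_creation.
Qed.

(** On symmetric vectors the adjoints of F and of its compression agree, so the norm of the
    compressed row suffices and the norm of the lift does not appear. *)
Lemma compression_row_bound k m (F : 'I_k -> 'M[bop F2 F2]_m) (x : hsum 'I_m F2) :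
  (forall j a b, toeplitz_algebra (F j a b)) -> (forall a, symmetric (x a)) ->
  \sum_j hnorm (adj (mx_op (F j)) x) ^+ 2 <=
    row_norm (fun j => mx_op (map_mx (@compression R n) (F j))) ^+ 2 * hnorm x ^+ 2.
Proof.
move=> FT xs; have /choice[y yx] a := symmetric_lift (xs a).
have [x' x'E] := hsum_of y.
have -> : hnorm x ^+ 2 = hnorm x' ^+ 2.
  by rewrite !hnorm_fin; apply: eq_bigr => a _; rewrite x'E -yx hnorm_sym_incl.
apply: le_trans (row_norm_adj _ _); apply: ler_sum => j _.
rewrite !hnorm_fin; apply: ler_sum => b _; rewrite !adj_mx_opE.
rewrite -hnorm_sym_incl bop_sum_arg le_eqVlt; apply/orP; left; apply/eqP.
congr (hnorm _ ^+ 2); apply: eq_bigr => a _.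
by rewrite mxE sym_incl_adj// x'E yx.
Qed.

Section CommutingTuples.
Context (H : hilbertType R) (T : 'I_n -> bop H H).
Hypothesis T_comm : forall i j, T i \ob T j = T j \ob T i.

Lemma word_op_perm v w : perm_eq v w -> word_op T v = word_op T w.
Proof.
have comm i u : T i \ob word_op T u = word_op T u \ob T i.
  elim: u => [|j u IHu]; first exact: bop_ext.
  apply: bop_ext => x; rewrite !word_op_cons !bcompE.
  have /(congr1 (fun g : bop H H => g x)) := IHu; rewrite !bcompE => <-.
  by have /(congr1 (fun g : bop H H => g (word_op T u x))) := T_comm i j.
elim: v w => [|i v IHv] w vw.
  by move: vw; rewrite perm_sym => /perm_nilP ->.
have iw : i \in w by rewrite -(perm_mem vw) mem_head.
case/splitPr: iw vw => w1 w2; rewrite perm_sym perm_catC /= perm_cons => vw.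
transitivity (T i \ob word_op T (w1 ++ w2)).
  by rewrite -(IHv (w1 ++ w2))// perm_sym perm_catC.
apply: bop_ext => x; rewrite (word_op_cat T w1 (i :: w2)) (word_op_cat T w1 w2) (word_op_cons T
  i w2) !bcompE.
by have /(congr1 (fun g : bop H H => g (word_op T w2 x))) := comm i w1.
Qed.

Lemma scale_comm r i j : scale_tuple T r i \ob scale_tuple T r j = scale_tuple T r j \ob
  scale_tuple T r i.
Proof.
apply: bop_ext => x; rewrite !bcompE !bopZ !linearZ /=; congr (_ *: (_ *: _)).
by have /(congr1 (fun g : bop H H => g x)) := T_comm i j.
Qed.

Lemma poisson_symmetric z K h : poisson T z K -> symmetric (K h).
Proof. by move=> KP v w vw; rewrite !KP (word_op_perm vw). Qed.

End CommutingTuples.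

(** [poisson_domination] with C = 0: K h is symmetric, f^* and g^* agree there, so every K
    annihilates the difference of the adjoints applied to h. *)
Lemma abel_compression (H : hilbertType R) (T : 'I_n -> bop H H) f g r :
  row_contraction T -> (forall i j, T i \ob T j = T j \ob T i) -> 0 <= r < 1 ->
  toeplitz_algebra f -> toeplitz_algebra g -> compression f = compression g ->
  abel T f r = abel T g r.
Proof.
move=> T_contr T_comm r01 fT gT fg; apply: adj_inj; apply: bop_ext => h.
apply/eqP; rewrite -subr_eq0; apply/eqP/hnorm_eq0/eqP; rewrite -sqrf_eq0.
apply/eqP/le_anti; rewrite sqr_ge0 andbT.
have := @poisson_domination _ _ _ (scale_tuple T r) (scale_row_contraction T_contr r01) 'I_1 'I_1
  (fun=> h) (fun=> adj (abel T f r) h - adj (abel T g r) h) 0 (scale_pure T_contr r01) (lexx 0).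
rewrite !big_ord1 mul0r; apply=> z K KP; rewrite !big_ord1 mul0r.
have Kf := abel_intertwines T_contr fT r01 KP h.
have Kg := abel_intertwines T_contr gT r01 KP h.
have [x xE] := symmetric_lift (poisson_symmetric (scale_comm T_comm r) h KP).
suff -> : K (adj (abel T f r) h - adj (abel T g r) h) = 0 by rewrite hnorm0 expr0n.
rewrite -xE -!sym_incl_adj// fg in Kf Kg.
exact: bop_subr_eq0 (etrans Kf (esym Kg)).
Qed.

End SymmetricFock.

(** * The inequality for each of the four algebras *)

Section Main.
Context (R : realType) (H : hilbertType R) (n m k : nat) (T : 'I_n -> bop H H).
Hypothesis T_contr : row_contraction T.
Local Notation F2 := (fock R n).
Local Notation S := (@creation R n).
Local Notation B := (@sym_creation R n).

Lemma hdot_vacuum : hdot (vacuum R n) (vacuum R n) = 1.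
Proof. by rewrite hdot_basis basisE. Qed.

Lemma disc_omega_bound (F : 'I_k -> 'M[bop F2 F2]_m) :
  (forall j a b, disc_algebra (F j a b)) ->
  (forall j, mx_at0 (vacuum R n) (F j) = 0) ->
  omega_bound T (norm_calculus S T) F.
Proof.
apply: norm_calculus_omega_bound => // [|p|P P0]; first exact: hdot_vacuum.
  apply: (@von_neumann R n H T T_contr setT) => //; first exact: opnorm_ge0.
  by move=> x _; rewrite -opnorm_adj opnorm_le.
apply: (@poly_word_bound R n k m H T T_contr setT) => //; first exact: row_norm_ge0.
  by move=> j a b; rewrite -hdot_basis; exact: P0.
by move=> x _; exact: row_norm_adj.
Qed.

Lemma toeplitz_omega_bound (F : 'I_k -> 'M[bop F2 F2]_m) :
  completely_non_coisometric T ->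
  (forall j a b, toeplitz_algebra (F j a b)) ->
  (forall j, mx_at0 (vacuum R n) (F j) = 0) ->
  omega_bound T (sot_calculus T) F.
Proof.
move=> T_cnc FT F0; apply: word_bound_omega; first exact: row_norm_ge0.
apply: (@sot_word_bound R n k m H T T_contr setT) => //; first exact: row_norm_ge0.
  by move=> j a b; have /matrixP/(_ a b) := F0 j; rewrite !mxE hdot_basis.
by move=> x _; exact: row_norm_adj.
Qed.

(** Level k = 1 already contradicts the row bound. *)
Lemma row_norm_lt1_cnc : row_norm T < 1 -> completely_non_coisometric T.
Proof.
move=> T1 [h [h0 /(_ 1%N isT)]].
rewrite (sum_tupleS _ (fun w => hnorm (adj (word_op T w) h) ^+ 2)).
under eq_bigr do rewrite (sum_tuple0 (fun w => hnorm (adj (word_op T (_ :: w)) h) ^+ 2))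
  adj_word_op_cons adj_word_op_nil.
move=> hE; have := row_norm_adj T h; rewrite hE; apply/negP; rewrite -ltNge.
have hp : 0 < hnorm h ^+ 2.
  rewrite exprn_gt0// lt_def hnorm_ge0 andbT; apply: contra_neq h0; exact: hnorm_eq0.
by rewrite gtr_pMl// expr_lt1// row_norm_ge0.
Qed.

Hypothesis T_comm : forall i j, T i \ob T j = T j \ob T i.

Let sym_poisson r z K h : poisson (scale_tuple T r) z K -> symmetric (K h).
Proof. by move=> KP; exact: (poisson_symmetric (scale_comm T_comm r) h KP). Qed.

(** The vacuum is symmetric, so f(0) survives compression and F(0) = 0 passes to every lift. *)
Lemma hdot_sym_vacuum (f : bop F2 F2) :
  hdot (compression f (sym_vacuum R n)) (sym_vacuum R n) = f (vacuum R n) [::].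
Proof. by rewrite /compression sym_projE !bcompE -adjPr hdot_basis. Qed.

Lemma sym_disc_omega_bound (F : 'I_k -> 'M[bop (sym_fock R n) (sym_fock R n)]_m) :
  (forall j a b, sym_disc_algebra (F j a b)) ->
  (forall j, mx_at0 (sym_vacuum R n) (F j) = 0) ->
  omega_bound T (norm_calculus B T) F.
Proof.
apply: norm_calculus_omega_bound => // [|p|P P0].
- by rewrite -hdot_sym_incl hdot_vacuum.
- apply: (@von_neumann R n H T T_contr (@symmetric R n)) => //; first exact: opnorm_ge0.
  move=> x /symmetric_lift[y <-]; rewrite -sym_incl_adj; last exact: nceval_toeplitz.
  by rewrite !hnorm_sym_incl compression_nceval -opnorm_adj opnorm_le.
apply: (@poly_word_bound R n k m H T T_contr (@symmetric R n)) => //.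
- exact: symmetric_adj.
- exact: symmetricD.
- exact: symmetric_restr.
- exact: row_norm_ge0.
- by move=> j a b; rewrite -hdot_sym_vacuum compression_nceval; exact: P0.
- move=> x xs; have FT j a b : toeplitz_algebra ((\matrix_(a, b) nceval S (P j a b) : 'M_m) a b).
    by rewrite mxE; exact: nceval_toeplitz.
  have := compression_row_bound FT xs.
  have -> // : (fun j => mx_op (map_mx (@compression R n) (\matrix_(a, b) nceval S (P j a b)))) =
    (fun j => mx_op (\matrix_(a, b) nceval B (P j a b))).
  by apply/funext => j; congr mx_op; apply/matrixP => a b; rewrite !mxE compression_nceval.
Qed.

(** Lifts of the same operator have equal f(rT) for every r < 1, hence equal limits. *)
Lemma sym_sot_calculusE (f : bop F2 F2) : completely_non_coisometric T -> toeplitz_algebra f ->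
  sym_sot_calculus T (compression f) = sot_calculus T f.
Proof.
move=> T_cnc fT.
have fE g : toeplitz_algebra g -> compression g = compression f -> sot_calculus T g =
  sot_calculus T f.
  move=> gT gf; apply: bop_ext => h.
  have Lg := @sot_calculusP _ _ _ _ T_contr T_cnc g h gT.
  have Lf := @sot_calculusP _ _ _ _ T_contr T_cnc f h fT.
  apply: hcvg_unique Lg _; apply: hcvg_near_eq Lf.
  apply: filterS (at_left1_itv R) => r r01.
  by rewrite (abel_compression T_contr T_comm r01 gT fT gf).
rewrite /sym_sot_calculus; case: xgetP => [X _ XP|/(_ (sot_calculus T f)) nX].
  by rewrite -(XP f fT erefl).
by exfalso; apply: nX => g gT gf; exact: fE.
Qed.

Lemma sym_toeplitz_omega_bound (F : 'I_k -> 'M[bop (sym_fock R n) (sym_fock R n)]_m) :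
  completely_non_coisometric T ->
  (forall j a b, sym_toeplitz_algebra (F j a b)) ->
  (forall j, mx_at0 (sym_vacuum R n) (F j) = 0) ->
  omega_bound T (sym_sot_calculus T) F.
Proof.
move=> T_cnc FT F0.
(* The entries can be lifted independently and arbitrarily, because only the compressions of the
   lifts are measured. *)
have /choice[f0 f0P] : forall t : 'I_k * 'I_m * 'I_m, exists f,
    toeplitz_algebra f /\ compression f = F t.1.1 t.1.2 t.2.
  by move=> t; have [f fT fF] := FT t.1.1 t.1.2 t.2; exists f.
pose f j := \matrix_(a, b) f0 (j, a, b).
have fT j a b : toeplitz_algebra (f j a b) by rewrite mxE; have [] := f0P (j, a, b).
have fF j : map_mx (@compression R n) (f j) = F j.
  by apply/matrixP => a b; rewrite !mxE; have [] := f0P (j, a, b).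
apply: word_bound_omega; first exact: row_norm_ge0.
have -> : (fun j => mx_op (map_mx (sym_sot_calculus T) (F j))) =
    (fun j => mx_op (map_mx (sot_calculus T) (f j))).
  apply/funext => j; congr mx_op; apply/matrixP => a b.
  by rewrite -fF !mxE sym_sot_calculusE//; have [] := f0P (j, a, b).
apply: (@sot_word_bound R n k m H T T_contr (@symmetric R n)) => //.
- exact: symmetric_adj.
- exact: symmetricD.
- exact: symmetric_restr.
- exact: row_norm_ge0.
- move=> j a b; rewrite -hdot_sym_vacuum.
  by have /matrixP/(_ a b) := F0 j; rewrite -fF !mxE.
- move=> x xs; have := compression_row_bound fT xs.
  have -> // : (fun j => mx_op (map_mx (@compression R n) (f j))) = (fun j => mx_op (F j)).
  by apply/funext => j; rewrite fF.
Qed.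

End Main.

Theorem theorem1p7 (R : realType) (H : hilbertType R) (n m k : nat)
    (n_gt0 : (0 < n)%N) (m_gt0 : (0 < m)%N) (k_gt0 : (0 < k)%N)
    (T : 'I_n -> bop H H) (T_contr : row_contraction T) :
  (* (i) *)
  (forall F : 'I_k -> 'M[bop (fock R n) (fock R n)]_m,
     (forall j a b, disc_algebra (F j a b)) ->
     (forall j, mx_at0 (vacuum R n) (F j) = 0) ->
     omega_bound T (norm_calculus (@creation R n) T) F) /\
  (* (ii) *)
  ((completely_non_coisometric T ->
    forall F : 'I_k -> 'M[bop (fock R n) (fock R n)]_m,
      (forall j a b, toeplitz_algebra (F j a b)) ->
      (forall j, mx_at0 (vacuum R n) (F j) = 0) ->
      omega_bound T (sot_calculus T) F) /\
   (row_norm T < 1 -> completely_non_coisometric T)) /\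
  (* (iii) *)
  ((forall i j, T i \ob T j = T j \ob T i) ->
   (forall F : 'I_k -> 'M[bop (sym_fock R n) (sym_fock R n)]_m,
      (forall j a b, sym_disc_algebra (F j a b)) ->
      (forall j, mx_at0 (sym_vacuum R n) (F j) = 0) ->
      omega_bound T (norm_calculus (@sym_creation R n) T) F) /\
   (completely_non_coisometric T ->
    forall F : 'I_k -> 'M[bop (sym_fock R n) (sym_fock R n)]_m,
      (forall j a b, sym_toeplitz_algebra (F j a b)) ->
      (forall j, mx_at0 (sym_vacuum R n) (F j) = 0) ->
      omega_bound T (sym_sot_calculus T) F)).
Proof.
split; first by move=> F; exact: disc_omega_bound.
split; first by split=> [T_cnc F|]; [exact: toeplitz_omega_bound|exact: row_norm_lt1_cnc].
move=> T_comm; split=> [F|T_cnc F]; first exact: sym_disc_omega_bound.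
exact: sym_toeplitz_omega_bound.
Qed.
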